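(* Let $k\in\mathbb N_0^2\setminus\{0\}$, $a_k\in\mathbb C$, and let $\xi_k=a_ke_k+\overline{a_k}e_{-k}+(-1)^{k_2+1}\overline{a_k}e_{\bar k}+(-1)^{k_2+1}a_ke_{-\bar k}$ be nonzero. Then the normalized Ricci curvature of $\mathrm{SDiff}(\mathbb K)$ in the direction $\xi_k$ is $$\mathrm{Ric}(\xi_k)=-\frac{3\|k\|^2}{8S_{\mathbb T}}=-\frac{3\|k\|^2}{16S_{\mathbb K}}.$$
   Context: $\mathbb T=\mathbb R^2/(2\pi\mathbb Z)^2$ (area $S_{\mathbb T}=4\pi^2$), $I(x_1,x_2)=(2\pi-x_1,\pi+x_2)$, $\mathbb K=\mathbb T/I$ (area $S_{\mathbb K}=S_{\mathbb T}/2$). The Lie algebra of $\mathrm{SDiff}(\mathbb K)$ is identified with real smooth zero-mean $f$ on $\mathbb T$ with $f\circ I=-f$, bracket $\{f,g\}=\partial_{x_2}f\partial_{x_1}g-\partial_{x_1}f\partial_{x_2}g$, inner product $\langle f,g\rangle=\int_{\mathbb T}\nabla f\cdot\nabla g\,dx_1dx_2$; sectional curvature $C(u,v)=\langle R(u,v)u,v\rangle/(\langle u,u\rangle\langle v,v\rangle-\langle u,v\rangle^2)$ with $R(u,v)w=-\nabla_u\nabla_vw+\nabla_v\nabla_uw+\nabla_{\{u,v\}}w$, $\nabla_uv=\frac12(\{u,v\}-B(u,v)-B(v,u))$, $\langle B(u,v),w\rangle=\langle u,\{v,w\}\rangle$. Basis $\mathcal B$: with $J^{\Re}=\{l\in\mathbb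 N_0^2\mid l\neq(n,0),\ l\neq(0,2n)\ \forall n\in\mathbb N_0\}$, $J^{\Im}=\{l\in\mathbb N_0^2\mid l\neq(0,2n)\ \forall n\in\mathbb N_0\}$, $\mathcal B$ consists of $4\cos(l_1x_1)\cos(l_2x_2)$ ($l\in J^{\Re}$, $l_2$ odd), $4\cos(l_1x_1)\sin(l_2x_2)$ ($l\in J^{\Im}$, $l_2$ odd), $4\sin(l_1x_1)\sin(l_2x_2)$ ($l\in J^{\Re}$, $l_2$ even), $4\sin(l_1x_1)\cos(l_2x_2)$ ($l\in J^{\Im}$, $l_2$ even); each has Laplace eigenvalue $-\|l\|^2$. $\mathcal B_R$ is the set of elements of $\mathcal B$ with $\|l\|\le R$. Normalized Ricci curvature: $\mathrm{Ric}(\xi)=\lim_{R\to\infty}\frac{1}{|\mathcal B_R|-1}\sum_{\mathcal E\in\mathcal B_R,\ \mathcal E\notin\mathbb R\xi}C(\xi,\mathcal E)$ ($R$ running over positive integers). $e_k=e^{i(k_1x_1+k_2x_2)}$, $\bar k=(k_1,-k_2)$, $\|k\|^2=k_1^2+k_2^2$. *)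

(* Defs.v *)
From Stdlib Require Import Reals List Arith Bool ClassicalEpsilon ClassicalDescription.
From Coquelicot Require Import Coquelicot.
Open Scope R_scope.

Definition fn2 := R -> R -> R.

Definition d1 (f : fn2) : fn2 := fun x y => Derive (fun t => f t y) x.
Definition d2 (f : fn2) : fn2 := fun x y => Derive (fun t => f x t) y.

Definition iterD (w : list bool) (f : fn2) : fn2 :=
  fold_right (fun (b : bool) (g : fn2) => if b then d1 g else d2 g) f w.

Definition Smooth (f : fn2) : Prop :=
  forall w : list bool,
    (forall x y, continuous (fun p : R * R => iterD w f (fst p) (snd p)) (x, y)) /\
    (forall x y, ex_derive (fun t => iterD w f t y) x /\
                 ex_derive (fun t => iterD w f x t) y).

Definition intT (f : fn2) : R :=
  RInt (fun x => RInt (fun y => f x y) 0 (2 * PI)) 0 (2 * PI).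

Definition S_T : R := 4 * PI ^ 2.
Definition S_K : R := S_T / 2.

(* Lie algebra of SDiff(K): smooth real functions on T (2pi-periodic),
   with f o I = -f, I(x1,x2) = (2pi - x1, pi + x2), and zero mean. *)
Definition InLie (f : fn2) : Prop :=
  Smooth f /\
  (forall x y, f (x + 2 * PI) y = f x y /\ f x (y + 2 * PI) = f x y) /\
  (forall x y, f (2 * PI - x) (PI + y) = - f x y) /\
  intT f = 0.

Definition ip (f g : fn2) : R :=
  intT (fun x y => d1 f x y * d1 g x y + d2 f x y * d2 g x y).

Definition bracket (f g : fn2) : fn2 :=
  fun x y => d2 f x y * d1 g x y - d1 f x y * d2 g x y.

Definition fadd (f g : fn2) : fn2 := fun x y => f x y + g x y.
Definition fsub (f g : fn2) : fn2 := fun x y => f x y - g x y.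
Definition fopp (f : fn2) : fn2 := fun x y => - f x y.
Definition fscal (c : R) (f : fn2) : fn2 := fun x y => c * f x y.

Definition Bop (u v : fn2) : fn2 :=
  epsilon (inhabits (fun _ _ => 0))
    (fun w => InLie w /\ forall z, InLie z -> ip w z = ip u (bracket v z)).

Definition nabla (u v : fn2) : fn2 :=
  fscal (1 / 2) (fsub (fsub (bracket u v) (Bop u v)) (Bop v u)).

Definition Rcurv (u v w : fn2) : fn2 :=
  fadd (fadd (fopp (nabla u (nabla v w))) (nabla v (nabla u w)))
       (nabla (bracket u v) w).

Definition sec (u v : fn2) : R :=
  ip (Rcurv u v u) v / (ip u u * ip v v - ip u v ^ 2).

Inductive btype := ReT | ImT.

Definition inJRe (l1 l2 : nat) : bool :=
  negb (Nat.eqb l2 0) && negb (Nat.eqb l1 0 && Nat.even l2).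
Definition inJIm (l1 l2 : nat) : bool :=
  negb (Nat.eqb l1 0 && Nat.even l2).

Definition basis_fun (l1 l2 : nat) (t : btype) : fn2 :=
  fun x y =>
    match t with
    | ReT => if Nat.odd l2 then 4 * cos (INR l1 * x) * cos (INR l2 * y)
             else 4 * sin (INR l1 * x) * sin (INR l2 * y)
    | ImT => if Nat.odd l2 then 4 * cos (INR l1 * x) * sin (INR l2 * y)
             else 4 * sin (INR l1 * x) * cos (INR l2 * y)
    end.

Definition basis_index (Rn : nat) : list (nat * nat * btype) :=
  flat_map (fun l1 =>
    flat_map (fun l2 =>
      if Nat.leb (l1 * l1 + l2 * l2) (Rn * Rn) then
        (if inJRe l1 l2 then (l1, l2, ReT) :: nil else nil) ++
        (if inJIm l1 l2 then (l1, l2, ImT) :: nil else nil)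
      else nil) (seq 0 (S Rn))) (seq 0 (S Rn)).

Definition B_R (Rn : nat) : list fn2 :=
  map (fun '(l1, l2, t) => basis_fun l1 l2 t) (basis_index Rn).

Definition inLine (xi E : fn2) : Prop := exists c : R, forall x y, E x y = c * xi x y.

Definition ric_partial (xi : fn2) (Rn : nat) : R :=
  / (INR (length (B_R Rn)) - 1) *
  fold_right Rplus 0
    (map (fun E => if excluded_middle_informative (inLine xi E) then 0 else sec xi E)
         (B_R Rn)).

Definition Ric_is (xi : fn2) (l : R) : Prop :=
  is_lim_seq (fun n => ric_partial xi (S n)) l.

Definition ek (k1 k2 : R) (x y : R) : C :=
  (cos (k1 * x + k2 * y), sin (k1 * x + k2 * y)).

(* xi_k = a e_k + conj(a) e_{-k} + (-1)^{k2+1} conj(a) e_{kbar}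
          + (-1)^{k2+1} a e_{-kbar}  (a real-valued function; we take Re) *)
Definition xi_k (k1 k2 : nat) (a : C) : fn2 :=
  fun x y =>
    let s : C := RtoC ((-1) ^ (k2 + 1)) in
    let r1 := INR k1 in let r2 := INR k2 in
    Re (Cplus (Cplus (Cmult a (ek r1 r2 x y)) (Cmult (Cconj a) (ek (- r1) (- r2) x y)))
              (Cplus (Cmult s (Cmult (Cconj a) (ek r1 (- r2) x y)))
                     (Cmult s (Cmult a (ek (- r1) r2 x y))))).

(* Main.v *)
(* With respect to the Laplace eigenvalues -K of xi and -L of a basis element E, and with
   P = {xi, E}, the operators B(xi, E) and B(E, xi) are multiples of lap^-1 P, while
   B(xi, xi) and B(E, E) vanish; the curvature numerator is therefore the quadratic form
   <P, f(-lap) P> in L^2 with f(M) = (K-L)^2/(4M) + (K+L)/2 - 3M/4.  The function P has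
   only the four frequencies (k1 +- l1, k2 +- l2).  If l1 > k1 and l2 > k2 they do not
   interfere, and the pairs k +- l give, with d = k2 l1 - k1 l2 and e = k2 l1 + k1 l2,
     C(xi, E) = - (d^4 + e^4) / (8 pi^2 K L^2) + O(1/L).
   Near the coordinate axes f(M) is of size sqrt L, but its leading part changes sign
   between the two frequencies along the axis, whose coefficients in P nearly agree in
   modulus; so C(xi, E) stays bounded, and these O(R) elements do not affect the mean.

   Up to a term antisymmetric in l1 and l2, (d^4 + e^4)/L^2 is 3 K^2/4 plus a multiple of
   cos(4 theta), theta being the polar angle of l, so it remains to see that cos(4 theta)
   has mean zero over the lattice points of the quarter disk.  By symmetry cos(4 theta)
   may be replaced by 2 cos(theta)^2 cos(4 theta), which is a derivative in the second
   variable, so every column sum is close to a boundary value; as a function of the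
   column, this boundary value is itself a derivative, and the sum is O(R^(3/2)). *)

Require Import Defs.
From Stdlib Require Import Reals List Arith Bool Lra Lia Psatz ZArith.
From Stdlib Require Import ClassicalEpsilon ClassicalDescription FunctionalExtensionality.
From Coquelicot Require Import Coquelicot.
(* [Reals] has projections [d1] and [d2], which hide the partial derivatives. *)
Import Defs.
Open Scope R_scope.

(** * Calculus on the torus *)

(** The operator B is an [epsilon] choice, so its value is known only once its defining relation has
    been solved and the solution shown to be unique. Solving it means inverting the Laplacian on a
    bracket. All computations take place among finite sums of glide-antisymmetric modes, where the
    inverse is explicit because a bracket has no coefficient at frequency zero; no Fourier series
    occurs. Uniqueness is the definiteness of the Dirichlet product.

    The bounds on C(xi, E) in the different regimes are brought to one form, a constant times 1/(l1
    + 1) + 1/(l2 + 1). This weight is bounded below beside the axes, dominates 1/L up to a factor,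
    and has sum O(R^(3/2)) over the quarter disk, while the number of modes grows like R^2. The
    finitely many E with L < 8 K, among them those proportional to xi, need no formula: they only
    enlarge the constant. *)

Definition cont2 (f : fn2) : Prop := forall x y, continuity_2d_pt f x y.

Definition C1 (f : fn2) : Prop :=
  cont2 f /\ cont2 (d1 f) /\ cont2 (d2 f) /\
  (forall x y, ex_derive (fun t => f t y) x /\ ex_derive (fun t => f x t) y).

Lemma C1_ex1 f x y : C1 f -> ex_derive (fun t => f t y) x.
Proof. intros (_ & _ & _ & H); exact (proj1 (H x y)). Qed.

Lemma C1_ex2 f x y : C1 f -> ex_derive (fun t => f x t) y.
Proof. intros (_ & _ & _ & H); exact (proj2 (H x y)). Qed.

Definition per (f : fn2) : Prop :=
  forall x y, f (x + 2 * PI) y = f x y /\ f x (y + 2 * PI) = f x y.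

Definition fmul (f g : fn2) : fn2 := fun x y => f x y * g x y.
Definition lap (f : fn2) : fn2 := fadd (d1 (d1 f)) (d2 (d2 f)).

Lemma fn2_ext (f g : fn2) : (forall x y, f x y = g x y) -> f = g.
Proof. intros H; do 2 (apply functional_extensionality; intro); apply H. Qed.

Ltac fext := apply fn2_ext; intros; unfold fadd, fsub, fopp, fscal, fmul.

Lemma two_pi_pos : 0 < 2 * PI.
Proof. pose proof PI_RGT_0; lra. Qed.

Lemma cont2_y (f : fn2) x y : cont2 f -> continuous (fun t => f x t) y.
Proof.
  intros H. apply continuity_pt_filterlim.
  intros e He. destruct (H x y (mkposreal e He)) as [d Hd].
  exists d; split; [apply cond_pos|]. intros z [_ Hz].
  apply Hd; [rewrite Rminus_diag, Rabs_R0; apply cond_pos | exact Hz].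
Qed.

Lemma cont2_ex_RInt (f : fn2) x a b : cont2 f -> ex_RInt (fun y => f x y) a b.
Proof.
  intros H; apply (ex_RInt_continuous (V := R_CompleteNormedModule)); intros.
  now apply cont2_y.
Qed.

Lemma cont2_add f g : cont2 f -> cont2 g -> cont2 (fadd f g).
Proof. intros Hf Hg x y; now apply continuity_2d_pt_plus. Qed.

Lemma cont2_mul f g : cont2 f -> cont2 g -> cont2 (fmul f g).
Proof. intros Hf Hg x y; now apply continuity_2d_pt_mult. Qed.

Lemma cont2_scal c f : cont2 f -> cont2 (fscal c f).
Proof.
  intros Hf x y; apply (continuity_2d_pt_mult (fun _ _ => c)); [|apply Hf].
  apply continuity_2d_pt_const.
Qed.

Lemma continuous_RInt_param (f : fn2) a b x :
  a <= b -> cont2 f -> continuous (fun x => RInt (fun y => f x y) a b) x.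
Proof.
  intros Hab H. apply continuity_pt_filterlim. intros e He.
  (* The [+ 1] keeps the quotient meaningful for [a = b] and makes the final inequality strict. *)
  assert (Hp : 0 < e / (b - a + 1)) by (apply Rdiv_lt_0_compat; lra).
  destruct (uniform_continuity_2d_1d' f a b x (fun t _ => H x t)
              (mkposreal _ Hp)) as [d Hd].
  exists d; split; [apply cond_pos|]. intros z [_ Hz]. simpl in *.
  unfold R_dist, Rdist in *.
  replace (RInt (fun y => f z y) a b - RInt (fun y => f x y) a b)
    with (RInt (fun y => f z y - f x y) a b).
  2:{ apply (RInt_minus (V := R_CompleteNormedModule)); now apply cont2_ex_RInt. }
  apply Rle_lt_trans with ((b - a) * (e / (b - a + 1))).
  - apply abs_RInt_le_const; [easy| |].
    + apply (ex_RInt_minus (V := R_CompleteNormedModule)); now apply cont2_ex_RInt.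
    + intros t Ht. apply Rlt_le, Hd; try assumption.
      * pose proof (cond_pos d); lra.
      * apply Rabs_def2 in Hz; lra.
      * rewrite Rminus_diag, Rabs_R0; apply cond_pos.
  - apply Rlt_le_trans with ((b - a + 1) * (e / (b - a + 1))).
    + apply Rmult_lt_compat_r; lra.
    + right; field; lra.
Qed.

Lemma ex_RInt_RInt (f : fn2) a b c d :
  c <= d -> cont2 f -> ex_RInt (fun x => RInt (fun y => f x y) c d) a b.
Proof.
  intros Hcd H; apply (ex_RInt_continuous (V := R_CompleteNormedModule)); intros.
  now apply continuous_RInt_param.
Qed.

Lemma intT_ext f g : (forall x y, f x y = g x y) -> intT f = intT g.
Proof. intros H; now rewrite (fn2_ext _ _ H). Qed.

Lemma intT_add f g : cont2 f -> cont2 g -> intT (fadd f g) = intT f + intT g.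
Proof.
  intros Hf Hg. pose proof two_pi_pos. unfold intT.
  rewrite <- (RInt_plus (V := R_CompleteNormedModule));
    [|apply ex_RInt_RInt; [lra|assumption]..].
  apply RInt_ext; intros x _.
  now apply (RInt_plus (V := R_CompleteNormedModule)); apply cont2_ex_RInt.
Qed.

Lemma intT_scal c f : cont2 f -> intT (fscal c f) = c * intT f.
Proof.
  intros Hf. pose proof two_pi_pos. unfold intT.
  rewrite <- (RInt_scal (V := R_CompleteNormedModule));
    [|apply ex_RInt_RInt; [lra|assumption]].
  apply RInt_ext; intros x _.
  now apply (RInt_scal (V := R_CompleteNormedModule)), cont2_ex_RInt.
Qed.

Lemma fsub_eq f g : fsub f g = fadd f (fscal (-1) g).
Proof. fext; ring. Qed.

Lemma intT_sub f g : cont2 f -> cont2 g -> intT (fsub f g) = intT f - intT g.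
Proof.
  intros; rewrite fsub_eq, intT_add, intT_scal; auto using cont2_scal; ring.
Qed.

Lemma intT_sep (g h : R -> R) :
  (forall x, continuous g x) -> (forall x, continuous h x) ->
  intT (fun x y => g x * h y) = RInt g 0 (2 * PI) * RInt h 0 (2 * PI).
Proof.
  intros Hg Hh. unfold intT.
  rewrite (RInt_ext _ (fun x => scal (RInt h 0 (2 * PI)) (g x))).
  - rewrite (RInt_scal (V := R_CompleteNormedModule)).
    + apply Rmult_comm.
    + apply (ex_RInt_continuous (V := R_CompleteNormedModule)); intros; apply Hg.
  - intros x _. rewrite (RInt_scal (V := R_CompleteNormedModule) h).
    + apply Rmult_comm.
    + apply (ex_RInt_continuous (V := R_CompleteNormedModule)); intros; apply Hh.
Qed.

Lemma intT_d2 f : C1 f -> per f -> intT (d2 f) = 0.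
Proof.
  intros Hd Hp. pose proof Hd as (Hc & _ & H2 & _). unfold intT.
  rewrite (RInt_ext _ (fun _ => 0)).
  - rewrite RInt_const; apply Rmult_0_r.
  - intros x _. unfold d2 at 1.
    rewrite (RInt_ext _ (Derive (fun t => f x t))) by reflexivity.
    rewrite RInt_Derive.
    + rewrite <- (proj2 (Hp x 0)), Rplus_0_l. apply Rminus_diag.
    + intros; now apply C1_ex2.
    + intros; now apply (cont2_y (d2 f)).
Qed.

(** Here the derivative is in the outer variable, so it is first pulled out of the inner integral;
    then the fundamental theorem and periodicity apply as for [intT_d2]. *)
Lemma intT_d1 f : C1 f -> per f -> intT (d1 f) = 0.
Proof.
  intros Hd Hp. pose proof Hd as (Hc & H1 & _ & _). unfold intT.
  pose proof two_pi_pos as Hpi.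
  set (G := fun x => RInt (fun y => f x y) 0 (2 * PI)).
  assert (HG : forall x, is_derive G x (RInt (fun y => d1 f x y) 0 (2 * PI))).
  { intros x. apply (is_derive_RInt_param f).
    - apply filter_forall; intros x0 t _; exact (C1_ex1 f x0 t Hd).
    - intros t _; exact (H1 x t).
    - apply filter_forall; intros x0; exact (cont2_ex_RInt f x0 _ _ Hc). }
  rewrite (RInt_ext _ (Derive G)).
  - rewrite RInt_Derive.
    + unfold G. rewrite (RInt_ext _ (fun y => f 0 y)); [apply Rminus_diag|].
      intros y _. rewrite <- (proj1 (Hp 0 y)), Rplus_0_l; reflexivity.
    + intros; eexists; apply HG.
    + intros x _. apply continuous_ext with (2 := continuous_RInt_param (d1 f) 0 (2 * PI) x ltac:(lra) H1).
      intros; symmetry; apply is_derive_unique, HG.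
  - intros x _; symmetry; apply is_derive_unique, HG.
Qed.

(** * Rules for partial derivatives and integration by parts *)

Lemma d1_add f g x y :
  ex_derive (fun t => f t y) x -> ex_derive (fun t => g t y) x ->
  d1 (fadd f g) x y = d1 f x y + d1 g x y.
Proof. intros; unfold d1, fadd; now apply Derive_plus. Qed.

Lemma d2_add f g x y :
  ex_derive (fun t => f x t) y -> ex_derive (fun t => g x t) y ->
  d2 (fadd f g) x y = d2 f x y + d2 g x y.
Proof. intros; unfold d2, fadd; now apply Derive_plus. Qed.

Lemma d1_scal c f : d1 (fscal c f) = fscal c (d1 f).
Proof. apply fn2_ext; intros; apply Derive_scal. Qed.

Lemma d2_scal c f : d2 (fscal c f) = fscal c (d2 f).
Proof. apply fn2_ext; intros; apply Derive_scal. Qed.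

Lemma C1_d1_add f g : C1 f -> C1 g -> d1 (fadd f g) = fadd (d1 f) (d1 g).
Proof. intros; apply fn2_ext; intros x y; apply d1_add; now apply C1_ex1. Qed.

Lemma C1_d2_add f g : C1 f -> C1 g -> d2 (fadd f g) = fadd (d2 f) (d2 g).
Proof. intros; apply fn2_ext; intros x y; apply d2_add; now apply C1_ex2. Qed.

Lemma C1_d1_mul f g : C1 f -> C1 g ->
  d1 (fmul f g) = fadd (fmul (d1 f) g) (fmul f (d1 g)).
Proof.
  intros; apply fn2_ext; intros x y; unfold d1, fmul, fadd.
  apply (Derive_mult (fun t => f t y) (fun t => g t y)); now apply C1_ex1.
Qed.

Lemma C1_d2_mul f g : C1 f -> C1 g ->
  d2 (fmul f g) = fadd (fmul (d2 f) g) (fmul f (d2 g)).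
Proof.
  intros; apply fn2_ext; intros x y; unfold d2, fmul, fadd.
  apply (Derive_mult (fun t => f x t) (fun t => g x t)); now apply C1_ex2.
Qed.

Lemma C1_add f g : C1 f -> C1 g -> C1 (fadd f g).
Proof.
  intros Hf Hg. unfold C1. rewrite C1_d1_add, C1_d2_add by assumption.
  pose proof Hf as (?&?&?&_). pose proof Hg as (?&?&?&_).
  repeat split; auto using cont2_add.
  - now apply (ex_derive_plus (V := R_NormedModule)); apply C1_ex1.
  - now apply (ex_derive_plus (V := R_NormedModule)); apply C1_ex2.
Qed.

Lemma C1_scal c f : C1 f -> C1 (fscal c f).
Proof.
  intros Hf. pose proof Hf as (?&?&?&_). unfold C1. rewrite d1_scal, d2_scal.
  repeat split; auto using cont2_scal; apply ex_derive_scal.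
  - now apply C1_ex1.
  - now apply C1_ex2.
Qed.

Lemma C1_mul f g : C1 f -> C1 g -> C1 (fmul f g).
Proof.
  intros Hf Hg. unfold C1. rewrite C1_d1_mul, C1_d2_mul by assumption.
  pose proof Hf as (?&?&?&_). pose proof Hg as (?&?&?&_).
  repeat split; auto using cont2_add, cont2_mul; unfold fmul.
  - apply (ex_derive_mult (fun t => f t y) (fun t => g t y)); now apply C1_ex1.
  - apply (ex_derive_mult (fun t => f x t) (fun t => g x t)); now apply C1_ex2.
Qed.

Lemma C1_sub f g : C1 f -> C1 g -> C1 (fsub f g).
Proof. intros; rewrite fsub_eq; auto using C1_add, C1_scal. Qed.

Lemma per_add f g : per f -> per g -> per (fadd f g).
Proof. intros Hf Hg x y; destruct (Hf x y), (Hg x y); unfold fadd; split; congruence. Qed.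

Lemma per_mul f g : per f -> per g -> per (fmul f g).
Proof. intros Hf Hg x y; destruct (Hf x y), (Hg x y); unfold fmul; split; congruence. Qed.

Lemma per_scal c f : per f -> per (fscal c f).
Proof. intros Hf x y; destruct (Hf x y); unfold fscal; split; congruence. Qed.

Lemma Derive_shift (f : R -> R) a x :
  ex_derive f (x + a) -> Derive (fun t => f (t + a)) x = Derive f (x + a).
Proof.
  intros H. apply is_derive_unique.
  apply Derive_correct in H. rewrite <- (Rmult_1_l (Derive f (x + a))).
  apply (is_derive_comp f (fun t => t + a)); [exact H|].
  auto_derive; [exact I | ring].
Qed.

Lemma per_d1 f : C1 f -> per f -> per (d1 f).
Proof.
  intros Hf Hp x y; unfold d1; split.
  - rewrite <- (Derive_shift (fun t => f t y)) by now apply C1_ex1.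
    apply Derive_ext; intros; apply Hp.
  - apply Derive_ext; intros; apply Hp.
Qed.

Lemma per_d2 f : C1 f -> per f -> per (d2 f).
Proof.
  intros Hf Hp x y; unfold d2; split.
  - apply Derive_ext; intros; apply Hp.
  - rewrite <- (Derive_shift (fun t => f x t)) by now apply C1_ex2.
    apply Derive_ext; intros; apply Hp.
Qed.

Lemma intT_by_parts1 f g : C1 f -> C1 g -> per f -> per g ->
  intT (fmul f (d1 g)) = - intT (fmul (d1 f) g).
Proof.
  intros Hf Hg Pf Pg.
  pose proof (intT_d1 _ (C1_mul _ _ Hf Hg) (per_mul _ _ Pf Pg)) as H.
  rewrite C1_d1_mul in H by assumption.
  destruct Hf as (?&?&?&_), Hg as (?&?&?&_).
  rewrite intT_add in H by auto using cont2_mul. lra.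
Qed.

Lemma intT_by_parts2 f g : C1 f -> C1 g -> per f -> per g ->
  intT (fmul f (d2 g)) = - intT (fmul (d2 f) g).
Proof.
  intros Hf Hg Pf Pg.
  pose proof (intT_d2 _ (C1_mul _ _ Hf Hg) (per_mul _ _ Pf Pg)) as H.
  rewrite C1_d2_mul in H by assumption.
  destruct Hf as (?&?&?&_), Hg as (?&?&?&_).
  rewrite intT_add in H by auto using cont2_mul. lra.
Qed.

Lemma bracket_eq f g : bracket f g = fsub (fmul (d2 f) (d1 g)) (fmul (d1 f) (d2 g)).
Proof. reflexivity. Qed.

Lemma ip_eq f g : ip f g = intT (fadd (fmul (d1 f) (d1 g)) (fmul (d2 f) (d2 g))).
Proof. reflexivity. Qed.

Lemma ip_lap f g : C1 f -> C1 (d1 f) -> C1 (d2 f) -> C1 g -> per f -> per g ->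
  ip f g = - intT (fmul (lap f) g).
Proof.
  intros Hf H1 H2 Hg Pf Pg. rewrite ip_eq, intT_add.
  - rewrite intT_by_parts1, intT_by_parts2; auto using per_d1, per_d2.
    rewrite <- Ropp_plus_distr, <- intT_add.
    + f_equal; apply intT_ext; intros; unfold lap, fadd, fmul; ring.
    + destruct H1 as (?&?&?&?), Hg as (?&?&?&?); now apply cont2_mul.
    + destruct H2 as (?&?&?&?), Hg as (?&?&?&?); now apply cont2_mul.
  - destruct Hf as (?&?&?&?), Hg as (?&?&?&?); now apply cont2_mul.
  - destruct Hf as (?&?&?&?), Hg as (?&?&?&?); now apply cont2_mul.
Qed.

(** The Hamiltonian field of [g] is divergence free: after integration by parts its divergence
    appears as the difference of the two mixed derivatives of [g], which is zero by hypothesis. *)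
Lemma intT_bracket f g h : C1 f -> C1 g -> C1 (d1 g) -> C1 (d2 g) -> C1 h ->
  d1 (d2 g) = d2 (d1 g) -> per f -> per g -> per h ->
  intT (fmul f (bracket g h)) = intT (fmul (bracket f g) h).
Proof.
  intros Hf Hg Ha Hb Hh Hs Pf Pg Ph.
  replace (fmul f (bracket g h)) with
    (fsub (fmul (fmul f (d2 g)) (d1 h)) (fmul (fmul f (d1 g)) (d2 h)))
    by (rewrite bracket_eq; fext; ring).
  assert (C1 (fmul f (d2 g))) as Ca by now apply C1_mul.
  assert (C1 (fmul f (d1 g))) as Cb by now apply C1_mul.
  rewrite intT_sub.
  - rewrite intT_by_parts1, intT_by_parts2; auto using per_mul, per_d1, per_d2.
    rewrite C1_d1_mul, C1_d2_mul by assumption.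
    destruct Hf as (?&?&?&?), Hh as (?&?&?&?), Hg as (?&?&?&?), Ha as (?&?&?&?), Hb as (?&?&?&?).
    match goal with |- - ?a - - ?b = _ => replace (- a - - b) with (b - a) by ring end.
    rewrite <- intT_sub by auto using cont2_mul, cont2_add.
    apply intT_ext; intros. rewrite Hs, bracket_eq; unfold fsub, fmul, fadd; ring.
  - destruct Ca as (?&?&?&?), Hh as (?&?&?&?); now apply cont2_mul.
  - destruct Cb as (?&?&?&?), Hh as (?&?&?&?); now apply cont2_mul.
Qed.

Lemma ip_comm f g : ip f g = ip g f.
Proof. apply intT_ext; intros; ring. Qed.

Lemma ip_add_l f g h : C1 f -> C1 g -> C1 h -> ip (fadd f g) h = ip f h + ip g h.
Proof.
  intros Hf Hg Hh. rewrite !ip_eq, C1_d1_add, C1_d2_add by assumption.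
  destruct Hf as (?&?&?&?), Hh as (?&?&?&?), Hg as (?&?&?&?).
  rewrite <- intT_add by auto using cont2_add, cont2_mul.
  apply intT_ext; intros; unfold fadd, fmul; ring.
Qed.

Lemma ip_scal_l c f h : C1 f -> C1 h -> ip (fscal c f) h = c * ip f h.
Proof.
  intros Hf Hh. rewrite !ip_eq, d1_scal, d2_scal.
  destruct Hf as (?&?&?&?), Hh as (?&?&?&?).
  rewrite <- intT_scal by auto using cont2_add, cont2_mul.
  apply intT_ext; intros; unfold fadd, fmul, fscal; ring.
Qed.

Lemma ip_sub_l f g h : C1 f -> C1 g -> C1 h -> ip (fsub f g) h = ip f h - ip g h.
Proof.
  intros; rewrite fsub_eq, ip_add_l, ip_scal_l; auto using C1_scal; ring.
Qed.

Lemma RInt_eq_0 (f : R -> R) a b : a < b -> (forall x, continuous f x) ->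
  (forall x, 0 <= f x) -> RInt f a b = 0 -> forall x, a <= x <= b -> f x = 0.
Proof.
  intros Hab Hc Hp H0 x Hx. apply Rle_antisym; [|apply Hp].
  apply Rnot_lt_le; intros Hlt.
  assert (HI : forall u v, ex_RInt f u v).
  { intros; apply (ex_RInt_continuous (V := R_CompleteNormedModule)); auto. }
  assert (Hloc : locally x (fun t => 0 < f t)).
  { apply (Hc x (fun t => 0 < t)). now apply open_gt. }
  destruct Hloc as [d Hd].
  pose proof (cond_pos d) as Hdp.
  (* Clipping the neighbourhood to [a, b] leaves an interval of positive length even when [x] is an
     endpoint. *)
  set (u := Rmax a (x - d / 2)). set (v := Rmin b (x + d / 2)).
  assert (a <= u /\ x - d / 2 <= u /\ u <= x) by
    (unfold u; repeat split; [apply Rmax_l|apply Rmax_r|apply Rmax_lub; lra]).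
  assert (v <= b /\ v <= x + d / 2 /\ x <= v) by
    (unfold v; repeat split; [apply Rmin_l|apply Rmin_r|apply Rmin_glb; lra]).
  assert (u < v).
  { unfold u, v; apply Rmax_lub_lt; apply Rmin_glb_lt; lra. }
  assert (I1 : 0 <= RInt f a u) by (apply RInt_ge_0; auto; lra).
  assert (I2 : 0 <= RInt f v b) by (apply RInt_ge_0; auto; lra).
  assert (I3 : 0 < RInt f u v).
  { apply RInt_gt_0; auto. intros t Ht. apply Hd.
    change (Rabs (t - x) < d). apply Rabs_def1; lra. }
  pose proof (RInt_Chasles f a u v (HI _ _) (HI _ _)) as E1.
  pose proof (RInt_Chasles f a v b (HI _ _) (HI _ _)) as E2.
  unfold plus in E1, E2; simpl in E1, E2. lra.
Qed.

Lemma intT_eq_0 f : cont2 f -> (forall x y, 0 <= f x y) -> intT f = 0 ->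
  forall x y, 0 <= x <= 2 * PI -> 0 <= y <= 2 * PI -> f x y = 0.
Proof.
  intros Hc Hp H0 x y Hx Hy. pose proof two_pi_pos.
  assert (Hi : RInt (fun y => f x y) 0 (2 * PI) = 0).
  { apply (RInt_eq_0 (fun x => RInt (fun y => f x y) 0 (2 * PI)) 0 (2 * PI)); auto.
    - intros; apply continuous_RInt_param; [lra|assumption].
    - intros; apply RInt_ge_0; [lra| |auto]. now apply cont2_ex_RInt. }
  apply (RInt_eq_0 (fun y => f x y) 0 (2 * PI)); auto.
  intros; now apply cont2_y.
Qed.

(** * Glide-antisymmetric trigonometric polynomials *)

Lemma Smooth_iff f : Smooth f <-> forall w, C1 (iterD w f).
Proof.
  split.
  - intros H w. split; [|split; [|split]].
    + intros x y; apply continuity_2d_pt_filterlim, (H w).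
    + intros x y; apply continuity_2d_pt_filterlim, (H (true :: w)).
    + intros x y; apply continuity_2d_pt_filterlim, (H (false :: w)).
    + intros x y; apply (H w).
  - intros H w; split; intros x y.
    + apply continuity_2d_pt_filterlim, (H w).
    + split; [apply (C1_ex1 (iterD w f)) | apply (C1_ex2 (iterD w f))]; apply H.
Qed.

Lemma Smooth_C1 f : Smooth f -> C1 f.
Proof. intros H; exact (proj1 (Smooth_iff f) H nil). Qed.

Lemma Smooth_d1 f : Smooth f -> Smooth (d1 f).
Proof.
  rewrite !Smooth_iff; intros H w.
  (* [iterD] folds from the right, so the derivative taken first is the last letter of the word. *)
  specialize (H (w ++ true :: nil)). unfold iterD in *. now rewrite fold_right_app in H.
Qed.

Lemma Smooth_d2 f : Smooth f -> Smooth (d2 f).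
Proof.
  rewrite !Smooth_iff; intros H w.
  specialize (H (w ++ false :: nil)). unfold iterD in *. now rewrite fold_right_app in H.
Qed.

Lemma Smooth_add f g : Smooth f -> Smooth g -> Smooth (fadd f g).
Proof.
  rewrite !Smooth_iff; intros Hf Hg w.
  assert (E : iterD w (fadd f g) = fadd (iterD w f) (iterD w g)).
  { induction w as [|[] w IH]; [reflexivity|..]; simpl; fold (iterD w (fadd f g));
      rewrite IH; [apply C1_d1_add | apply C1_d2_add]; auto. }
  rewrite E; auto using C1_add.
Qed.

Lemma Smooth_scal c f : Smooth f -> Smooth (fscal c f).
Proof.
  rewrite !Smooth_iff; intros Hf w.
  assert (E : iterD w (fscal c f) = fscal c (iterD w f)).
  { induction w as [|[] w IH]; [reflexivity|..]; simpl; fold (iterD w (fscal c f));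
      rewrite IH; [apply d1_scal | apply d2_scal]; auto. }
  rewrite E; auto using C1_scal.
Qed.

Lemma InLie_add f g : InLie f -> InLie g -> InLie (fadd f g).
Proof.
  intros (Sf & Pf & Af & If) (Sg & Pg & Ag & Ig).
  split; [|split; [|split]].
  - now apply Smooth_add.
  - now apply per_add.
  - intros x y; unfold fadd; rewrite Af, Ag; ring.
  - rewrite intT_add, If, Ig; [ring|..]; now apply Smooth_C1.
Qed.

Lemma InLie_scal c f : InLie f -> InLie (fscal c f).
Proof.
  intros (Sf & Pf & Af & If).
  split; [|split; [|split]].
  - now apply Smooth_scal.
  - now apply per_scal.
  - intros x y; unfold fscal; rewrite Af; ring.
  - rewrite intT_scal, If; [ring|]; now apply Smooth_C1.
Qed.

Lemma InLie_C1 f : InLie f -> C1 f.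
Proof. intros H; apply Smooth_C1, H. Qed.

Lemma InLie_per f : InLie f -> per f.
Proof. intros (_ & H & _); exact H. Qed.

(** Free phases make the family closed under both partial derivatives, each of which shifts one
    phase by a quarter period. *)
Definition wave (c a p b q : R) : fn2 := fun x y => c * cos (a * x - p) * cos (b * y - q).

Lemma cos_shift t : cos (t + PI / 2) = - sin t.
Proof. rewrite cos_plus, cos_PI2, sin_PI2; ring. Qed.

Lemma sin_as_cos t : sin t = cos (t - PI / 2).
Proof. rewrite cos_minus, cos_PI2, sin_PI2; ring. Qed.

Lemma wave_d1 c a p b q : d1 (wave c a p b q) = wave (c * a) a (p - PI / 2) b q.
Proof.
  apply fn2_ext; intros; unfold d1, wave. apply is_derive_unique.
  replace (a * x - (p - PI / 2)) with (a * x - p + PI / 2) by ring.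
  rewrite cos_shift. auto_derive; [exact I|unfold Rminus; ring].
Qed.

Lemma wave_d2 c a p b q : d2 (wave c a p b q) = wave (c * b) a p b (q - PI / 2).
Proof.
  apply fn2_ext; intros; unfold d2, wave. apply is_derive_unique.
  replace (b * y - (q - PI / 2)) with (b * y - q + PI / 2) by ring.
  rewrite cos_shift. auto_derive; [exact I|unfold Rminus; ring].
Qed.

Lemma cont2_comp_x (h : R -> R) : (forall t, continuity_pt h t) -> cont2 (fun x _ => h x).
Proof. intros H x y; apply (continuity_1d_2d_pt_comp h); [apply H|apply continuity_2d_pt_id1]. Qed.

Lemma cont2_comp_y (h : R -> R) : (forall t, continuity_pt h t) -> cont2 (fun _ y => h y).
Proof. intros H x y; apply (continuity_1d_2d_pt_comp h); [apply H|apply continuity_2d_pt_id2]. Qed.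

Lemma cos_lin_cont a p t : continuity_pt (fun t => cos (a * t - p)) t.
Proof. reg. Qed.

Lemma wave_cont2 c a p b q : cont2 (wave c a p b q).
Proof.
  apply (cont2_mul (fun x _ => c * cos (a * x - p)) (fun _ y => cos (b * y - q))).
  - apply (cont2_scal c (fun x _ => cos (a * x - p))).
    apply (cont2_comp_x (fun x => cos (a * x - p))), cos_lin_cont.
  - apply (cont2_comp_y (fun y => cos (b * y - q))), cos_lin_cont.
Qed.

Lemma wave_C1 c a p b q : C1 (wave c a p b q).
Proof.
  unfold C1. rewrite wave_d1, wave_d2.
  split; [|split; [|split]]; try apply wave_cont2.
  intros x y; unfold wave; split; auto_derive; exact I.
Qed.

Lemma wave_Smooth c a p b q : Smooth (wave c a p b q).
Proof.
  apply Smooth_iff; intros w.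
  assert (E : exists c' p' q', iterD w (wave c a p b q) = wave c' a p' b q').
  { induction w as [|[] w (c' & p' & q' & IH)].
    - now exists c, p, q.
    - simpl; fold (iterD w (wave c a p b q)); rewrite IH, wave_d1; eauto.
    - simpl; fold (iterD w (wave c a p b q)); rewrite IH, wave_d2; eauto. }
  destruct E as (c' & p' & q' & ->). apply wave_C1.
Qed.

Lemma wave_lap c a p b q : lap (wave c a p b q) = fscal (- (a ^ 2 + b ^ 2)) (wave c a p b q).
Proof.
  unfold lap. rewrite wave_d1, wave_d1, wave_d2, wave_d2. fext. unfold wave.
  replace (a * x - (p - PI / 2 - PI / 2)) with (a * x - p + PI) by field.
  replace (b * y - (q - PI / 2 - PI / 2)) with (b * y - q + PI) by field.
  rewrite !neg_cos. ring.
Qed.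

Lemma cos_add_ZPI t n : cos (t + IZR n * PI) = cos (IZR n * PI) * cos t.
Proof. rewrite cos_plus, (sin_eq_0_1 (IZR n * PI)); [ring|now exists n]. Qed.

Lemma cos_ZPI_sq n : cos (IZR n * PI) * cos (IZR n * PI) = 1.
Proof.
  pose proof (sin2_cos2 (IZR n * PI)) as H.
  rewrite (sin_eq_0_1 (IZR n * PI)) in H; [|now exists n].
  unfold Rsqr in H; lra.
Qed.

Lemma cos_add_Z2PI t n : cos (t + IZR n * (2 * PI)) = cos t.
Proof.
  replace (t + IZR n * (2 * PI)) with (t + IZR n * PI + IZR n * PI) by ring.
  rewrite !cos_add_ZPI, <- Rmult_assoc, cos_ZPI_sq; ring.
Qed.

Lemma wave_per c m p n q : per (wave c (IZR m) p (IZR n) q).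
Proof.
  intros x y; unfold wave; split.
  - replace (IZR m * (x + 2 * PI) - p) with (IZR m * x - p + IZR m * (2 * PI)) by ring.
    now rewrite cos_add_Z2PI.
  - replace (IZR n * (y + 2 * PI) - q) with (IZR n * y - q + IZR n * (2 * PI)) by ring.
    now rewrite cos_add_Z2PI.
Qed.

Lemma cos_lin_continuous a p t : continuous (fun t => cos (a * t - p)) t.
Proof. apply continuity_pt_filterlim, cos_lin_cont. Qed.

Lemma RInt_cos_Z n q : n <> 0%Z -> RInt (fun t => cos (IZR n * t - q)) 0 (2 * PI) = 0.
Proof.
  intros Hn. apply not_0_IZR in Hn.
  assert (E : sin (IZR n * (2 * PI) - q) = sin (IZR n * 0 - q)).
  { rewrite !sin_as_cos, <- (cos_add_Z2PI (IZR n * 0 - q - PI / 2) n). f_equal; ring. }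
  apply is_RInt_unique.
  replace 0 with (minus (sin (IZR n * (2 * PI) - q) / IZR n) (sin (IZR n * 0 - q) / IZR n)) at 2.
  - apply (is_RInt_derive (fun t => sin (IZR n * t - q) / IZR n)).
    + intros x _; auto_derive; [exact I|unfold Rminus; now field].
    + intros; apply cos_lin_continuous.
  - rewrite E; apply Rminus_diag.
Qed.

(* The phase makes the [x]-factor [cos (m x)] or [sin (m x)] up to sign, according to
   the parity of [n]; this is what antisymmetry under the glide reflection demands. *)
Definition kwave (c : R) (m n : Z) (q : R) : fn2 :=
  wave c (IZR m) ((IZR n + 1) * (PI / 2)) (IZR n) q.

(** Reflecting [x] reverses the phase, which amounts to adding (n + 1) PI to the argument; the shift
    in [y] adds n PI. The two signs multiply to -1. *)
Lemma kwave_anti c m n q x y : kwave c m n q (2 * PI - x) (PI + y) = - kwave c m n q x y.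
Proof.
  unfold kwave, wave.
  replace (IZR n * (PI + y) - q) with (IZR n * y - q + IZR n * PI) by ring.
  replace (cos (IZR m * (2 * PI - x) - (IZR n + 1) * (PI / 2)))
    with (- cos (IZR m * x - (IZR n + 1) * (PI / 2) + IZR n * PI)).
  - rewrite !cos_add_ZPI.
    transitivity (- (c * cos (IZR m * x - (IZR n + 1) * (PI / 2)) * cos (IZR n * y - q))
       * (cos (IZR n * PI) * cos (IZR n * PI))); [ring|].
    rewrite cos_ZPI_sq; ring.
  - rewrite <- neg_cos, <- cos_neg, <- (cos_add_Z2PI _ m). f_equal; field.
Qed.

Lemma kwave_mean c m n q : intT (kwave c m n q) = 0.
Proof.
  unfold kwave, wave.
  rewrite (intT_sep (fun x => c * cos (IZR m * x - (IZR n + 1) * (PI / 2)))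
                    (fun y => cos (IZR n * y - q))).
  2:{ intros; apply (continuous_mult (fun _ => c)); [apply continuous_const|apply cos_lin_continuous]. }
  2:{ intros; apply cos_lin_continuous. }
  (* For [n = 0] the phase is PI / 2, so the [x]-factor is a sine: it has mean zero, and it vanishes
     identically for [m = 0]. *)
  destruct (Z.eq_dec n 0) as [->|Hn]; [|rewrite RInt_cos_Z by assumption; ring].
  rewrite (RInt_scal (V := R_CompleteNormedModule) (fun x => cos (IZR m * x - (0 + 1) * (PI / 2)))).
  2:{ apply (ex_RInt_continuous (V := R_CompleteNormedModule)); intros; apply cos_lin_continuous. }
  destruct (Z.eq_dec m 0) as [->|Hm].
  - rewrite (RInt_ext _ (fun _ => 0)).
    + rewrite RInt_const. unfold scal; simpl; unfold mult; simpl; ring.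
    + intros x _. replace (0 * x - (0 + 1) * (PI / 2)) with (- (PI / 2)) by ring.
      now rewrite cos_neg, cos_PI2.
  - rewrite RInt_cos_Z by assumption. unfold scal; simpl; unfold mult; simpl; ring.
Qed.

Lemma kwave_InLie c m n q : InLie (kwave c m n q).
Proof.
  split; [|split; [|split]].
  - apply wave_Smooth.
  - apply wave_per.
  - intros; apply kwave_anti.
  - apply kwave_mean.
Qed.

Lemma kwave_lap c m n q :
  lap (kwave c m n q) = fscal (- (IZR m ^ 2 + IZR n ^ 2)) (kwave c m n q).
Proof. apply wave_lap. Qed.

(** The finite span of the Klein modes. It is closed under the Laplacian, brackets and [Bop], so the
    curvature of two modes never leaves it. *)
Inductive kspan : fn2 -> Prop :=
| kspan_kwave c m n q : kspan (kwave c m n q)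
| kspan_add f g : kspan f -> kspan g -> kspan (fadd f g)
| kspan_scal c f : kspan f -> kspan (fscal c f).

Lemma kspan_sub f g : kspan f -> kspan g -> kspan (fsub f g).
Proof. intros; rewrite fsub_eq; auto using kspan. Qed.

Lemma kspan_InLie f : kspan f -> InLie f.
Proof. induction 1; auto using kwave_InLie, InLie_add, InLie_scal. Qed.

Lemma kspan_Smooth f : kspan f -> Smooth f.
Proof. intros H; apply (kspan_InLie _ H). Qed.

Lemma kspan_C1 f : kspan f -> C1 f.
Proof. intros H; apply Smooth_C1, kspan_Smooth, H. Qed.

Lemma lap_add f g : Smooth f -> Smooth g -> lap (fadd f g) = fadd (lap f) (lap g).
Proof.
  intros Hf Hg. unfold lap.
  rewrite C1_d1_add, C1_d2_add, C1_d1_add, C1_d2_add;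
    auto using Smooth_C1, Smooth_d1, Smooth_d2.
  fext; ring.
Qed.

Lemma lap_scal c f : lap (fscal c f) = fscal c (lap f).
Proof. unfold lap. rewrite !d1_scal, !d2_scal. fext; ring. Qed.

Lemma kspan_lap f : kspan f -> kspan (lap f).
Proof.
  induction 1.
  - rewrite kwave_lap; auto using kspan.
  - rewrite lap_add by now apply kspan_Smooth. auto using kspan.
  - rewrite lap_scal; auto using kspan.
Qed.

Lemma kspan_schwarz f : kspan f -> d1 (d2 f) = d2 (d1 f).
Proof.
  induction 1 as [c m n q|f g Hf IHf Hg IHg|c f Hf IHf].
  - unfold kwave. rewrite wave_d1, wave_d2, wave_d1, wave_d2. fext; unfold wave; ring.
  - apply kspan_Smooth in Hf, Hg.
    rewrite C1_d1_add, C1_d2_add, C1_d1_add, C1_d2_add;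
      auto using Smooth_C1, Smooth_d1, Smooth_d2; congruence.
  - rewrite !d1_scal, !d2_scal, !d1_scal; congruence.
Qed.

Lemma bracket_add_l f g h : C1 f -> C1 g ->
  bracket (fadd f g) h = fadd (bracket f h) (bracket g h).
Proof.
  intros; rewrite !bracket_eq, C1_d1_add, C1_d2_add by assumption. fext; ring.
Qed.

Lemma bracket_scal_l c f h : bracket (fscal c f) h = fscal c (bracket f h).
Proof. rewrite !bracket_eq, d1_scal, d2_scal. fext; ring. Qed.

Lemma bracket_anti f g : bracket f g = fscal (-1) (bracket g f).
Proof. rewrite !bracket_eq; fext; ring. Qed.

Lemma bracket_add_r f g h : C1 f -> C1 g ->
  bracket h (fadd f g) = fadd (bracket h f) (bracket h g).
Proof.
  intros; rewrite !bracket_eq, C1_d1_add, C1_d2_add by assumption. fext; ring.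
Qed.

Lemma bracket_scal_r c f h : bracket h (fscal c f) = fscal c (bracket h f).
Proof. rewrite !bracket_eq, d1_scal, d2_scal. fext; ring. Qed.

Lemma bracket_wave c1 a1 p1 b1 q1 c2 a2 p2 b2 q2 x y :
  bracket (wave c1 a1 p1 b1 q1) (wave c2 a2 p2 b2 q2) x y =
  c1 * c2 / 4 *
  ((b1 * a2 - a1 * b2) *
     (sin ((a1 + a2) * x - (p1 + p2)) * sin ((b1 + b2) * y - (q1 + q2)) -
      sin ((a1 - a2) * x - (p1 - p2)) * sin ((b1 - b2) * y - (q1 - q2))) +
   (b1 * a2 + a1 * b2) *
     (sin ((a1 + a2) * x - (p1 + p2)) * sin ((b1 - b2) * y - (q1 - q2)) -
      sin ((a1 - a2) * x - (p1 - p2)) * sin ((b1 + b2) * y - (q1 + q2)))).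
Proof.
  unfold bracket. rewrite !wave_d1, !wave_d2. unfold wave.
  replace (a1 * x - (p1 - PI / 2)) with (a1 * x - p1 + PI / 2) by ring.
  replace (a2 * x - (p2 - PI / 2)) with (a2 * x - p2 + PI / 2) by ring.
  replace (b1 * y - (q1 - PI / 2)) with (b1 * y - q1 + PI / 2) by ring.
  replace (b2 * y - (q2 - PI / 2)) with (b2 * y - q2 + PI / 2) by ring.
  rewrite !cos_shift.
  replace ((a1 + a2) * x - (p1 + p2)) with ((a1 * x - p1) + (a2 * x - p2)) by ring.
  replace ((a1 - a2) * x - (p1 - p2)) with ((a1 * x - p1) - (a2 * x - p2)) by ring.
  replace ((b1 + b2) * y - (q1 + q2)) with ((b1 * y - q1) + (b2 * y - q2)) by ring.
  replace ((b1 - b2) * y - (q1 - q2)) with ((b1 * y - q1) - (b2 * y - q2)) by ring.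
  rewrite !sin_plus, !sin_minus. field.
Qed.

(* The bracket of two Klein modes has the four frequencies [(m1 +- m2, n1 +- n2)]; the
   weights [g1 .. g4] leave room for Fourier multipliers such as [lap] and its inverse. *)
Definition kbr (c1 : R) (m1 n1 : Z) (q1 c2 : R) (m2 n2 : Z) (q2 : R) (g1 g2 g3 g4 : R) : fn2 :=
  fadd
    (fadd
      (kwave (- (c1 * c2 / 4) * (IZR n1 * IZR m2 - IZR m1 * IZR n2) * g1)
         (m1 + m2) (n1 + n2) (q1 + q2 + PI / 2))
      (kwave (- (c1 * c2 / 4) * (IZR n1 * IZR m2 - IZR m1 * IZR n2) * g2)
         (m1 - m2) (n1 - n2) (q1 - q2 + PI / 2)))
    (fadd
      (kwave (- (c1 * c2 / 4) * cos (IZR n2 * PI) * (IZR n1 * IZR m2 + IZR m1 * IZR n2) * g3)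
         (m1 + m2) (n1 - n2) (q1 - q2 + PI / 2))
      (kwave (- (c1 * c2 / 4) * cos (IZR n2 * PI) * (IZR n1 * IZR m2 + IZR m1 * IZR n2) * g4)
         (m1 - m2) (n1 + n2) (q1 + q2 + PI / 2))).

(** The phase that [kwave] attaches to second frequency [n1 - n2] differs from [p1 + p2] by n2 PI +
    PI / 2, and likewise the one for [n1 + n2] differs from [p1 - p2]. The quarter period turns
    cosines into sines, and the sign cos(n2 PI) stored in [kbr] undoes the rest. *)
Lemma kbr_eval c1 m1 n1 q1 c2 m2 n2 q2 g1 g2 g3 g4 x y :
  let a1 := IZR m1 in let b1 := IZR n1 in let a2 := IZR m2 in let b2 := IZR n2 in
  let p1 := (b1 + 1) * (PI / 2) in let p2 := (b2 + 1) * (PI / 2) in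
  kbr c1 m1 n1 q1 c2 m2 n2 q2 g1 g2 g3 g4 x y =
  c1 * c2 / 4 *
  ((b1 * a2 - a1 * b2) *
     (g1 * sin ((a1 + a2) * x - (p1 + p2)) * sin ((b1 + b2) * y - (q1 + q2)) -
      g2 * sin ((a1 - a2) * x - (p1 - p2)) * sin ((b1 - b2) * y - (q1 - q2))) +
   (b1 * a2 + a1 * b2) *
     (g3 * sin ((a1 + a2) * x - (p1 + p2)) * sin ((b1 - b2) * y - (q1 - q2)) -
      g4 * sin ((a1 - a2) * x - (p1 - p2)) * sin ((b1 + b2) * y - (q1 + q2)))).
Proof.
  intros A1 B1 A2 B2 p1 p2. unfold p1, p2.
  unfold kbr, kwave, wave, fadd. rewrite !plus_IZR, !minus_IZR.
  fold A1 A2 B1 B2.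
  assert (HB : forall t, cos (t + B2 * PI) = cos (B2 * PI) * cos t) by (intros; apply cos_add_ZPI).
  assert (HQ : cos (B2 * PI) * cos (B2 * PI) = 1) by apply cos_ZPI_sq.
  rewrite (sin_as_cos ((B1 + B2) * y - _)), (sin_as_cos ((B1 - B2) * y - _)).
  replace (cos ((A1 + A2) * x - (B1 + B2 + 1) * (PI / 2)))
    with (- sin ((A1 + A2) * x - ((B1 + 1) * (PI / 2) + (B2 + 1) * (PI / 2)))).
  2:{ rewrite <- cos_shift; f_equal; field. }
  replace (cos ((A1 - A2) * x - (B1 - B2 + 1) * (PI / 2)))
    with (sin ((A1 - A2) * x - ((B1 + 1) * (PI / 2) - (B2 + 1) * (PI / 2)))).
  2:{ rewrite sin_as_cos; f_equal; field. }
  replace (cos ((A1 + A2) * x - (B1 - B2 + 1) * (PI / 2)))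
    with (cos (B2 * PI) * - sin ((A1 + A2) * x - ((B1 + 1) * (PI / 2) + (B2 + 1) * (PI / 2)))).
  2:{ rewrite <- cos_shift, <- HB; f_equal; field. }
  replace (sin ((A1 - A2) * x - ((B1 + 1) * (PI / 2) - (B2 + 1) * (PI / 2))))
    with (cos (B2 * PI) * cos ((A1 - A2) * x - (B1 + B2 + 1) * (PI / 2))).
  2:{ rewrite sin_as_cos, <- HB; f_equal; field. }
  replace ((B1 + B2) * y - (q1 + q2 + PI / 2)) with ((B1 + B2) * y - (q1 + q2) - PI / 2) by ring.
  replace ((B1 - B2) * y - (q1 - q2 + PI / 2)) with ((B1 - B2) * y - (q1 - q2) - PI / 2) by ring.
  set (e := cos (B2 * PI)) in *.
  set (S := sin _). set (T := cos ((A1 - A2) * x - _)).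
  set (U := cos ((B1 + B2) * y - _ - _)). set (V := cos ((B1 - B2) * y - _ - _)).
  replace (g3 * S * V) with ((e * e) * g3 * S * V) by (rewrite HQ; ring).
  field.
Qed.

Lemma bracket_kwave c1 m1 n1 q1 c2 m2 n2 q2 :
  bracket (kwave c1 m1 n1 q1) (kwave c2 m2 n2 q2) = kbr c1 m1 n1 q1 c2 m2 n2 q2 1 1 1 1.
Proof.
  apply fn2_ext; intros x y. unfold kwave at 1 2. rewrite bracket_wave, kbr_eval; ring.
Qed.

(** * The Levi-Civita connection and the curvature numerator *)

(** At frequency zero the Laplacian can only be inverted on amplitude zero; both sides are then 0,
    whatever the quotient by 0 is. *)
Lemma kwave_lap_inv c m n q : (m = 0%Z -> n = 0%Z -> c = 0) ->
  lap (kwave (- (c / (IZR m ^ 2 + IZR n ^ 2))) m n q) = kwave c m n q.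
Proof.
  intros H. rewrite kwave_lap. fext. unfold kwave, wave.
  destruct (Req_dec (IZR m ^ 2 + IZR n ^ 2) 0) as [E|E].
  - assert (IZR m = 0 /\ IZR n = 0) as [Hm Hn] by (split; nra).
    rewrite H by now apply eq_IZR. unfold Rdiv; ring.
  - field; assumption.
Qed.

Lemma lap_add4 a b c d : Smooth a -> Smooth b -> Smooth c -> Smooth d ->
  lap (fadd (fadd a b) (fadd c d)) = fadd (fadd (lap a) (lap b)) (fadd (lap c) (lap d)).
Proof. intros; now rewrite !lap_add by auto using Smooth_add. Qed.

(** Each coefficient of the bracket is a determinant of the two frequency vectors, up to a
    reflection; it vanishes when these vectors are equal or opposite, that is, whenever the
    resulting frequency is zero. *)
Lemma kwave_bracket_lap_inv c1 m1 n1 q1 c2 m2 n2 q2 :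
  let M a b := IZR a ^ 2 + IZR b ^ 2 in
  lap (kbr c1 m1 n1 q1 c2 m2 n2 q2 (- / M (m1 + m2)%Z (n1 + n2)%Z) (- / M (m1 - m2)%Z (n1 - n2)%Z)
        (- / M (m1 + m2)%Z (n1 - n2)%Z) (- / M (m1 - m2)%Z (n1 + n2)%Z))
  = bracket (kwave c1 m1 n1 q1) (kwave c2 m2 n2 q2).
Proof.
  intros M. rewrite bracket_kwave. unfold kbr.
  rewrite lap_add4 by apply wave_Smooth.
  do 2 f_equal; rewrite Rmult_1_r;
  match goal with |- lap (kwave (?c * - / ?d) _ _ _) = _ =>
    replace (c * - / d) with (- (c / d)) by (unfold Rdiv; ring) end;
  apply kwave_lap_inv; intros Hm Hn.
  - replace m2 with (- m1)%Z by lia. replace n2 with (- n1)%Z by lia.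
    rewrite !opp_IZR; ring.
  - replace m2 with m1 by lia. replace n2 with n1 by lia. ring.
  - replace m2 with (- m1)%Z by lia. replace n2 with n1 by lia.
    rewrite !opp_IZR; ring.
  - replace m2 with m1 by lia. replace n2 with (- n1)%Z by lia.
    rewrite !opp_IZR; ring.
Qed.

Lemma kspan_kbr c1 m1 n1 q1 c2 m2 n2 q2 g1 g2 g3 g4 :
  kspan (kbr c1 m1 n1 q1 c2 m2 n2 q2 g1 g2 g3 g4).
Proof. unfold kbr; auto using kspan. Qed.

(** Applied to [u] and [v] this shows that the span is closed under the bracket; applied to [lap u]
    and [v] it produces the candidate for B(u, v). *)
Lemma kspan_bracket_lap_inv u v : kspan u -> kspan v ->
  exists w, kspan w /\ lap w = bracket u v.
Proof.
  intros Hu Hv.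
  assert (Hk : forall c m n q, exists w, kspan w /\ lap w = bracket (kwave c m n q) v).
  { intros c m n q. induction Hv as [c2 m2 n2 q2|f g Hf (w & Hw & Ew) Hg (z & Hz & Ez)|a f Hf (w & Hw & Ew)].
    - eexists; split; [|apply kwave_bracket_lap_inv]. apply kspan_kbr.
    - exists (fadd w z); split; [auto using kspan|].
      rewrite lap_add, bracket_add_r by auto using kspan_Smooth, kspan_C1. congruence.
    - exists (fscal a w); split; [auto using kspan|].
      rewrite lap_scal, bracket_scal_r. congruence. }
  induction Hu as [c1 m1 n1 q1|f g Hf (w & Hw & Ew) Hg (z & Hz & Ez)|a f Hf (w & Hw & Ew)].
  - apply Hk.
  - exists (fadd w z); split; [auto using kspan|].
    rewrite lap_add, bracket_add_l by auto using kspan_Smooth, kspan_C1. congruence.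
  - exists (fscal a w); split; [auto using kspan|].
    rewrite lap_scal, bracket_scal_l. congruence.
Qed.

Lemma kspan_bracket u v : kspan u -> kspan v -> kspan (bracket u v).
Proof.
  intros Hu Hv. destruct (kspan_bracket_lap_inv u v Hu Hv) as (w & Hw & <-).
  now apply kspan_lap.
Qed.

Lemma per_bracket f g : C1 f -> C1 g -> per f -> per g -> per (bracket f g).
Proof.
  intros. rewrite bracket_eq, fsub_eq.
  auto using per_add, per_mul, per_scal, per_d1, per_d2.
Qed.

Lemma C1_bracket f g : Smooth f -> Smooth g -> C1 (bracket f g).
Proof.
  intros. rewrite bracket_eq. auto using C1_sub, C1_mul, Smooth_d1, Smooth_d2, Smooth_C1.
Qed.

Lemma ip_kspan u z : kspan u -> C1 z -> per z -> ip u z = - intT (fmul (lap u) z).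
Proof.
  intros Hu Hz Pz. pose proof (kspan_Smooth u Hu).
  apply ip_lap; auto using Smooth_C1, Smooth_d1, Smooth_d2.
  now apply InLie_per, kspan_InLie.
Qed.

Lemma intT_bracket_kspan f v z : kspan f -> kspan v -> C1 z -> per z ->
  intT (fmul f (bracket v z)) = intT (fmul (bracket f v) z).
Proof.
  intros Hf Hv Hz Pz. pose proof (kspan_Smooth v Hv).
  apply intT_bracket; auto using kspan_C1, Smooth_C1, Smooth_d1, Smooth_d2,
    kspan_schwarz, InLie_per, kspan_InLie.
Qed.

(** Both sides equal the integral of -{lap u, v} z, by Green's formula and invariance of the L^2
    product. The test function [z] ranges over the whole Lie algebra, so its bracket with [v] is
    treated only as a periodic [C1] function. *)
Lemma ip_lap_inv_bracket u v w z : kspan u -> kspan v -> kspan w ->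
  lap w = bracket (lap u) v -> InLie z -> ip w z = ip u (bracket v z).
Proof.
  intros Hu Hv Hw E Hz. pose proof (InLie_C1 _ Hz). pose proof (InLie_per _ Hz).
  rewrite !ip_kspan, intT_bracket_kspan, E;
    auto using kspan_lap, per_bracket, kspan_C1, InLie_per, kspan_InLie.
  apply C1_bracket; [now apply kspan_Smooth | apply Hz].
Qed.

Lemma per_Z f x y m n : per f -> f (x + IZR m * (2 * PI)) (y + IZR n * (2 * PI)) = f x y.
Proof.
  intros Hf.
  assert (Hn1 : forall (k : nat) x y, f (x + INR k * (2 * PI)) y = f x y).
  { induction k as [|k IH]; intros a b; [now rewrite Rmult_0_l, Rplus_0_r|].
    rewrite S_INR, Rmult_plus_distr_r, Rmult_1_l, <- Rplus_assoc, (proj1 (Hf _ _)).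
    apply IH. }
  assert (Hn2 : forall (k : nat) x y, f x (y + INR k * (2 * PI)) = f x y).
  { induction k as [|k IH]; intros a b; [now rewrite Rmult_0_l, Rplus_0_r|].
    rewrite S_INR, Rmult_plus_distr_r, Rmult_1_l, <- Rplus_assoc, (proj2 (Hf _ _)).
    apply IH. }
  assert (H1 : forall k x y, f (x + IZR k * (2 * PI)) y = f x y).
  { intros k a b. destruct (Z_le_gt_dec 0 k).
    - rewrite <- (Z2Nat.id k), <- INR_IZR_INZ by lia. apply Hn1.
    - rewrite <- (Hn1 (Z.to_nat (- k)) (a + _)), INR_IZR_INZ, Z2Nat.id, opp_IZR by lia.
      f_equal; ring. }
  assert (H2 : forall k x y, f x (y + IZR k * (2 * PI)) = f x y).
  { intros k a b. destruct (Z_le_gt_dec 0 k).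
    - rewrite <- (Z2Nat.id k), <- INR_IZR_INZ by lia. apply Hn2.
    - rewrite <- (Hn2 (Z.to_nat (- k)) _ (b + _)), INR_IZR_INZ, Z2Nat.id, opp_IZR by lia.
      f_equal; ring. }
  now rewrite H1, H2.
Qed.

Lemma mod_2PI x : exists k : Z, 0 <= x + IZR k * (2 * PI) <= 2 * PI.
Proof.
  pose proof two_pi_pos as Hp.
  destruct (archimed (x / (2 * PI))) as [Ha Hb].
  exists (1 - up (x / (2 * PI)))%Z. rewrite minus_IZR.
  set (u := IZR (up (x / (2 * PI)))) in *.
  assert (E : x = x / (2 * PI) * (2 * PI)) by (field; lra).
  set (z := x / (2 * PI)) in *. nra.
Qed.

Lemma is_const_of_Derive_0 (h : R -> R) a b : (forall t, ex_derive h t) ->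
  (forall t, a <= t <= b -> Derive h t = 0) -> forall s t,
  a <= s <= b -> a <= t <= b -> h s = h t.
Proof.
  intros Hd H0 s t Hs Ht.
  destruct (MVT_gen h s t (Derive h)) as (c & Hc & E).
  - intros; now apply Derive_correct.
  - intros c _. apply derivable_continuous_pt, ex_derive_Reals_0, Hd.
  - rewrite H0 in E; [lra|].
    unfold Rmin, Rmax in Hc; destruct (Rle_dec s t); lra.
Qed.

(* A function with zero Dirichlet energy is constant, hence zero because it changes
   sign under the glide reflection. *)
Lemma ip_definite g : InLie g -> ip g g = 0 -> g = fun _ _ => 0.
Proof.
  intros HL H0. pose proof two_pi_pos.
  destruct (HL) as (HS & Hp & HA & _).
  pose proof (Smooth_C1 _ HS) as HC. pose proof HC as (_ & c1 & c2 & _).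
  rewrite ip_eq in H0.
  assert (Hz : forall x y, 0 <= x <= 2 * PI -> 0 <= y <= 2 * PI -> d1 g x y = 0 /\ d2 g x y = 0).
  { intros x y Hx Hy.
    pose proof (intT_eq_0 _ (cont2_add _ _ (cont2_mul _ _ c1 c1) (cont2_mul _ _ c2 c2))
      ltac:(intros; unfold fadd, fmul; nra) H0 x y Hx Hy) as E.
    unfold fadd, fmul in E. split; nra. }
  assert (Hc : forall x y, 0 <= x <= 2 * PI -> 0 <= y <= 2 * PI -> g x y = g PI 0).
  { intros x y Hx Hy. transitivity (g x 0).
    - apply (is_const_of_Derive_0 (fun t => g x t) 0 (2 * PI)); try lra.
      + intros; now apply C1_ex2.
      + intros; now apply Hz.
    - apply (is_const_of_Derive_0 (fun t => g t 0) 0 (2 * PI)); try lra.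
      + intros; now apply C1_ex1.
      + intros; apply Hz; lra. }
  assert (Hv : g PI 0 = 0).
  { pose proof (HA PI 0) as E. rewrite Hc in E; lra. }
  apply fn2_ext; intros x y.
  destruct (mod_2PI x) as [k Hk]. destruct (mod_2PI y) as [l Hl].
  rewrite <- (per_Z g x y k l Hp), Hc; assumption.
Qed.

(** Two solutions of the defining relation differ by an element of the Lie algebra that is
    orthogonal to itself, so [epsilon] has no freedom. *)
Lemma Bop_eq u v w : kspan u -> kspan v -> kspan w ->
  lap w = bracket (lap u) v -> Bop u v = w.
Proof.
  intros Hu Hv Hw E.
  assert (Hspec : forall z, InLie z -> ip w z = ip u (bracket v z))
    by (intros; now apply ip_lap_inv_bracket).
  pose proof (kspan_InLie w Hw) as Lw.
  unfold Bop.
  destruct (epsilon_spec (inhabits (fun _ _ : R => 0))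
    (fun w => InLie w /\ forall z, InLie z -> ip w z = ip u (bracket v z)))
    as [Lb Hb]; [now exists w|].
  set (b := epsilon _ _) in *.
  assert (Ld : InLie (fsub b w)) by (rewrite fsub_eq; auto using InLie_add, InLie_scal).
  assert (E0 : fsub b w = fun _ _ => 0).
  { apply ip_definite; [assumption|].
    rewrite ip_sub_l by auto using InLie_C1. rewrite Hb, Hspec by assumption. ring. }
  apply fn2_ext; intros x y.
  pose proof (f_equal (fun h => h x y) E0) as Ex. unfold fsub in Ex. lra.
Qed.

Lemma kspan_Bop u v : kspan u -> kspan v -> kspan (Bop u v).
Proof.
  intros Hu Hv. destruct (kspan_bracket_lap_inv (lap u) v (kspan_lap _ Hu) Hv) as (w & Hw & E).
  now rewrite (Bop_eq u v w).
Qed.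

Lemma ip_Bop u v z : kspan u -> kspan v -> InLie z -> ip (Bop u v) z = ip u (bracket v z).
Proof.
  intros Hu Hv Hz. destruct (kspan_bracket_lap_inv (lap u) v (kspan_lap _ Hu) Hv) as (w & Hw & E).
  rewrite (Bop_eq u v w) by assumption. now apply ip_lap_inv_bracket.
Qed.

Lemma kspan_nabla u v : kspan u -> kspan v -> kspan (nabla u v).
Proof. intros; unfold nabla; auto using kspan, kspan_sub, kspan_bracket, kspan_Bop. Qed.

Lemma ip_nabla u v z : kspan u -> kspan v -> kspan z ->
  ip (nabla u v) z = 1 / 2 * (ip (bracket u v) z - ip u (bracket v z) - ip v (bracket u z)).
Proof.
  intros Hu Hv Hz. unfold nabla.
  rewrite ip_scal_l, !ip_sub_l, !ip_Bop;
    auto using kspan_sub, kspan_C1, kspan_bracket, kspan_Bop, kspan_InLie.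
Qed.

(** * The curvature numerator of two Laplace eigenfunctions *)

Section Curvature.
Variables (u v Q : fn2) (K L : R).
Hypotheses (Hu : kspan u) (Hv : kspan v) (HQ : kspan Q).
Hypotheses (Eu : lap u = fscal (- K) u) (Ev : lap v = fscal (- L) v)
  (EQ : lap Q = bracket u v).
Let P := bracket u v.

Lemma kspan_P : kspan P.
Proof. now apply kspan_bracket. Qed.

Lemma ip_eigen z w M : kspan z -> kspan w -> lap z = fscal (- M) z ->
  ip z w = M * intT (fmul z w).
Proof.
  intros Hz Hw E.
  rewrite ip_kspan, E by auto using kspan_C1, InLie_per, kspan_InLie.
  pose proof (kspan_C1 _ Hz) as (? & _). pose proof (kspan_C1 _ Hw) as (? & _).
  replace (M * intT (fmul z w)) with (- (- M * intT (fmul z w))) by ring.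
  rewrite <- intT_scal by now apply cont2_mul.
  f_equal; apply intT_ext; intros; unfold fmul, fscal; ring.
Qed.

Lemma intT_fmul_comm f g : intT (fmul f g) = intT (fmul g f).
Proof. apply intT_ext; intros; unfold fmul; ring. Qed.

Lemma intT_fmul_scal_r f c g : kspan f -> kspan g ->
  intT (fmul f (fscal c g)) = c * intT (fmul f g).
Proof.
  intros Hf Hg. pose proof (kspan_C1 _ Hf) as (? & _). pose proof (kspan_C1 _ Hg) as (? & _).
  rewrite <- intT_scal by now apply cont2_mul.
  apply intT_ext; intros; unfold fmul, fscal; ring.
Qed.

Lemma intT_fmul_add_r f g h : kspan f -> kspan g -> kspan h ->
  intT (fmul f (fadd g h)) = intT (fmul f g) + intT (fmul f h).
Proof.
  intros Hf Hg Hh. pose proof (kspan_C1 _ Hf) as (? & _). pose proof (kspan_C1 _ Hg) as (? & _).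
  pose proof (kspan_C1 _ Hh) as (? & _).
  rewrite <- intT_add by now apply cont2_mul.
  apply intT_ext; intros; unfold fmul, fadd; ring.
Qed.

Lemma nabla_vu : nabla v u = fadd (fscal (- (1 / 2)) P) (fscal (1 / 2 * (K - L)) Q).
Proof.
  unfold nabla.
  rewrite (Bop_eq v u (fscal L Q)), (Bop_eq u v (fscal (- K) Q)); auto using kspan.
  - rewrite (bracket_anti v u). fold P. fext; field.
  - rewrite lap_scal, EQ, Eu, bracket_scal_l; reflexivity.
  - rewrite lap_scal, EQ, Ev, bracket_scal_l, (bracket_anti v u). fext; ring.
Qed.

(** Zero is written as a multiple of [f] so that it is visibly an element of [kspan]. *)
Lemma bracket_self f : bracket f f = fscal 0 f.
Proof. rewrite bracket_eq; fext; ring. Qed.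

Lemma nabla_uu : nabla u u = fscal 0 u.
Proof.
  unfold nabla. rewrite (Bop_eq u u (fscal 0 u)); auto using kspan.
  - rewrite bracket_self; fext; field.
  - rewrite lap_scal, Eu, bracket_scal_l, bracket_self. fext; ring.
Qed.

Lemma ip_nabla_v_uu : ip (nabla v (nabla u u)) v = 0.
Proof.
  rewrite nabla_uu, ip_nabla by auto using kspan.
  rewrite bracket_scal_r, bracket_scal_l, (ip_comm v (fscal 0 _)), !ip_scal_l;
    auto using kspan_C1, kspan_bracket; ring.
Qed.

(** With W = nabla v u, invariance of the L^2 product and the eigenvalue equations reduce the
    pairing to half the integral of (K - L) P W + W lap P. Substituting W from [nabla_vu], the two
    integrals of P^2 cancel. *)
Lemma ip_nabla_u_vu : ip (nabla u (nabla v u)) v =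
  (K - L) ^ 2 / 4 * intT (fmul P Q) - 1 / 4 * intT (fmul P (lap P)).
Proof.
  pose proof kspan_P as HP.
  set (W := nabla v u).
  assert (HW : kspan W) by now apply kspan_nabla.
  assert (CW := kspan_C1 _ HW). assert (PW := InLie_per _ (kspan_InLie _ HW)).
  rewrite ip_nabla by assumption.
  rewrite (ip_comm (bracket u W) v), (ip_eigen v _ L), (ip_eigen u _ K);
    auto using kspan_bracket.
  rewrite (bracket_anti W v), !intT_fmul_scal_r by auto using kspan_bracket.
  rewrite !intT_bracket_kspan by assumption.
  rewrite (bracket_anti v u). fold P.
  rewrite (intT_fmul_comm (fscal (-1) P)), !intT_fmul_scal_r by assumption.
  rewrite (intT_fmul_comm P W), (ip_comm W P), ip_kspan by assumption.
  unfold W. rewrite nabla_vu. fold P.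
  rewrite (intT_fmul_comm (fadd _ _) P), !intT_fmul_add_r, !intT_fmul_scal_r;
    auto using kspan, kspan_lap.
  assert (E : intT (fmul (lap P) Q) = intT (fmul P P)).
  { apply Ropp_eq_reg. rewrite <- ip_kspan; auto using kspan_C1, InLie_per, kspan_InLie.
    rewrite ip_comm, ip_kspan, EQ; auto using kspan_C1, InLie_per, kspan_InLie. }
  rewrite E, (intT_fmul_comm (lap P) P). field.
Qed.

Lemma ip_nabla_P_u : ip (nabla P u) v =
  (K + L) / 2 * intT (fmul P P) + 1 / 2 * intT (fmul P (lap P)).
Proof.
  pose proof kspan_P as HP.
  assert (CW := kspan_C1 _ HP). assert (PW := InLie_per _ (kspan_InLie _ HP)).
  rewrite ip_nabla by assumption. fold P.
  rewrite (ip_comm (bracket P u) v), (ip_eigen v _ L), (ip_eigen u _ K), ip_kspan;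
    auto using kspan_bracket.
  rewrite (bracket_anti P u), (bracket_anti P v), !intT_fmul_scal_r by auto using kspan_bracket.
  rewrite !intT_bracket_kspan by assumption.
  rewrite (bracket_anti v u). fold P.
  rewrite (intT_fmul_comm (fscal (-1) P)), !intT_fmul_scal_r by assumption.
  rewrite (intT_fmul_comm (lap P) P). field.
Qed.

Lemma ip_Rcurv : ip (Rcurv u v u) v =
  - ((K - L) ^ 2 / 4) * intT (fmul P Q) + (K + L) / 2 * intT (fmul P P)
  + 3 / 4 * intT (fmul P (lap P)).
Proof.
  pose proof kspan_P as HP. unfold Rcurv.
  assert (Eo : forall f, fopp f = fscal (-1) f) by (intros; fext; ring).
  fold P.
  rewrite Eo, !ip_add_l, ip_scal_l by auto 6 using kspan_C1, kspan_nabla, kspan.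
  rewrite ip_nabla_v_uu, ip_nabla_u_vu, ip_nabla_P_u. field.
Qed.
End Curvature.

(** * Integrals of products of modes *)

(* Coquelicot's integrals leave equalities typed in a normed module, which [ring] rejects. *)
Ltac eqR := match goal with |- ?a = ?b => change (@eq R a b) end.

Definition J (m n p q : R) : R := RInt (fun t => sin (m * t - p) * sin (n * t - q)) 0 (2 * PI).

Lemma sin_lin_continuous a p t : continuous (fun t => sin (a * t - p)) t.
Proof. apply continuity_pt_filterlim; reg. Qed.

Lemma J_continuous m n p q t : continuous (fun t => sin (m * t - p) * sin (n * t - q)) t.
Proof.
  apply (continuous_mult (fun t => sin (m * t - p)) (fun t => sin (n * t - q)));
    apply sin_lin_continuous.
Qed.

Lemma ex_RInt_cont (f : R -> R) a b : (forall t, continuous f t) -> ex_RInt f a b.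
Proof. intros H; apply (ex_RInt_continuous (V := R_CompleteNormedModule)); auto. Qed.

Lemma RInt_add (f g : R -> R) a b : (forall t, continuous f t) -> (forall t, continuous g t) ->
  RInt (fun t => f t + g t) a b = RInt f a b + RInt g a b.
Proof.
  intros; apply (RInt_plus (V := R_CompleteNormedModule)); now apply ex_RInt_cont.
Qed.

Lemma RInt_mulc (f : R -> R) c a b : (forall t, continuous f t) ->
  RInt (fun t => c * f t) a b = c * RInt f a b.
Proof.
  intros; apply (RInt_scal (V := R_CompleteNormedModule)); now apply ex_RInt_cont.
Qed.

Lemma continuous_mulc (f : R -> R) c t : continuous f t -> continuous (fun t => c * f t) t.
Proof. intros H; apply (continuous_mult (fun _ => c) f); [apply continuous_const|exact H]. Qed.

Lemma J_eq m n p q : J m n p q =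
  1 / 2 * (RInt (fun t => cos ((m - n) * t - (p - q))) 0 (2 * PI)
           - RInt (fun t => cos ((m + n) * t - (p + q))) 0 (2 * PI)).
Proof.
  unfold J.
  rewrite (RInt_ext _ (fun t => 1 / 2 * cos ((m - n) * t - (p - q))
                                + (- (1 / 2)) * cos ((m + n) * t - (p + q)))).
  - rewrite (RInt_add (fun t => 1 / 2 * cos _) (fun t => - (1 / 2) * cos _)), !RInt_mulc;
      [idtac|intros; try apply continuous_mulc; apply cos_lin_continuous..]. ring.
  - intros t _.
    replace ((m - n) * t - (p - q)) with ((m * t - p) - (n * t - q)) by ring.
    replace ((m + n) * t - (p + q)) with ((m * t - p) + (n * t - q)) by ring.
    rewrite cos_minus, cos_plus; eqR; field.
Qed.

Lemma J_orth m n p q : (m <> n)%Z -> (m <> - n)%Z -> J (IZR m) (IZR n) p q = 0.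
Proof.
  intros; rewrite J_eq, <- minus_IZR, <- plus_IZR, !RInt_cos_Z by lia; ring.
Qed.

Lemma J_diag m p : m <> 0%Z -> J (IZR m) (IZR m) p p = PI.
Proof.
  intros; rewrite J_eq, <- plus_IZR, RInt_cos_Z by lia.
  rewrite (RInt_ext _ (fun _ => 1)).
  - rewrite RInt_const. unfold scal; simpl; unfold mult; simpl; field.
  - intros x _. rewrite <- cos_0; f_equal; ring.
Qed.

Lemma J_bound m n p q : Rabs (J m n p q) <= 2 * PI.
Proof.
  pose proof two_pi_pos. unfold J. replace (2 * PI) with ((2 * PI - 0) * 1) at 2 by ring.
  apply abs_RInt_le_const; [lra|apply ex_RInt_cont, J_continuous|].
  intros t _. rewrite Rabs_mult.
  pose proof (SIN_bound (m * t - p)) as B1. pose proof (SIN_bound (n * t - q)) as B2.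
  apply Rabs_le in B1, B2.
  rewrite <- (Rmult_1_r 1). apply Rmult_le_compat; auto using Rabs_pos.
Qed.

Lemma J_ext m n p q m' n' p' q' c : 
  (forall t, sin (m * t - p) * sin (n * t - q) = c * (sin (m' * t - p') * sin (n' * t - q'))) ->
  J m n p q = c * J m' n' p' q'.
Proof.
  intros H. unfold J. rewrite <- RInt_mulc by (intros; apply J_continuous).
  apply RInt_ext; intros; apply H.
Qed.

(* The pairing of a bracket of two modes with its weighted version, in terms of the inner
   products [A] of the two [x]-factors and [B] of the two [y]-factors ([p]: frequency sum,
   [m]: difference, [0]: mixed).  The mixed products vanish unless one of
   the modes is close to an axis. *)
Definition gram (d e g1 g2 g3 g4 Ap Am A0 Bp Bm B0 : R) : R :=
  Ap * (d ^ 2 * g1 * Bp + e ^ 2 * g3 * Bm + d * e * (g1 + g3) * B0) +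
  Am * (d ^ 2 * g2 * Bm + e ^ 2 * g4 * Bp + d * e * (g2 + g4) * B0) -
  A0 * (d * e * (g1 + g4) * Bp + d * e * (g2 + g3) * Bm
        + (d ^ 2 * (g1 + g2) + e ^ 2 * (g3 + g4)) * B0).

Lemma cont_lin3 (f g h : R -> R) a b c t : (forall t, continuous f t) ->
  (forall t, continuous g t) -> (forall t, continuous h t) ->
  continuous (fun t => a * f t + b * g t + c * h t) t.
Proof.
  intros. apply (continuous_plus (fun t => a * f t + b * g t) (fun t => c * h t));
  [apply (continuous_plus (fun t => a * f t) (fun t => b * g t))|];
  apply continuous_mulc; auto.
Qed.

Lemma RInt_lin3 (f g h : R -> R) a b c u v : (forall t, continuous f t) ->
  (forall t, continuous g t) -> (forall t, continuous h t) ->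
  RInt (fun t => a * f t + b * g t + c * h t) u v
  = a * RInt f u v + b * RInt g u v + c * RInt h u v.
Proof.
  intros Hf Hg Hh.
  rewrite (RInt_add (fun t => a * f t + b * g t) (fun t => c * h t)).
  - rewrite (RInt_add (fun t => a * f t) (fun t => b * g t)), !RInt_mulc;
      auto using continuous_mulc.
  - intros; apply (continuous_plus (fun t => a * f t) (fun t => b * g t));
      auto using continuous_mulc.
  - auto using continuous_mulc.
Qed.

Lemma cont2_sep (g h : R -> R) : (forall x, continuous g x) -> (forall x, continuous h x) ->
  cont2 (fun x y => g x * h y).
Proof.
  intros Hg Hh. apply (cont2_mul (fun x _ => g x) (fun _ y => h y));
  [apply cont2_comp_x|apply cont2_comp_y]; intros t; apply continuity_pt_filterlim;
  [apply Hg|apply Hh].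
Qed.

Lemma intT_kbr_kbr c1 m1 n1 q1 c2 m2 n2 q2 g1 g2 g3 g4 :
  let a1 := IZR m1 in let b1 := IZR n1 in let a2 := IZR m2 in let b2 := IZR n2 in
  let p1 := (b1 + 1) * (PI / 2) in let p2 := (b2 + 1) * (PI / 2) in
  intT (fmul (kbr c1 m1 n1 q1 c2 m2 n2 q2 1 1 1 1) (kbr c1 m1 n1 q1 c2 m2 n2 q2 g1 g2 g3 g4)) =
  (c1 * c2 / 4) ^ 2 * gram (b1 * a2 - a1 * b2) (b1 * a2 + a1 * b2) g1 g2 g3 g4
    (J (a1 + a2) (a1 + a2) (p1 + p2) (p1 + p2)) (J (a1 - a2) (a1 - a2) (p1 - p2) (p1 - p2))
    (J (a1 + a2) (a1 - a2) (p1 + p2) (p1 - p2))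
    (J (b1 + b2) (b1 + b2) (q1 + q2) (q1 + q2)) (J (b1 - b2) (b1 - b2) (q1 - q2) (q1 - q2))
    (J (b1 + b2) (b1 - b2) (q1 + q2) (q1 - q2)).
Proof.
  intros a1 b1 a2 b2 p1 p2.
  set (d := b1 * a2 - a1 * b2). set (e := b1 * a2 + a1 * b2).
  set (Sp := fun x => sin ((a1 + a2) * x - (p1 + p2))).
  set (Sm := fun x => sin ((a1 - a2) * x - (p1 - p2))).
  set (Tp := fun y => sin ((b1 + b2) * y - (q1 + q2))).
  set (Tm := fun y => sin ((b1 - b2) * y - (q1 - q2))).
  (* Sorted by the three products of [x]-factors, the terms of the expanded product form three
     separable functions. *)
  set (h := fun a b c y => a * (Tp y * Tp y) + b * (Tm y * Tm y) + c * (Tp y * Tm y)).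
  assert (Hh : forall a b c t, continuous (h a b c) t).
  { intros; apply cont_lin3; intros; apply J_continuous. }
  assert (Ih : forall a b c, RInt (h a b c) 0 (2 * PI) =
    a * J (b1 + b2) (b1 + b2) (q1 + q2) (q1 + q2) + b * J (b1 - b2) (b1 - b2) (q1 - q2) (q1 - q2)
    + c * J (b1 + b2) (b1 - b2) (q1 + q2) (q1 - q2)).
  { intros; unfold h; rewrite RInt_lin3; [reflexivity|intros; apply J_continuous..]. }
  rewrite (intT_ext _ (fscal ((c1 * c2 / 4) ^ 2) (fadd (fadd
    (fun x y => (Sp x * Sp x) * h (d ^ 2 * g1) (e ^ 2 * g3) (d * e * (g1 + g3)) y)
    (fun x y => (Sm x * Sm x) * h (e ^ 2 * g4) (d ^ 2 * g2) (d * e * (g2 + g4)) y))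
    (fun x y => (Sp x * Sm x) * h (- (d * e * (g1 + g4))) (- (d * e * (g2 + g3)))
       (- (d ^ 2 * (g1 + g2) + e ^ 2 * (g3 + g4))) y)))).
  - rewrite intT_scal, !intT_add, !intT_sep, !Ih;
      try (apply J_continuous || apply Hh || intros; apply J_continuous || apply Hh);
      repeat apply cont2_add; try (apply cont2_sep; [apply J_continuous|apply Hh]).
    unfold gram, J, Sp, Sm. ring.
  - intros x y. unfold fmul. rewrite !kbr_eval. fold a1 a2 b1 b2. fold p1 p2.
    fold (Sp x) (Sm x) (Tp y) (Tm y). fold d e.
    unfold fscal, fadd, h. field.
Qed.

(** * Estimates for the curvature multiplier *)

(* The curvature numerator of eigenfunctions with eigenvalues [-K] and [-L] is the
   quadratic form of [fM K L (- lap)] on their bracket. *)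
Definition fM (K L M : R) : R := (K - L) ^ 2 / (4 * M) + (K + L) / 2 - 3 / 4 * M.

(** Here t stands for the scalar product k.l and d for the determinant, so that t^2 + d^2 = K L is
    Lagrange's identity and K + L +- 2 t are the squared norms of k +- l. Their product (L - K)^2 +
    4 d^2 is the denominator; the parts of order sqrt(K L) cancel in the sum. *)
Lemma pair_identity K L t d : 0 < K -> 2 * K <= L -> t ^ 2 + d ^ 2 = K * L ->
  fM K L (K + L + 2 * t) + fM K L (K + L - 2 * t)
  = - 2 * (K + L) * d ^ 2 / ((L - K) ^ 2 + 4 * d ^ 2).
Proof.
  intros HK HL E. unfold fM.
  assert (HM : (K + L + 2 * t) * (K + L - 2 * t) = (L - K) ^ 2 + 4 * d ^ 2) by nra.
  assert (0 < (L - K) ^ 2 + 4 * d ^ 2) by nra.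
  assert (K + L + 2 * t <> 0 /\ K + L - 2 * t <> 0) as [H1 H2]
    by (split; intros Z; rewrite Z in HM; lra).
  rewrite <- HM. replace (d ^ 2) with (K * L - t ^ 2) by lra.
  field. split; assumption.
Qed.

(** Over a common denominator the difference is d^4 * 2 (K^2 + 4 d^2 - 3 K L), at most (K L)^2 * 16
    K L in modulus, divided by L ((L - K)^2 + 4 d^2) >= L^3 / 4. *)
Lemma pair_estimate K L t d : 0 < K -> 2 * K <= L -> t ^ 2 + d ^ 2 = K * L ->
  Rabs (d ^ 2 * (fM K L (K + L + 2 * t) + fM K L (K + L - 2 * t)) + 2 * d ^ 4 / L) <= 64 * K ^ 3.
Proof.
  intros HK HL E. rewrite (pair_identity _ _ _ d) by assumption.
  assert (HD : 0 < (L - K) ^ 2 + 4 * d ^ 2) by nra.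
  replace (d ^ 2 * (- 2 * (K + L) * d ^ 2 / ((L - K) ^ 2 + 4 * d ^ 2)) + 2 * d ^ 4 / L)
    with ((d ^ 2) ^ 2 * (2 * (K ^ 2 + 4 * d ^ 2 - 3 * K * L)) / (L * ((L - K) ^ 2 + 4 * d ^ 2)))
    by (field; lra).
  assert (0 <= d ^ 2 <= K * L) by nra.
  set (D := d ^ 2) in *.
  assert (0 < L * ((L - K) ^ 2 + 4 * D)) by (apply Rmult_lt_0_compat; lra).
  assert (Hq : L ^ 2 / 4 <= (L - K) ^ 2 + 4 * D) by nra.
  assert (HD2 : 0 <= D ^ 2 <= (K * L) ^ 2) by (split; [apply pow2_ge_0|apply pow_incr; lra]).
  assert (HX : Rabs (2 * (K ^ 2 + 4 * D - 3 * K * L)) <= 16 * (K * L))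
    by (apply Rabs_le; nra).
  unfold Rdiv. rewrite Rabs_mult, (Rabs_pos_eq (/ _)) by (apply Rlt_le, Rinv_0_lt_compat; lra).
  apply Rmult_le_reg_r with (L * ((L - K) ^ 2 + 4 * D)); [assumption|].
  rewrite Rmult_assoc, Rinv_l, Rmult_1_r by lra.
  apply Rle_trans with ((K * L) ^ 2 * (16 * (K * L))).
  - rewrite Rabs_mult. apply Rmult_le_compat; try apply Rabs_pos; try assumption.
    rewrite Rabs_pos_eq; lra.
  - replace ((K * L) ^ 2 * (16 * (K * L))) with (64 * K ^ 3 * (L * (L ^ 2 / 4))) by field.
    apply Rmult_le_compat_l; [nra|]. apply Rmult_le_compat_l; lra.
Qed.

(** Isolates the large part -2 t, of order sqrt(K L). Writing L = M - K - 2 t leaves K / 2 and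
    fractions whose numerators are O(K L) and whose denominators are multiples of M >= L / 4. *)
Lemma fM_estimate K L t : 0 < K -> 8 * K <= L -> t ^ 2 <= K * L ->
  Rabs (fM K L (K + L + 2 * t) + 2 * t) <= 15 * K.
Proof.
  intros HK HL E.
  (* The inequality of means gives 2 |t| <= 2 sqrt(K L) <= L / 2 + 2 K, and K <= L / 8. *)
  assert (HM : L / 4 <= K + L + 2 * t).
  { assert (- (L / 2 + 2 * K) <= 2 * t); [|lra].
    apply Rnot_lt_le; intros H. nra. }
  set (M := K + L + 2 * t) in *. set (X := K + 2 * t).
  assert (Ex : fM K L M + 2 * t =
    X ^ 2 / (4 * M) - K / 2 - L * K / (2 * M) + K ^ 2 / (4 * M)).
  { unfold fM, X. replace L with (M - K - 2 * t) by (unfold M; ring). field. lra. }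
  rewrite Ex.
  assert (HX : 0 <= X ^ 2 <= 2 * K ^ 2 + 8 * (K * L)).
  { split; [apply pow2_ge_0|unfold X]. pose proof (pow2_ge_0 (K - 2 * t)). nra. }
  assert (Hd : forall a b, 0 <= a -> a <= b * L -> 0 <= b -> 0 <= a / M <= 4 * b).
  { intros a b Ha Hb Hb0. split.
    - apply Rdiv_le_0_compat; lra.
    - apply Rle_div_l; [lra|]. nra. }
  replace (X ^ 2 / (4 * M)) with (X ^ 2 / M / 4) by (field; lra).
  replace (L * K / (2 * M)) with (L * K / M / 2) by (field; lra).
  replace (K ^ 2 / (4 * M)) with (K ^ 2 / M / 4) by (field; lra).
  pose proof (Hd (X ^ 2) (9 * K) ltac:(lra) ltac:(nra) ltac:(lra)).
  pose proof (Hd (L * K) K ltac:(nra) ltac:(lra) ltac:(lra)).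
  pose proof (Hd (K ^ 2) K ltac:(nra) ltac:(nra) ltac:(lra)).
  apply Rabs_le; lra.
Qed.

Lemma gram_linear d e g1 g2 g3 g4 h1 h2 h3 h4 c Ap Am A0 Bp Bm B0 :
  gram d e (c * g1 + h1) (c * g2 + h2) (c * g3 + h3) (c * g4 + h4) Ap Am A0 Bp Bm B0
  = c * gram d e g1 g2 g3 g4 Ap Am A0 Bp Bm B0 + gram d e h1 h2 h3 h4 Ap Am A0 Bp Bm B0.
Proof. unfold gram; ring. Qed.

(** Exchanging the coordinates negates the determinant [d] and swaps the two mixed frequencies; thus
    [gram_near] serves both axes. *)
Lemma gram_swap d e g1 g2 g3 g4 Ap Am A0 Bp Bm B0 :
  gram d e g1 g2 g3 g4 Ap Am A0 Bp Bm B0 = gram (- d) e g1 g2 g4 g3 Bp Bm B0 Ap Am A0.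
Proof. unfold gram; ring. Qed.

Lemma Rabs_mult3_le a b c A B C : Rabs a <= A -> Rabs b <= B -> Rabs c <= C ->
  Rabs (a * b * c) <= A * B * C.
Proof.
  intros; rewrite !Rabs_mult.
  repeat apply Rmult_le_compat; auto using Rabs_pos, Rmult_le_pos.
Qed.

(** The expansion has sixteen terms: four with d^2, four with e^2 and eight with |d e| <= (d^2 +
    e^2) / 2. Their coefficients add up to 8 (d^2 + e^2). *)
Lemma gram_bound d e h1 h2 h3 h4 Ap Am A0 Bp Bm B0 T H :
  Rabs h1 <= H -> Rabs h2 <= H -> Rabs h3 <= H -> Rabs h4 <= H ->
  Rabs Ap <= T -> Rabs Am <= T -> Rabs A0 <= T ->
  Rabs Bp <= T -> Rabs Bm <= T -> Rabs B0 <= T ->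
  Rabs (gram d e h1 h2 h3 h4 Ap Am A0 Bp Bm B0) <= 8 * (d ^ 2 + e ^ 2) * (H * T * T).
Proof.
  intros.
  set (X := H * T * T).
  assert (P : forall h a b, Rabs h <= H -> Rabs a <= T -> Rabs b <= T -> Rabs (h * a * b) <= X)
    by (intros; now apply Rabs_mult3_le).
  assert (Q1 : forall x, Rabs x <= X -> - (d ^ 2 * X) <= d ^ 2 * x <= d ^ 2 * X).
  { intros x Hx; apply Rabs_le_between in Hx. pose proof (pow2_ge_0 d); nra. }
  assert (Q2 : forall x, Rabs x <= X -> - (e ^ 2 * X) <= e ^ 2 * x <= e ^ 2 * X).
  { intros x Hx; apply Rabs_le_between in Hx. pose proof (pow2_ge_0 e); nra. }
  assert (Q3 : forall x, Rabs x <= X ->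
    - ((d ^ 2 + e ^ 2) / 2 * X) <= d * e * x <= (d ^ 2 + e ^ 2) / 2 * X).
  { intros x Hx; apply Rabs_le_between in Hx.
    pose proof (pow2_ge_0 (d - e)). pose proof (pow2_ge_0 (d + e)). nra. }
  pose proof (Q1 _ (P h1 Ap Bp ltac:(auto) ltac:(auto) ltac:(auto))).
  pose proof (Q2 _ (P h3 Ap Bm ltac:(auto) ltac:(auto) ltac:(auto))).
  pose proof (Q3 _ (P h1 Ap B0 ltac:(auto) ltac:(auto) ltac:(auto))).
  pose proof (Q3 _ (P h3 Ap B0 ltac:(auto) ltac:(auto) ltac:(auto))).
  pose proof (Q1 _ (P h2 Am Bm ltac:(auto) ltac:(auto) ltac:(auto))).
  pose proof (Q2 _ (P h4 Am Bp ltac:(auto) ltac:(auto) ltac:(auto))).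
  pose proof (Q3 _ (P h2 Am B0 ltac:(auto) ltac:(auto) ltac:(auto))).
  pose proof (Q3 _ (P h4 Am B0 ltac:(auto) ltac:(auto) ltac:(auto))).
  pose proof (Q3 _ (P h1 A0 Bp ltac:(auto) ltac:(auto) ltac:(auto))).
  pose proof (Q3 _ (P h4 A0 Bp ltac:(auto) ltac:(auto) ltac:(auto))).
  pose proof (Q3 _ (P h2 A0 Bm ltac:(auto) ltac:(auto) ltac:(auto))).
  pose proof (Q3 _ (P h3 A0 Bm ltac:(auto) ltac:(auto) ltac:(auto))).
  pose proof (Q1 _ (P h1 A0 B0 ltac:(auto) ltac:(auto) ltac:(auto))).
  pose proof (Q1 _ (P h2 A0 B0 ltac:(auto) ltac:(auto) ltac:(auto))).
  pose proof (Q2 _ (P h3 A0 B0 ltac:(auto) ltac:(auto) ltac:(auto))).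
  pose proof (Q2 _ (P h4 A0 B0 ltac:(auto) ltac:(auto) ltac:(auto))).
  replace (gram d e h1 h2 h3 h4 Ap Am A0 Bp Bm B0) with
    (d ^ 2 * (h1 * Ap * Bp) + e ^ 2 * (h3 * Ap * Bm) + d * e * (h1 * Ap * B0) + d * e * (h3 * Ap * B0)
     + d ^ 2 * (h2 * Am * Bm) + e ^ 2 * (h4 * Am * Bp) + d * e * (h2 * Am * B0) + d * e * (h4 * Am * B0)
     - (d * e * (h1 * A0 * Bp) + d * e * (h4 * A0 * Bp) + d * e * (h2 * A0 * Bm) + d * e * (h3 * A0 * Bm)
        + d ^ 2 * (h1 * A0 * B0) + d ^ 2 * (h2 * A0 * B0) + e ^ 2 * (h3 * A0 * B0) + e ^ 2 * (h4 * A0 * B0)))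
    by (unfold gram; ring).
  apply Rabs_le. lra.
Qed.

(** Since k1 l1 <= K, the weights are +-w with w = 2 k2 l2, up to 15 K from [fM_estimate] and 2 K
    from the term in k1 l1. The part with weights +-w is zero for k2 = 0; otherwise equality of the
    [y]-products leaves the factor e^2 - d^2 = 4 k1 k2 l1 l2, again containing k1 l1, and hence the
    size K^2 L instead of order L^(3/2). The two parts cost 16 and 8 * 2 * 17 = 272. *)
Lemma gram_near k1 k2 l1 l2 Ap Am A0 Bp Bm B0 T :
  let K := k1 ^ 2 + k2 ^ 2 in let L := l1 ^ 2 + l2 ^ 2 in
  let f a b := fM K L (a ^ 2 + b ^ 2) in
  0 <= k1 -> 0 <= k2 -> 0 <= l1 -> 0 <= l2 -> 0 < K -> 8 * K <= L -> l1 <= k1 ->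
  Rabs Ap <= T -> Rabs Am <= T -> Rabs A0 <= T ->
  Rabs Bp <= T -> Rabs Bm <= T -> Rabs B0 <= T ->
  (k2 = 0 \/ (Bp = Bm /\ B0 = 0)) ->
  Rabs (gram (k2 * l1 - k1 * l2) (k2 * l1 + k1 * l2)
    (f (k1 + l1) (k2 + l2)) (f (k1 - l1) (k2 - l2)) (f (k1 + l1) (k2 - l2)) (f (k1 - l1) (k2 + l2))
    Ap Am A0 Bp Bm B0) <= 300 * T ^ 2 * K ^ 2 * L.
Proof.
  intros K L f Hk1 Hk2 Hl1 Hl2 HK HL Hl HAp HAm HA0 HBp HBm HB0 Hcase.
  set (d := k2 * l1 - k1 * l2). set (e := k2 * l1 + k1 * l2).
  set (w := 2 * (k2 * l2)).
  assert (Hkl : 0 <= k1 * l1 <= K) by (unfold K; nra).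
  assert (Hh : forall s, (s = 1 \/ s = -1) -> forall r, (r = 1 \/ r = -1) ->
     Rabs (f (k1 + s * l1) (k2 + r * l2) + r * w) <= 17 * K).
  { intros s Hs r Hr.
    set (t := s * (k1 * l1) + r * (k2 * l2)).
    assert (s ^ 2 = 1 /\ r ^ 2 = 1) as [Es Er] by (destruct Hs, Hr; subst; split; ring).
    assert (E : (k1 + s * l1) ^ 2 + (k2 + r * l2) ^ 2 = K + L + 2 * t).
    { unfold K, L, t. ring_simplify. rewrite Es, Er. ring. }
    assert (Ht : t ^ 2 <= K * L).
    { unfold t, K, L. pose proof (pow2_ge_0 (s * (k1 * l2) - r * (k2 * l1))).
      replace ((s * (k1 * l1) + r * (k2 * l2)) ^ 2) with
        (s ^ 2 * (k1 * l1) ^ 2 + r ^ 2 * (k2 * l2) ^ 2 + 2 * s * r * (k1 * l1 * k2 * l2)) by ring.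
      replace ((s * (k1 * l2) - r * (k2 * l1)) ^ 2) with
        (s ^ 2 * (k1 * l2) ^ 2 + r ^ 2 * (k2 * l1) ^ 2 - 2 * s * r * (k1 * l1 * k2 * l2)) in * by ring.
      rewrite Es, Er in *. nra. }
    pose proof (fM_estimate K L t HK HL Ht) as B. unfold f. rewrite E.
    replace (fM K L (K + L + 2 * t) + r * w) with
      ((fM K L (K + L + 2 * t) + 2 * t) + (- (2 * s * (k1 * l1)))) by (unfold t, w; ring).
    apply Rle_trans with (1 := Rabs_triang _ _).
    assert (Rabs (- (2 * s * (k1 * l1))) <= 2 * K); [|lra].
    apply Rabs_le. destruct Hs; subst s; lra. }
  set (h1 := f (k1 + l1) (k2 + l2) + w). set (h2 := f (k1 - l1) (k2 - l2) - w).
  set (h3 := f (k1 + l1) (k2 - l2) - w). set (h4 := f (k1 - l1) (k2 + l2) + w).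
  assert (B1 : Rabs h1 <= 17 * K).
  { unfold h1. specialize (Hh 1 (or_introl eq_refl) 1 (or_introl eq_refl)).
    rewrite !Rmult_1_l in Hh. exact Hh. }
  assert (B2 : Rabs h2 <= 17 * K).
  { unfold h2. specialize (Hh (-1) (or_intror eq_refl) (-1) (or_intror eq_refl)).
    replace (k1 + -1 * l1) with (k1 - l1) in Hh by ring.
    replace (k2 + -1 * l2) with (k2 - l2) in Hh by ring.
    replace (-1 * w) with (- w) in Hh by ring. exact Hh. }
  assert (B3 : Rabs h3 <= 17 * K).
  { unfold h3. specialize (Hh 1 (or_introl eq_refl) (-1) (or_intror eq_refl)).
    rewrite Rmult_1_l in Hh.
    replace (k2 + -1 * l2) with (k2 - l2) in Hh by ring.
    replace (-1 * w) with (- w) in Hh by ring. exact Hh. }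
  assert (B4 : Rabs h4 <= 17 * K).
  { unfold h4. specialize (Hh (-1) (or_intror eq_refl) 1 (or_introl eq_refl)).
    rewrite !Rmult_1_l in Hh.
    replace (k1 + -1 * l1) with (k1 - l1) in Hh by ring. exact Hh. }
  replace (f (k1 + l1) (k2 + l2)) with (w * -1 + h1) by (unfold h1; ring).
  replace (f (k1 - l1) (k2 - l2)) with (w * 1 + h2) by (unfold h2; ring).
  replace (f (k1 + l1) (k2 - l2)) with (w * 1 + h3) by (unfold h3; ring).
  replace (f (k1 - l1) (k2 + l2)) with (w * -1 + h4) by (unfold h4; ring).
  rewrite gram_linear. apply Rle_trans with (1 := Rabs_triang _ _).
  pose proof (gram_bound d e h1 h2 h3 h4 Ap Am A0 Bp Bm B0 T (17 * K)
    B1 B2 B3 B4 HAp HAm HA0 HBp HBm HB0) as G.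
  assert (Hde : d ^ 2 + e ^ 2 <= 2 * (K * L)).
  { unfold d, e, K, L. pose proof (pow2_ge_0 (k1 * l1)). pose proof (pow2_ge_0 (k2 * l2)). nra. }
  assert (HT : 0 <= T) by (eapply Rle_trans; [apply Rabs_pos|exact HAp]).
  assert (G' : 8 * (d ^ 2 + e ^ 2) * (17 * K * T * T) <= 272 * T ^ 2 * K ^ 2 * L).
  { replace (272 * T ^ 2 * K ^ 2 * L) with (8 * (2 * (K * L)) * (17 * K * T * T)) by ring.
    apply Rmult_le_compat_r; [|lra]. repeat apply Rmult_le_pos; lra. }
  assert (Rabs (w * gram d e (-1) 1 1 (-1) Ap Am A0 Bp Bm B0) <= 16 * T ^ 2 * K ^ 2 * L).
  { destruct Hcase as [Z | [Z1 Z2]].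
    - unfold w; rewrite Z. rewrite Rmult_0_l, Rmult_0_r, Rmult_0_l, Rabs_R0.
      repeat apply Rmult_le_pos; try apply pow_le; lra.
    - replace (w * gram d e (-1) 1 1 (-1) Ap Am A0 Bp Bm B0)
        with (8 * ((k1 * l1) * k2 ^ 2 * l2 ^ 2) * ((Ap - Am) * Bm * 1)).
      2:{ rewrite Z1, Z2. unfold gram, w, d, e. ring. }
      assert (HX : Rabs ((Ap - Am) * Bm * 1) <= 2 * T * T * 1).
      { apply Rabs_mult3_le; [|assumption|rewrite Rabs_R1; lra].
        apply Rle_trans with (1 := Rabs_triang _ _). rewrite Rabs_Ropp. lra. }
      rewrite Rabs_mult.
      assert (HY : 0 <= (k1 * l1) * k2 ^ 2 * l2 ^ 2 <= K * K * L).
      { pose proof (pow2_ge_0 k2). pose proof (pow2_ge_0 l2). pose proof (pow2_ge_0 k1).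
        pose proof (pow2_ge_0 l1). split.
        - repeat apply Rmult_le_pos; try lra; nra.
        - repeat apply Rmult_le_compat; try lra; try (unfold K, L; lra).
          apply Rmult_le_pos; lra. }
      rewrite (Rabs_pos_eq (8 * _)) by lra.
      replace (16 * T ^ 2 * K ^ 2 * L) with (8 * (K * K * L) * (2 * T * T * 1)) by ring.
      apply Rmult_le_compat; try apply Rabs_pos; lra. }
  assert (0 <= T ^ 2 * K ^ 2 * L) by (repeat apply Rmult_le_pos; try apply pow_le; lra).
  lra.
Qed.

Lemma gram_generic d e g1 g2 g3 g4 A0 B0 :
  (A0 = 0 /\ B0 = 0) -> gram d e g1 g2 g3 g4 PI PI A0 PI PI B0
    = PI ^ 2 * (d ^ 2 * (g1 + g2) + e ^ 2 * (g3 + g4)).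
Proof. intros [-> ->]; unfold gram; ring. Qed.

(** For k1 = 0 the frequencies k1 + l1 and k1 - l1 are opposite and do interfere; the mixed product
    -PI makes the cross terms a second copy of the generic form. *)
Lemma gram_generic_x d g1 g2 g3 g4 :
  g1 = g4 -> g2 = g3 -> gram d d g1 g2 g3 g4 PI PI (- PI) PI PI 0
    = 2 * PI ^ 2 * (d ^ 2 * (g1 + g2) + d ^ 2 * (g3 + g4)).
Proof. intros -> ->; unfold gram; ring. Qed.

Lemma gram_generic_y d g1 g2 g3 g4 :
  g1 = g3 -> g2 = g4 -> gram d (- d) g1 g2 g3 g4 PI PI 0 PI PI (- PI)
    = 2 * PI ^ 2 * (d ^ 2 * (g1 + g2) + (- d) ^ 2 * (g3 + g4)).
Proof. intros -> ->; unfold gram; ring. Qed.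

(** * Sectional curvatures *)

Lemma lap_kbr c1 m1 n1 q1 c2 m2 n2 q2 g1 g2 g3 g4 :
  let M a b := IZR a ^ 2 + IZR b ^ 2 in
  lap (kbr c1 m1 n1 q1 c2 m2 n2 q2 g1 g2 g3 g4) =
  kbr c1 m1 n1 q1 c2 m2 n2 q2
    (- M (m1 + m2)%Z (n1 + n2)%Z * g1) (- M (m1 - m2)%Z (n1 - n2)%Z * g2)
    (- M (m1 + m2)%Z (n1 - n2)%Z * g3) (- M (m1 - m2)%Z (n1 + n2)%Z * g4).
Proof.
  intros M; unfold kbr. rewrite lap_add4, !kwave_lap by apply wave_Smooth.
  do 2 f_equal; fext; unfold kwave, wave, M; ring.
Qed.

Lemma kbr_lin c1 m1 n1 q1 c2 m2 n2 q2 g1 g2 g3 g4 h1 h2 h3 h4 c :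
  fadd (fscal c (kbr c1 m1 n1 q1 c2 m2 n2 q2 g1 g2 g3 g4)) (kbr c1 m1 n1 q1 c2 m2 n2 q2 h1 h2 h3 h4)
  = kbr c1 m1 n1 q1 c2 m2 n2 q2 (c * g1 + h1) (c * g2 + h2) (c * g3 + h3) (c * g4 + h4).
Proof. unfold kbr, kwave, wave; fext; ring. Qed.

Lemma kbr_scal c1 m1 n1 q1 c2 m2 n2 q2 g1 g2 g3 g4 c :
  fscal c (kbr c1 m1 n1 q1 c2 m2 n2 q2 g1 g2 g3 g4)
  = kbr c1 m1 n1 q1 c2 m2 n2 q2 (c * g1) (c * g2) (c * g3) (c * g4).
Proof. unfold kbr, kwave, wave; fext; ring. Qed.

Definition knorm2 (m n : Z) : R := IZR m ^ 2 + IZR n ^ 2.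

(** Arranges the multiplier by the weights -1/M, 1 and -M with which [Q], [P] and [lap P] enter
    [ip_Rcurv]. The total inverse keeps this valid at frequency zero. *)
Lemma fM_eq K L M : fM K L M = - ((K - L) ^ 2 / 4) * - / M + ((K + L) / 2 * 1 + 3 / 4 * (- M * 1)).
Proof. unfold fM, Rdiv. rewrite Rinv_mult. generalize (/ M); intros; field. Qed.

Lemma ip_Rcurv_kwave c1 m1 n1 q1 c2 m2 n2 q2 :
  let u := kwave c1 m1 n1 q1 in let v := kwave c2 m2 n2 q2 in
  let K := knorm2 m1 n1 in let L := knorm2 m2 n2 in
  let f a b := fM K L (knorm2 a b) in
  ip (Rcurv u v u) v = intT (fmul (kbr c1 m1 n1 q1 c2 m2 n2 q2 1 1 1 1)
    (kbr c1 m1 n1 q1 c2 m2 n2 q2 (f (m1 + m2) (n1 + n2))%Z (f (m1 - m2) (n1 - n2))%Z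
       (f (m1 + m2) (n1 - n2))%Z (f (m1 - m2) (n1 + n2))%Z)).
Proof.
  intros u v K L f.
  rewrite (ip_Rcurv u v _ K L (kspan_kwave _ _ _ _) (kspan_kwave _ _ _ _)
    (kspan_kbr _ _ _ _ _ _ _ _ _ _ _ _) (kwave_lap _ _ _ _) (kwave_lap _ _ _ _)
    (kwave_bracket_lap_inv c1 m1 n1 q1 c2 m2 n2 q2)).
  unfold u, v. rewrite bracket_kwave, lap_kbr.
  rewrite <- !intT_fmul_scal_r by apply kspan_kbr.
  rewrite Rplus_assoc, <- !intT_fmul_add_r by auto using kspan, kspan_kbr.
  rewrite (kbr_scal _ _ _ _ _ _ _ _ _ _ _ _ (3 / 4)), !kbr_lin.
  unfold f. now rewrite !fM_eq.
Qed.

Lemma wave_sq_int c m n p q :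
  intT (fmul (wave c m p n q) (wave c m p n q)) =
  c ^ 2 * (J m m (p - PI / 2) (p - PI / 2) * J n n (q - PI / 2) (q - PI / 2)).
Proof.
  rewrite (intT_ext _ (fscal (c ^ 2) (fun x y =>
    (sin (m * x - (p - PI / 2)) * sin (m * x - (p - PI / 2))) *
    (sin (n * y - (q - PI / 2)) * sin (n * y - (q - PI / 2)))))).
  - rewrite intT_scal, intT_sep; try (intros; apply J_continuous); [reflexivity|].
    apply (cont2_sep (fun x => sin (m * x - (p - PI / 2)) * sin (m * x - (p - PI / 2)))
       (fun y => sin (n * y - (q - PI / 2)) * sin (n * y - (q - PI / 2)))); apply J_continuous.
  - intros x y; unfold fmul, fscal, wave. rewrite !sin_as_cos.
    replace (m * x - (p - PI / 2) - PI / 2) with (m * x - p) by ring.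
    replace (n * y - (q - PI / 2) - PI / 2) with (n * y - q) by ring. ring.
Qed.

Lemma J_zero p : cos p * cos p = 1 -> J 0 0 (p - PI / 2) (p - PI / 2) = 2 * PI.
Proof.
  intros H. unfold J. rewrite (RInt_ext _ (fun _ => 1)).
  - rewrite RInt_const. unfold scal; simpl; unfold mult; simpl; ring.
  - intros x _. rewrite !sin_as_cos.
    replace (0 * x - (p - PI / 2) - PI / 2) with (- p) by ring. now rewrite cos_neg.
Qed.

Lemma sec_kwave c1 m1 n1 q1 c2 m2 n2 q2 :
  let u := kwave c1 m1 n1 q1 in let v := kwave c2 m2 n2 q2 in
  let K := knorm2 m1 n1 in let L := knorm2 m2 n2 in
  K <> L ->
  sec u v = ip (Rcurv u v u) v / (K * intT (fmul u u) * (L * intT (fmul v v)))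
  /\ ip u v = 0.
Proof.
  intros u v K L H.
  assert (Hu : kspan u) by apply kspan_kwave. assert (Hv : kspan v) by apply kspan_kwave.
  assert (Eu : lap u = fscal (- K) u) by apply kwave_lap.
  assert (Ev : lap v = fscal (- L) v) by apply kwave_lap.
  assert (H0 : ip u v = 0).
  { pose proof (ip_eigen u v K Hu Hv Eu) as E1. pose proof (ip_eigen v u L Hv Hu Ev) as E2.
    rewrite ip_comm, intT_fmul_comm in E2.
    assert (intT (fmul u v) = 0) as Z; [|rewrite E1, Z; ring].
    apply Rmult_eq_reg_l with (K - L); lra. }
  split; [|exact H0]. unfold sec.
  rewrite H0, (ip_eigen u u K), (ip_eigen v v L) by assumption.
  f_equal; ring.
Qed.

Definition xphase (n : nat) : R := (INR n + 1) * (PI / 2).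

Lemma xphase_odd n : Nat.odd n = true -> exists j, xphase n = IZR j * PI.
Proof.
  intros H. apply Nat.odd_spec in H as [j ->]. exists (Z.of_nat j + 1)%Z. unfold xphase.
  rewrite plus_IZR, <- INR_IZR_INZ, plus_INR, mult_INR. simpl. field.
Qed.

(* The frequency-zero factors occur only with these phases: otherwise the mode vanishes,
   or its phase is irrelevant and is normalized. *)
Definition nondegenerate (k1 k2 : nat) (q : R) : Prop :=
  (k1 = 0%nat -> Nat.odd k2 = true) /\ (k2 = 0%nat -> q = 0).

Definition nwave (r : R) (k1 k2 : nat) (q : R) : fn2 := kwave r (Z.of_nat k1) (Z.of_nat k2) q.

Lemma nwave_sq_int r k1 k2 q : nondegenerate k1 k2 q ->
  let g (n : nat) := match n with O => 2 | _ => 1 end in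
  intT (fmul (nwave r k1 k2 q) (nwave r k1 k2 q)) = r ^ 2 * (g k1 * g k2 * PI ^ 2).
Proof.
  intros [H1 H2] g. unfold nwave, kwave. rewrite wave_sq_int.
  assert (E1 : J (IZR (Z.of_nat k1)) (IZR (Z.of_nat k1))
    ((IZR (Z.of_nat k2) + 1) * (PI / 2) - PI / 2) ((IZR (Z.of_nat k2) + 1) * (PI / 2) - PI / 2)
     = g k1 * PI).
  { destruct k1 as [|k1].
    - apply J_zero. rewrite <- INR_IZR_INZ.
      destruct (xphase_odd k2 (H1 eq_refl)) as [j Ej]. unfold xphase in Ej. rewrite Ej.
      apply cos_ZPI_sq.
    - rewrite J_diag by lia. simpl; ring. }
  assert (E2 : J (IZR (Z.of_nat k2)) (IZR (Z.of_nat k2)) (q - PI / 2) (q - PI / 2) = g k2 * PI).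
  { destruct k2 as [|k2].
    - apply J_zero. rewrite (H2 eq_refl), cos_0; ring.
    - rewrite J_diag by lia. simpl; ring. }
  rewrite E1, E2; ring.
Qed.

(** For k1 > 0 the frequencies k1 + l1 and k1 - l1 differ in modulus, so the sines are orthogonal.
    For k1 = 0 the parity of k2 makes [p1] a multiple of PI, and the second sine is minus the
    first. *)
Lemma gram_factor_x (k1 k2 l1 : nat) p2 : (k1 = 0%nat -> Nat.odd k2 = true) -> (k1 < l1)%nat ->
  let a := IZR (Z.of_nat k1) in let b := IZR (Z.of_nat l1) in
  let p1 := (IZR (Z.of_nat k2) + 1) * (PI / 2) in
  J (a + b) (a + b) (p1 + p2) (p1 + p2) = PI /\ J (a - b) (a - b) (p1 - p2) (p1 - p2) = PI /\
  ((k1 <> 0%nat /\ J (a + b) (a - b) (p1 + p2) (p1 - p2) = 0) \/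
   (k1 = 0%nat /\ J (a + b) (a - b) (p1 + p2) (p1 - p2) = - PI)).
Proof.
  intros H0 Hl a b p1. unfold a, b. rewrite <- !plus_IZR, <- !minus_IZR.
  split; [apply J_diag; lia|]. split; [apply J_diag; lia|].
  destruct (Nat.eq_dec k1 0) as [E|E]; [right|left]; split; auto.
  - rewrite <- (J_diag (Z.of_nat k1 + Z.of_nat l1) (p1 + p2)) by lia.
    rewrite (J_ext _ _ _ _ (IZR (Z.of_nat k1 + Z.of_nat l1)) (IZR (Z.of_nat k1 + Z.of_nat l1))
      (p1 + p2) (p1 + p2) (-1)); [ring|].
    intros t.
    replace (sin (IZR (Z.of_nat k1 - Z.of_nat l1) * t - (p1 - p2)))
      with (- sin (IZR (Z.of_nat k1 + Z.of_nat l1) * t - (p1 + p2))); [ring|].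
    destruct (xphase_odd k2 (H0 E)) as [j Ej]. unfold xphase in Ej. rewrite INR_IZR_INZ in Ej.
    fold p1 in Ej. rewrite <- sin_neg, !sin_as_cos, <- (cos_add_Z2PI _ (- j)), E. f_equal.
    rewrite Ej, plus_IZR, minus_IZR, opp_IZR; simpl; ring.
  - apply J_orth; lia.
Qed.

Lemma gram_factor_y (k2 l2 : nat) q1 q2 : (k2 = 0%nat -> q1 = 0) -> (k2 < l2)%nat ->
  let a := IZR (Z.of_nat k2) in let b := IZR (Z.of_nat l2) in
  J (a + b) (a + b) (q1 + q2) (q1 + q2) = PI /\ J (a - b) (a - b) (q1 - q2) (q1 - q2) = PI /\
  ((k2 <> 0%nat /\ J (a + b) (a - b) (q1 + q2) (q1 - q2) = 0) \/
   (k2 = 0%nat /\ J (a + b) (a - b) (q1 + q2) (q1 - q2) = - PI)).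
Proof.
  intros H0 Hl a b. unfold a, b. rewrite <- !plus_IZR, <- !minus_IZR.
  split; [apply J_diag; lia|]. split; [apply J_diag; lia|].
  destruct (Nat.eq_dec k2 0) as [E|E]; [right|left]; split; auto.
  - rewrite <- (J_diag (Z.of_nat k2 + Z.of_nat l2) (q1 + q2)) by lia.
    rewrite (J_ext _ _ _ _ (IZR (Z.of_nat k2 + Z.of_nat l2)) (IZR (Z.of_nat k2 + Z.of_nat l2))
      (q1 + q2) (q1 + q2) (-1)); [ring|].
    intros t. rewrite (H0 E), E.
    replace (sin (IZR (Z.of_nat 0 - Z.of_nat l2) * t - (0 - q2)))
      with (- sin (IZR (Z.of_nat 0 + Z.of_nat l2) * t - (0 + q2))); [ring|].
    rewrite <- sin_neg. f_equal. rewrite plus_IZR, minus_IZR; simpl; ring.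
  - apply J_orth; lia.
Qed.

Definition csec (k1 k2 l1 l2 : R) : R :=
  ((k2 * l1 - k1 * l2) ^ 4 + (k2 * l1 + k1 * l2) ^ 4)
  / (8 * PI ^ 2 * (k1 ^ 2 + k2 ^ 2) * (l1 ^ 2 + l2 ^ 2) ^ 2).

Lemma PI_sq_gt_1 : 1 < PI ^ 2.
Proof. pose proof PI2_1. nra. Qed.

Lemma csec_bound k1 k2 l1 l2 : 0 < k1 ^ 2 + k2 ^ 2 -> 0 < l1 ^ 2 + l2 ^ 2 ->
  0 <= csec k1 k2 l1 l2 <= k1 ^ 2 + k2 ^ 2.
Proof.
  intros HK HL. pose proof PI_sq_gt_1. unfold csec.
  set (d := k2 * l1 - k1 * l2). set (e := k2 * l1 + k1 * l2).
  assert (d ^ 2 + e ^ 2 <= 2 * ((k1 ^ 2 + k2 ^ 2) * (l1 ^ 2 + l2 ^ 2))).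
  { unfold d, e. pose proof (pow2_ge_0 (k1 * l1)). pose proof (pow2_ge_0 (k2 * l2)). nra. }
  set (K := k1 ^ 2 + k2 ^ 2) in *. set (L := l1 ^ 2 + l2 ^ 2) in *.
  assert (0 < K * L ^ 2) by (apply Rmult_lt_0_compat; [|apply pow_lt]; lra).
  assert (Hden : 0 < 8 * PI ^ 2 * K * L ^ 2).
  { rewrite Rmult_assoc. apply Rmult_lt_0_compat; lra. }
  assert (Hn : 0 <= d ^ 4 + e ^ 4 <= (2 * (K * L)) ^ 2).
  { pose proof (pow2_ge_0 d). pose proof (pow2_ge_0 e). split; [nra|].
    apply Rle_trans with ((d ^ 2 + e ^ 2) ^ 2); [nra|]. apply pow_incr; lra. }
  split.
  - apply Rdiv_le_0_compat; lra.
  - apply Rle_div_l; [lra|].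
    replace (K * (8 * PI ^ 2 * K * L ^ 2)) with (8 * PI ^ 2 * (K * L) ^ 2) by ring.
    pose proof (pow2_ge_0 (K * L)). nra.
Qed.

(** * Uniform bounds for one sectional curvature *)

Section Term.
Variables (r s : R) (k1 k2 l1 l2 : nat) (q q' : R).
Hypotheses (Hr : r <> 0) (Hs : s <> 0).
Hypotheses (Du : nondegenerate k1 k2 q) (Dv : nondegenerate l1 l2 q').
Let a1 := INR k1. Let b1 := INR k2. Let a2 := INR l1. Let b2 := INR l2.
Let K := a1 ^ 2 + b1 ^ 2.
Let L := a2 ^ 2 + b2 ^ 2.
Hypotheses (HK : 0 < K) (HL : 8 * K <= L).
Let u := nwave r k1 k2 q.
Let v := nwave s l1 l2 q'.
Let f a b := fM K L (a ^ 2 + b ^ 2).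
Let d := b1 * a2 - a1 * b2.
Let e := b1 * a2 + a1 * b2.

Lemma nwave_ip_0 : ip u v = 0.
Proof.
  apply sec_kwave. unfold knorm2. rewrite <- !INR_IZR_INZ. fold a1 b1 a2 b2. fold K L. lra.
Qed.

Lemma intT_sq_pos (c : R) (m n : nat) p : c <> 0 -> nondegenerate m n p ->
  c ^ 2 * PI ^ 2 <= intT (fmul (nwave c m n p) (nwave c m n p)).
Proof.
  intros Hc D. rewrite nwave_sq_int by assumption.
  apply Rmult_le_compat_l; [apply pow2_ge_0|]. pose proof (pow2_ge_0 PI).
  destruct m, n; lra.
Qed.

(** The six integrals matter only through a uniform bound and their values away from the axes, so
    they are hidden behind existential quantifiers. *)
Lemma sec_nwave : exists Ap Am A0 Bp Bm B0,
  sec u v = (r * s / 4) ^ 2 * gram d e (f (a1 + a2) (b1 + b2)) (f (a1 - a2) (b1 - b2))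
    (f (a1 + a2) (b1 - b2)) (f (a1 - a2) (b1 + b2)) Ap Am A0 Bp Bm B0
    / (K * intT (fmul u u) * (L * intT (fmul v v))) /\
  (Rabs Ap <= 2 * PI /\ Rabs Am <= 2 * PI /\ Rabs A0 <= 2 * PI) /\
  (Rabs Bp <= 2 * PI /\ Rabs Bm <= 2 * PI /\ Rabs B0 <= 2 * PI) /\
  ((k1 < l1)%nat -> Ap = PI /\ Am = PI /\ ((k1 <> 0%nat /\ A0 = 0) \/ (k1 = 0%nat /\ A0 = - PI))) /\
  ((k2 < l2)%nat -> Bp = PI /\ Bm = PI /\ ((k2 <> 0%nat /\ B0 = 0) \/ (k2 = 0%nat /\ B0 = - PI))).
Proof.
  destruct Du as [D1 D2].
  assert (HKL : knorm2 (Z.of_nat k1) (Z.of_nat k2) <> knorm2 (Z.of_nat l1) (Z.of_nat l2)).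
  { unfold knorm2. rewrite <- !INR_IZR_INZ. fold a1 b1 a2 b2. fold K L. lra. }
  pose proof (proj1 (sec_kwave r (Z.of_nat k1) (Z.of_nat k2) q s (Z.of_nat l1) (Z.of_nat l2) q' HKL)) as E.
  rewrite ip_Rcurv_kwave, intT_kbr_kbr in E.
  do 6 eexists. split; [|split; [|split; [|split]]].
  - unfold knorm2 in E. rewrite !plus_IZR, !minus_IZR in E. 
    unfold u, v, nwave, f, d, e, K, L, a1, b1, a2, b2. rewrite !INR_IZR_INZ. exact E.
  - split; [|split]; apply J_bound.
  - split; [|split]; apply J_bound.
  - intros H. now apply gram_factor_x.
  - intros H. now apply gram_factor_y.
Qed.

Lemma den_pos : 0 < K * intT (fmul u u) * (L * intT (fmul v v)) /\
  r ^ 2 * s ^ 2 * K * L * PI ^ 4 <= K * intT (fmul u u) * (L * intT (fmul v v)).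
Proof.
  pose proof (intT_sq_pos r k1 k2 q Hr Du) as H1. pose proof (intT_sq_pos s l1 l2 q' Hs Dv) as H2.
  fold u in H1. fold v in H2. pose proof PI_RGT_0.
  assert (P1 : 0 < r ^ 2 * PI ^ 2) by (apply Rmult_lt_0_compat; [nra|apply pow_lt; lra]).
  assert (P2 : 0 < s ^ 2 * PI ^ 2) by (apply Rmult_lt_0_compat; [nra|apply pow_lt; lra]).
  split.
  - repeat apply Rmult_lt_0_compat; lra.
  - replace (r ^ 2 * s ^ 2 * K * L * PI ^ 4) with (K * (r ^ 2 * PI ^ 2) * (L * (s ^ 2 * PI ^ 2))) by ring.
    apply Rmult_le_compat; try (apply Rmult_le_pos; lra); apply Rmult_le_compat_l; lra.
Qed.

(** The constants give 300 (2 PI)^2 / 16 = 75 PI^2, which the PI^4 of the denominator absorbs. *)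
Lemma sec_of_gram_bound G : Rabs G <= 300 * (2 * PI) ^ 2 * K ^ 2 * L ->
  Rabs ((r * s / 4) ^ 2 * G / (K * intT (fmul u u) * (L * intT (fmul v v)))) <= 75 * K.
Proof.
  intros HG. destruct den_pos as [Hp Hd]. pose proof PI_sq_gt_1.
  set (D := K * intT (fmul u u) * (L * intT (fmul v v))) in *.
  unfold Rdiv at 1. rewrite Rabs_mult, (Rabs_pos_eq (/ D)) by (apply Rlt_le, Rinv_0_lt_compat, Hp).
  apply Rmult_le_reg_r with D; [assumption|]. rewrite Rmult_assoc, Rinv_l, Rmult_1_r by lra.
  rewrite Rabs_mult, (Rabs_pos_eq (_ ^ 2)) by apply pow2_ge_0.
  apply Rle_trans with ((r * s / 4) ^ 2 * (300 * (2 * PI) ^ 2 * K ^ 2 * L)).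
  { apply Rmult_le_compat_l; [apply pow2_ge_0|assumption]. }
  apply Rle_trans with (75 * K * (r ^ 2 * s ^ 2 * K * L * PI ^ 4)).
  2:{ apply Rmult_le_compat_l; lra. }
  replace ((r * s / 4) ^ 2 * (300 * (2 * PI) ^ 2 * K ^ 2 * L))
    with (75 * (r ^ 2 * s ^ 2 * K ^ 2 * L * PI ^ 2) * 1) by field.
  replace (75 * K * (r ^ 2 * s ^ 2 * K * L * PI ^ 4)) with
    (75 * (r ^ 2 * s ^ 2 * K ^ 2 * L * PI ^ 2) * PI ^ 2) by ring.
  apply Rmult_le_compat_l; [|lra].
  repeat (apply pow2_ge_0 || apply Rmult_le_pos); lra.
Qed.

Lemma sec_near_x : (l1 <= k1)%nat -> Rabs (sec u v) <= 75 * K.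
Proof.
  intros H. destruct sec_nwave as (Ap & Am & A0 & Bp & Bm & B0 & E & (HAp & HAm & HA0) & (HBp & HBm & HB0) & _ & HB).
  rewrite E. apply sec_of_gram_bound.
  apply le_INR in H as H'. fold a1 a2 in H'.
  assert (0 <= a1 /\ 0 <= a2 /\ 0 <= b1 /\ 0 <= b2) as (? & ? & ? & ?) by (repeat split; apply pos_INR).
  apply gram_near; try assumption.
  (* l1 <= k1 and l2 <= k2 together would give L <= K; hence l2 > k2 and the [y]-products are
     known. *)
  destruct (le_lt_dec l2 k2) as [Hl|Hl].
  - apply le_INR in Hl. fold b1 b2 in Hl. unfold K, L in *. exfalso. nra.
  - destruct (HB Hl) as (-> & -> & [[_ Z]|[Z _]]); [now right|].
    left. unfold b1. now rewrite Z.
Qed.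

Lemma sec_near_y : (l2 <= k2)%nat -> Rabs (sec u v) <= 75 * K.
Proof.
  intros H. destruct sec_nwave as (Ap & Am & A0 & Bp & Bm & B0 & E & (HAp & HAm & HA0) & (HBp & HBm & HB0) & HA & _).
  rewrite E. apply sec_of_gram_bound.
  apply le_INR in H as H'. fold b1 b2 in H'.
  assert (0 <= a1 /\ 0 <= a2 /\ 0 <= b1 /\ 0 <= b2) as (? & ? & ? & ?) by (repeat split; apply pos_INR).
  pose proof (gram_near b1 a1 b2 a2 Bp Bm B0 Ap Am A0 (2 * PI)) as G. cbv zeta in G.
  rewrite (Rplus_comm (b1 ^ 2)), (Rplus_comm (b2 ^ 2)) in G. fold K L in G.
  rewrite gram_swap.
  assert (X : forall a b, fM K L (b ^ 2 + a ^ 2) = f a b) by (intros; unfold f; f_equal; ring).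
  rewrite !X in G.
  replace (- d) with (a1 * b2 - b1 * a2) by (unfold d; ring).
  replace e with (a1 * b2 + b1 * a2) by (unfold e; ring).
  apply G; try assumption.
  destruct (le_lt_dec l1 k1) as [Hl|Hl].
  - apply le_INR in Hl. fold a1 a2 in Hl. unfold K, L in *. exfalso. nra.
  - destruct (HA Hl) as (-> & -> & [[_ Z]|[Z _]]); [now right|].
    left. unfold a1. now rewrite Z.
Qed.

(** If k1 or k2 is zero, interference doubles the quadratic form, but the squared norm of [u]
    doubles as well, so all cases share one formula. *)
Lemma sec_generic_eq : (k1 < l1)%nat -> (k2 < l2)%nat -> sec u v =
  (d ^ 2 * (f (a1 + a2) (b1 + b2) + f (a1 - a2) (b1 - b2))
   + e ^ 2 * (f (a1 + a2) (b1 - b2) + f (a1 - a2) (b1 + b2))) / (16 * PI ^ 2 * K * L).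
Proof.
  intros H1 H2. destruct sec_nwave as (Ap & Am & A0 & Bp & Bm & B0 & E & _ & _ & HA & HB).
  rewrite E. destruct (HA H1) as (-> & -> & CA). destruct (HB H2) as (-> & -> & CB).
  unfold u, v. rewrite !nwave_sq_int by assumption.
  pose proof PI_RGT_0 as Hpi.
  destruct l1 as [|l1']; [lia|]. destruct l2 as [|l2']; [lia|].
  assert (K <> 0) by lra. assert (L <> 0) by lra. assert (PI <> 0) by lra.
  destruct CA as [[N1 ->]|[N1 ->]], CB as [[N2 ->]|[N2 ->]].
  - rewrite gram_generic by auto. destruct k1; [lia|]. destruct k2; [lia|].
    field. repeat split; assumption.
  - assert (Z : b1 = 0) by (unfold b1; now rewrite N2).
    replace e with (- d) by (unfold d, e; rewrite Z; ring).
    rewrite gram_generic_y by (unfold f; rewrite Z; f_equal; ring).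
    destruct k1; [lia|]. rewrite N2.
    field. repeat split; assumption.
  - assert (Z : a1 = 0) by (unfold a1; now rewrite N1).
    replace e with d by (unfold d, e; rewrite Z; ring).
    rewrite gram_generic_x by (unfold f; rewrite Z; f_equal; ring).
    destruct k2; [lia|]. rewrite N1.
    field. repeat split; assumption.
  - exfalso. unfold K, a1, b1 in HK. rewrite N1, N2 in HK. simpl in HK. lra.
Qed.

(** [pair_estimate] is used twice: for k +- l with determinant d, and for k +- (l1, -l2) with
    determinant e. Each contributes 64 K^3 before division by 16 PI^2 K L. *)
Lemma sec_generic : (k1 < l1)%nat -> (k2 < l2)%nat ->
  Rabs (sec u v + csec a1 b1 a2 b2) <= 8 * K ^ 2 / L.
Proof.
  intros H1 H2. rewrite sec_generic_eq by assumption.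
  pose proof PI_sq_gt_1.
  assert (P1 := pair_estimate K L (a1 * a2 + b1 * b2) d HK ltac:(lra) ltac:(unfold K, L, d; ring)).
  assert (P2 := pair_estimate K L (a1 * a2 - b1 * b2) e HK ltac:(lra) ltac:(unfold K, L, e; ring)).
  replace (K + L + 2 * (a1 * a2 + b1 * b2)) with ((a1 + a2) ^ 2 + (b1 + b2) ^ 2) in P1 by (unfold K, L; ring).
  replace (K + L - 2 * (a1 * a2 + b1 * b2)) with ((a1 - a2) ^ 2 + (b1 - b2) ^ 2) in P1 by (unfold K, L; ring).
  replace (K + L + 2 * (a1 * a2 - b1 * b2)) with ((a1 + a2) ^ 2 + (b1 - b2) ^ 2) in P2 by (unfold K, L; ring).
  replace (K + L - 2 * (a1 * a2 - b1 * b2)) with ((a1 - a2) ^ 2 + (b1 + b2) ^ 2) in P2 by (unfold K, L; ring).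
  fold (f (a1 + a2) (b1 + b2)) (f (a1 - a2) (b1 - b2)) in P1.
  fold (f (a1 + a2) (b1 - b2)) (f (a1 - a2) (b1 + b2)) in P2.
  unfold csec. fold d e K L.
  set (x := _ + 2 * d ^ 4 / L) in P1. set (y := _ + 2 * e ^ 4 / L) in P2.
  match goal with |- Rabs ?z <= _ => replace z with ((x + y) / (16 * PI ^ 2 * K * L)) end.
  2:{ unfold x, y. field. repeat split; try lra. pose proof PI_RGT_0; lra. }
  assert (0 < K * L) by (apply Rmult_lt_0_compat; lra).
  assert (HD : 0 < 16 * PI ^ 2 * K * L) by (rewrite Rmult_assoc; apply Rmult_lt_0_compat; lra).
  unfold Rdiv at 1. rewrite Rabs_mult, (Rabs_pos_eq (/ _)) by (apply Rlt_le, Rinv_0_lt_compat, HD).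
  apply Rmult_le_reg_r with (1 := HD). rewrite Rmult_assoc, Rinv_l, Rmult_1_r by lra.
  apply Rle_trans with (1 := Rabs_triang _ _).
  replace (8 * K ^ 2 / L * (16 * PI ^ 2 * K * L)) with (128 * K ^ 3 * PI ^ 2) by (field; lra).
  assert (0 < K ^ 3) by (apply pow_lt; lra). nra.
Qed.

(** Merges three regimes. Beside an axis 76 K = 75 K + K bounds curvature and leading term together,
    and l1 <= k1 (or l2 <= k2) lets a factor k1 + 1 (or k2 + 1) pay for the weight. In the generic
    case l1 + 1 <= 2 L turns 8 K^2 / L into 16 K^2 / (l1 + 1). *)
Lemma sec_estimate : Rabs (sec u v + csec a1 b1 a2 b2) <=
  (76 * K * (a1 + 1) + 76 * K * (b1 + 1) + 16 * K ^ 2) * (/ (a2 + 1) + / (b2 + 1)).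
Proof.
  assert (0 <= a1 /\ 0 <= a2 /\ 0 <= b1 /\ 0 <= b2) as (? & ? & ? & ?) by (repeat split; apply pos_INR).
  assert (IA : 0 < / (a2 + 1)) by (apply Rinv_0_lt_compat; lra).
  assert (IB : 0 < / (b2 + 1)) by (apply Rinv_0_lt_compat; lra).
  set (C1 := 76 * K * (a1 + 1)). set (C2 := 76 * K * (b1 + 1)). set (C3 := 16 * K ^ 2).
  assert (0 <= C1 /\ 0 <= C2 /\ 0 <= C3) as (? & ? & ?).
  { unfold C1, C2, C3. repeat split; repeat apply Rmult_le_pos; try apply pow2_ge_0; lra. }
  assert (B := csec_bound a1 b1 a2 b2 HK ltac:(fold L; lra)). fold K in B.
  assert (near : Rabs (sec u v) <= 75 * K -> Rabs (sec u v + csec a1 b1 a2 b2) <= 76 * K).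
  { intros Hn. apply Rle_trans with (1 := Rabs_triang _ _). rewrite (Rabs_pos_eq (csec _ _ _ _)); lra. }
  destruct (le_lt_dec l1 k1) as [G1|G1]; [|destruct (le_lt_dec l2 k2) as [G2|G2]].
  - specialize (near (sec_near_x G1)). apply le_INR in G1. fold a1 a2 in G1.
    apply Rle_trans with (1 := near).
    apply Rle_trans with (C1 * / (a2 + 1)); [|nra].
    replace (76 * K) with (76 * K * (a2 + 1) * / (a2 + 1)) by (field; lra).
    apply Rmult_le_compat_r; [lra|]. unfold C1. apply Rmult_le_compat_l; lra.
  - specialize (near (sec_near_y G2)). apply le_INR in G2. fold b1 b2 in G2.
    apply Rle_trans with (1 := near).
    apply Rle_trans with (C2 * / (b2 + 1)); [|nra].
    replace (76 * K) with (76 * K * (b2 + 1) * / (b2 + 1)) by (field; lra).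
    apply Rmult_le_compat_r; [lra|]. unfold C2. apply Rmult_le_compat_l; lra.
  - apply Rle_trans with (1 := sec_generic G1 G2).
    apply Rle_trans with (C3 * / (a2 + 1)); [|nra].
    assert (1 <= a2) by (apply (le_INR 1); lia).
    unfold C3, Rdiv. rewrite (Rmult_assoc 16), (Rmult_assoc 8).
    replace (16 * (K ^ 2 * / (a2 + 1))) with (8 * (K ^ 2 * (/ (a2 + 1) * 2))) by ring.
    apply Rmult_le_compat_l; [lra|]. apply Rmult_le_compat_l; [apply pow2_ge_0|].
    apply Rmult_le_reg_r with (L * (a2 + 1)); [apply Rmult_lt_0_compat; lra|].
    replace (/ L * (L * (a2 + 1))) with (a2 + 1) by (field; lra).
    replace (/ (a2 + 1) * 2 * (L * (a2 + 1))) with (2 * L) by (field; lra).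
    unfold L. nra.
Qed.

(** The eigenvalues differ, so [v] is orthogonal to [u]; as a multiple of [u] it would be orthogonal
    to itself, although its norm is positive. *)
Lemma nwave_not_inLine : ~ inLine u v.
Proof.
  intros [c E].
  assert (Ev : v = fscal c u) by (fext; apply E).
  assert (Hu : kspan u) by apply kspan_kwave. assert (Hv : kspan v) by apply kspan_kwave.
  pose proof (intT_sq_pos s l1 l2 q' Hs Dv) as H2. fold v in H2.
  assert (0 < s ^ 2 * PI ^ 2).
  { pose proof PI_RGT_0. apply Rmult_lt_0_compat; [nra|apply pow_lt; lra]. }
  assert (Z : ip v v = 0).
  { rewrite Ev at 1. rewrite ip_scal_l, nwave_ip_0 by now apply kspan_C1. ring. }
  assert (Elap : lap v = fscal (- L) v).
  { unfold v, nwave. rewrite kwave_lap, <- !INR_IZR_INZ. reflexivity. }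
  rewrite (ip_eigen v v L Hv Hv Elap) in Z. nra.
Qed.
End Term.

(** * Lattice points in a quarter disk *)

Definition lsum {T : Type} (f : T -> R) (s : list T) : R := fold_right Rplus 0 (map f s).

Lemma lsum_app {T} (f : T -> R) s1 s2 : lsum f (s1 ++ s2) = lsum f s1 + lsum f s2.
Proof. unfold lsum; induction s1; simpl; [ring|rewrite IHs1; ring]. Qed.

Lemma lsum_flat_map {S T} (f : T -> R) (g : S -> list T) s :
  lsum f (flat_map g s) = lsum (fun x => lsum f (g x)) s.
Proof. induction s; [reflexivity|]. simpl. rewrite lsum_app, IHs; reflexivity. Qed.

Lemma lsum_ext {T} (f g : T -> R) s : (forall x, In x s -> f x = g x) -> lsum f s = lsum g s.
Proof.
  unfold lsum; induction s; simpl; intros H; [reflexivity|].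
  rewrite (H a), IHs; auto.
Qed.

Lemma lsum_lin {T} (f g : T -> R) a b s :
  lsum (fun x => a * f x + b * g x) s = a * lsum f s + b * lsum g s.
Proof. unfold lsum; induction s; simpl; [ring|rewrite IHs; ring]. Qed.

Lemma lsum_le {T} (f g : T -> R) s : (forall x, In x s -> f x <= g x) -> lsum f s <= lsum g s.
Proof.
  unfold lsum; induction s; simpl; intros H; [lra|].
  apply Rplus_le_compat; auto.
Qed.

Lemma lsum_abs {T} (f : T -> R) s : Rabs (lsum f s) <= lsum (fun x => Rabs (f x)) s.
Proof.
  unfold lsum; induction s; simpl; [rewrite Rabs_R0; lra|].
  apply Rle_trans with (1 := Rabs_triang _ _). lra.
Qed.

Lemma lsum_const {T} c (s : list T) : lsum (fun _ => c) s = INR (length s) * c.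
Proof.
  unfold lsum; induction s; [simpl; ring|].
  change (length (a :: s)) with (S (length s)). rewrite S_INR. simpl. rewrite IHs. ring.
Qed.

Lemma lsum_swap {S T} (f : S -> T -> R) s t :
  lsum (fun x => lsum (fun y => f x y) t) s = lsum (fun y => lsum (fun x => f x y) s) t.
Proof.
  induction s as [|a s IH].
  - change (0 = lsum (fun _ => 0) t). rewrite lsum_const; ring.
  - change (lsum (fun y => f a y) t + lsum (fun x => lsum (fun y => f x y) t) s
      = lsum (fun y => f a y + lsum (fun x => f x y) s) t).
    rewrite IH. transitivity (lsum (fun y => 1 * f a y + 1 * lsum (fun x => f x y) s) t).
    + rewrite (lsum_lin (fun y => f a y) (fun y => lsum (fun x => f x y) s)); ring.
    + apply lsum_ext; intros; ring.
Qed.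

Lemma lsum_prefix (g : nat -> R) (c : nat -> bool) m n : (m <= n)%nat ->
  (forall j, (j < n)%nat -> (c j = true <-> (j < m)%nat)) ->
  lsum (fun j => if c j then g j else 0) (seq 0 n) = lsum g (seq 0 m).
Proof.
  intros Hm Hc. replace n with (m + (n - m))%nat by lia. rewrite seq_app, lsum_app.
  rewrite (lsum_ext _ g (seq 0 m)).
  - rewrite (lsum_ext _ (fun _ => 0) (seq (0 + m) _)); [rewrite lsum_const; ring|].
    intros j Hj; apply in_seq in Hj. destruct (c j) eqn:E; [|reflexivity].
    apply Hc in E; lia.
  - intros j Hj; apply in_seq in Hj. rewrite (proj2 (Hc j ltac:(lia))) by lia. reflexivity.
Qed.

Lemma lsum_seq_S (g : nat -> R) n : lsum g (seq 0 (S n)) = lsum g (seq 0 n) + g n.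
Proof. rewrite seq_S, lsum_app. unfold lsum at 2; simpl; ring. Qed.

Definition dsum (n : nat) (g : nat -> nat -> R) : R :=
  lsum (fun i => lsum (fun j => if Nat.leb (i * i + j * j) (n * n) then g i j else 0)
    (seq 0 (S n))) (seq 0 (S n)).

Lemma dsum_ext n f g : (forall i j, f i j = g i j) -> dsum n f = dsum n g.
Proof.
  intros H. unfold dsum. apply lsum_ext; intros i _. apply lsum_ext; intros j _.
  now rewrite H.
Qed.

Lemma dsum_lin n f g a b : dsum n (fun i j => a * f i j + b * g i j) = a * dsum n f + b * dsum n g.
Proof.
  unfold dsum. rewrite <- lsum_lin. apply lsum_ext; intros i _.
  rewrite <- lsum_lin. apply lsum_ext; intros j _. destruct (Nat.leb _ _); ring.
Qed.

Lemma dsum_swap n g : dsum n (fun i j => g j i) = dsum n g.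
Proof.
  unfold dsum. rewrite lsum_swap. apply lsum_ext; intros i _. apply lsum_ext; intros j _.
  now rewrite (Nat.add_comm (j * j)).
Qed.

Lemma dsum_abs_le n f g : (forall i j, Rabs (f i j) <= g i j) -> Rabs (dsum n f) <= dsum n g.
Proof.
  intros H. unfold dsum. apply Rle_trans with (1 := lsum_abs _ _).
  apply lsum_le; intros i _. apply Rle_trans with (1 := lsum_abs _ _).
  apply lsum_le; intros j _. destruct (Nat.leb _ _); [apply H|rewrite Rabs_R0; lra].
Qed.

(** The order R^(3/2) of all error terms, shifted so that it also dominates n + 1. *)
Definition err (n : nat) : R := (INR n + 1) * sqrt (INR n + 1).

Lemma sqrt_ge_1 x : 1 <= x -> 1 <= sqrt x.
Proof. intros H; rewrite <- sqrt_1 at 1; now apply sqrt_le_1_alt. Qed.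

Lemma err_ge n : INR n + 1 <= err n.
Proof.
  unfold err. pose proof (pos_INR n).
  assert (1 <= sqrt (INR n + 1)) by (apply sqrt_ge_1; lra). nra.
Qed.

(** A logarithm would be sharp, but the square root telescopes, 1/b <= 2 (b - a) for consecutive
    roots a and b, and matches [err]. *)
Lemma harmonic_le m : lsum (fun i => / (INR i + 1)) (seq 0 m) <= 2 * sqrt (INR m).
Proof.
  induction m as [|m IH]; [change (0 <= 2 * sqrt 0); rewrite sqrt_0; lra|].
  rewrite lsum_seq_S, S_INR. pose proof (pos_INR m).
  set (a := sqrt (INR m)) in *. set (b := sqrt (INR m + 1)).
  assert (Ha : a * a = INR m) by (apply sqrt_sqrt; lra).
  assert (Hb : b * b = INR m + 1) by (apply sqrt_sqrt; lra).
  assert (0 <= a) by apply sqrt_pos. 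
  assert (1 <= b) by (apply sqrt_ge_1; lra).
  assert (/ (INR m + 1) <= / b).
  { apply Rinv_le_contravar; nra. }
  assert (/ b <= 2 * (b - a)); [|lra].
  apply Rmult_le_reg_r with b; [lra|]. rewrite Rinv_l by lra. nra.
Qed.

Lemma lsum_inv_le n : lsum (fun i => / (INR i + 1)) (seq 0 (S n)) <= 2 * sqrt (INR n + 1).
Proof. rewrite <- S_INR; apply harmonic_le. Qed.

Lemma dsum_inv_l n : dsum n (fun i j => / (INR i + 1)) <= 2 * err n.
Proof.
  apply Rle_trans with (lsum (fun i => (INR n + 1) * / (INR i + 1) + 0 * 0) (seq 0 (S n))).
  - unfold dsum. apply lsum_le; intros i _.
    assert (0 < / (INR i + 1)) by (apply Rinv_0_lt_compat; pose proof (pos_INR i); lra).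
    apply Rle_trans with (lsum (fun _ => / (INR i + 1)) (seq 0 (S n))).
    + apply lsum_le; intros j _. destruct (Nat.leb _ _); lra.
    + rewrite lsum_const, length_seq, S_INR. lra.
  - rewrite (lsum_lin _ (fun _ => 0)). pose proof (lsum_inv_le n). unfold err.
    pose proof (pos_INR n). nra.
Qed.

Definition weight (i j : nat) : R := / (INR i + 1) + / (INR j + 1).

Lemma dsum_weight n : dsum n weight <= 4 * err n.
Proof.
  rewrite (dsum_ext n weight (fun i j => 1 * / (INR i + 1) + 1 * / (INR j + 1)))
    by (intros; unfold weight; ring).
  rewrite (dsum_lin n (fun i _ => / (INR i + 1)) (fun _ j => / (INR j + 1))).
  rewrite (dsum_swap n (fun i _ => / (INR i + 1))). pose proof (dsum_inv_l n). lra.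
Qed.

(** The square of points with both coordinates at most n / 2 lies in the disk. Only the order n^2 of
    the count matters. *)
Lemma dsum_1_ge n : (INR n + 1) ^ 2 / 4 <= dsum n (fun _ _ => 1).
Proof.
  set (m := S (Nat.div2 n)).
  assert (Hm : (m <= S n)%nat) by (unfold m; pose proof (Nat.div2_odd n); lia).
  assert (Hsq : forall i j, (i < m)%nat -> (j < m)%nat -> (i * i + j * j <= n * n)%nat).
  { intros i j Hi Hj. unfold m in *.
    assert (2 * Nat.div2 n <= n)%nat by (pose proof (Nat.div2_odd n); lia). nia. }
  assert (Hm2 : INR n + 1 <= 2 * INR m).
  { unfold m. rewrite <- S_INR. replace 2 with (INR 2) by reflexivity. rewrite <- mult_INR.
    apply le_INR. pose proof (Nat.div2_odd n). destruct (Nat.odd n); simpl Nat.b2n in *; lia. }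
  apply Rle_trans with (lsum (fun i => if Nat.ltb i m then INR m else 0) (seq 0 (S n))).
  - rewrite (lsum_prefix (fun _ => INR m) (fun i => Nat.ltb i m) m); [|assumption|].
    + rewrite lsum_const, length_seq. pose proof (pos_INR n). nra.
    + intros; apply Nat.ltb_lt.
  - unfold dsum. apply lsum_le; intros i _. destruct (Nat.ltb i m) eqn:E.
    + apply Nat.ltb_lt in E.
      apply Rle_trans with (lsum (fun j => if Nat.ltb j m then 1 else 0) (seq 0 (S n))).
      * rewrite (lsum_prefix (fun _ => 1) (fun i => Nat.ltb i m) m); [|assumption|].
        -- rewrite lsum_const, length_seq. lra.
        -- intros; apply Nat.ltb_lt.
      * apply lsum_le; intros j _. destruct (Nat.ltb j m) eqn:E2.
        -- apply Nat.ltb_lt in E2. rewrite (proj2 (Nat.leb_le _ _) (Hsq i j E E2)). lra.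
        -- cbv beta; destruct (Nat.leb (i * i + j * j) (n * n)); lra.
    + apply Rle_trans with (lsum (fun _ => 0) (seq 0 (S n))); [rewrite lsum_const; lra|].
      apply lsum_le; intros j _. cbv beta; destruct (Nat.leb (i * i + j * j) (n * n)); lra.
Qed.

(** * The mean of cos(4 theta) over the quarter disk *)

Lemma Lipschitz_of_derive (h h' : R -> R) M a b : a <= b ->
  (forall t, a <= t <= b -> is_derive h t (h' t)) -> (forall t, a <= t <= b -> Rabs (h' t) <= M) ->
  Rabs (h b - h a) <= M * (b - a).
Proof.
  intros Hab Hd HM.
  destruct (MVT_gen h a b h') as (c & Hc & E).
  - intros x Hx. rewrite Rmin_left, Rmax_right in Hx by lra. apply Hd; lra.
  - intros x Hx. rewrite Rmin_left, Rmax_right in Hx by lra.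
    apply derivable_continuous_pt, ex_derive_Reals_0. eexists; now apply Hd.
  - rewrite Rmin_left, Rmax_right in Hc by lra.
    rewrite E, Rabs_mult, (Rabs_pos_eq (b - a)) by lra.
    apply Rmult_le_compat_r; [lra|auto].
Qed.

(* [angA] is [cos(theta)^2 * cos(4 theta)] and [angF] an antiderivative of it in [y]. *)
Definition angA (x y : R) : R := x ^ 2 * (x ^ 4 - 6 * x ^ 2 * y ^ 2 + y ^ 4) / (x ^ 2 + y ^ 2) ^ 3.
Definition angF (x y : R) : R := x ^ 2 * y * (x ^ 2 - y ^ 2) / (x ^ 2 + y ^ 2) ^ 2.
Definition angA' (x y : R) : R :=
  x ^ 2 * (- 18 * x ^ 4 * y + 28 * x ^ 2 * y ^ 3 - 2 * y ^ 5) / (x ^ 2 + y ^ 2) ^ 4.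

(** With y = x tan(theta), the weight cos(theta)^2 cancels the Jacobian of dy = x dtheta /
    cos(theta)^2, so [angF] is x sin(4 theta) / 4. For cos(4 theta) alone the primitive in y would
    contain an arctangent. *)
Lemma angF_derive x y : 0 < x -> is_derive (angF x) y (angA x y).
Proof.
  intros Hx. assert (0 < x ^ 2 + y ^ 2) by nra.
  unfold angF, angA. auto_derive; [nra|]. field. nra.
Qed.

Lemma angA_derive x y : 0 < x -> is_derive (angA x) y (angA' x y).
Proof.
  intros Hx. assert (0 < x ^ 2 + y ^ 2) by nra.
  unfold angA, angA'. auto_derive; [apply Rgt_not_eq; repeat apply Rmult_lt_0_compat; nra|]. field. nra.
Qed.

Lemma angA_bound x y : 0 < x -> Rabs (angA x y) <= 1.
Proof.
  intros Hx. assert (Hr : 0 < x ^ 2 + y ^ 2) by nra. unfold angA.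
  set (r := x ^ 2 + y ^ 2) in *.
  replace (x ^ 2 * (x ^ 4 - 6 * x ^ 2 * y ^ 2 + y ^ 4)) with
    (x ^ 2 * (r ^ 2 - 8 * (x ^ 2 * y ^ 2))) by (unfold r; ring).
  assert (0 < r ^ 3) by now apply pow_lt.
  assert (0 <= x ^ 2 <= r) by (unfold r; nra).
  assert (0 <= 8 * (x ^ 2 * y ^ 2) <= 2 * r ^ 2).
  { pose proof (pow2_ge_0 (x * y)). pose proof (pow2_ge_0 (x ^ 2 - y ^ 2)). unfold r; nra. }
  apply Rabs_le; split.
  - apply Rle_div_r; [assumption|]. simpl (r ^ 3). nra.
  - apply Rle_div_l; [assumption|]. simpl (r ^ 3). nra.
Qed.

Lemma angA'_bound x y : 0 < x -> 0 <= y -> Rabs (angA' x y) <= 9 / x.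
Proof.
  intros Hx Hy. assert (Hr : 0 < x ^ 2 + y ^ 2) by nra. unfold angA'.
  set (r := x ^ 2 + y ^ 2) in *.
  assert (H4 : 0 < r ^ 4) by now apply pow_lt.
  replace (x ^ 2 * (- 18 * x ^ 4 * y + 28 * x ^ 2 * y ^ 3 - 2 * y ^ 5)) with
    (x ^ 2 * y * (- 18 * x ^ 4 + 28 * x ^ 2 * y ^ 2 - 2 * y ^ 4)) by ring.
  assert (HB : Rabs (- 18 * x ^ 4 + 28 * x ^ 2 * y ^ 2 - 2 * y ^ 4) <= 18 * r ^ 2).
  { unfold r. pose proof (pow2_ge_0 (x * y)). pose proof (pow2_ge_0 (x ^ 2)). pose proof (pow2_ge_0 (y ^ 2)).
    apply Rabs_le; nra. }
  unfold Rdiv. rewrite !Rabs_mult, (Rabs_pos_eq (/ _)) by (apply Rlt_le, Rinv_0_lt_compat, H4).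
  rewrite (Rabs_pos_eq (x ^ 2)), (Rabs_pos_eq y) by nra.
  apply Rmult_le_reg_r with (r ^ 4); [assumption|]. rewrite Rmult_assoc, Rinv_l, Rmult_1_r by lra.
  apply Rmult_le_reg_r with x; [assumption|].
  replace (9 * / x * r ^ 4 * x) with (9 * r ^ 4) by (field; lra).
  assert (Hxy : 0 <= x * y <= r / 2) by (unfold r; pose proof (pow2_ge_0 (x - y)); nra).
  assert (Hxx : 0 <= x ^ 2 <= r) by (unfold r; nra).
  set (B := Rabs _) in *. assert (0 <= B) by apply Rabs_pos.
  replace (x ^ 2 * y * B * x) with ((x ^ 2 * (x * y)) * B) by ring.
  replace (9 * r ^ 4) with ((r * (r / 2)) * (18 * r ^ 2)) by field.
  apply Rmult_le_compat; try assumption.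
  - apply Rmult_le_pos; lra.
  - apply Rmult_le_compat; lra.
Qed.

(** Compares the sum with the integral, starting from [angF x 0 = 0]. On each unit step the mean
    value theorem gives [angA] at a nearby point, and moving it to the left end costs the Lipschitz
    constant 9 / x. *)
Lemma column_telescope x m : 0 < x ->
  Rabs (lsum (fun j => angA x (INR j)) (seq 0 m) - angF x (INR m)) <= INR m * (9 / x).
Proof.
  intros Hx. induction m as [|m IH].
  - replace (_ - _) with 0 by (unfold lsum, angF, Rdiv; simpl; ring).
    rewrite Rabs_R0; simpl; lra.
  - rewrite lsum_seq_S, S_INR. pose proof (pos_INR m) as Hm.
    set (s := lsum _ _) in *.
    replace (s + angA x (INR m) - angF x (INR m + 1)) with
      ((s - angF x (INR m)) + (angA x (INR m) - (angF x (INR m + 1) - angF x (INR m)))) by ring.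
    apply Rle_trans with (1 := Rabs_triang _ _).
    rewrite Rmult_plus_distr_r, Rmult_1_l. apply Rplus_le_compat; [exact IH|].
    destruct (MVT_gen (angF x) (INR m) (INR m + 1) (angA x)) as (c & Hc & E).
    + intros; now apply angF_derive.
    + intros. apply derivable_continuous_pt, ex_derive_Reals_0. eexists; now apply angF_derive.
    + rewrite Rmin_left, Rmax_right in Hc by lra. rewrite E.
      replace (angA x (INR m) - angA x c * (INR m + 1 - INR m)) with (- (angA x c - angA x (INR m))) by ring.
      rewrite Rabs_Ropp.
      apply Rle_trans with (9 / x * (c - INR m)).
      * apply Lipschitz_of_derive with (angA' x); [lra|intros; now apply angA_derive|].
        intros; apply angA'_bound; lra.
      * assert (0 < 9 / x) by (apply Rdiv_lt_0_compat; lra). nra.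
Qed.

Definition circF (n x : R) : R := x ^ 2 * sqrt (n ^ 2 - x ^ 2) * (2 * x ^ 2 - n ^ 2) / n ^ 4.

Lemma angF_circle n x : 0 <= x <= n -> 0 < n -> angF x (sqrt (n ^ 2 - x ^ 2)) = circF n x.
Proof.
  intros Hx Hn. unfold angF, circF. rewrite pow2_sqrt by nra. field. nra.
Qed.

Lemma column_estimate (n i : nat) : (i <= n)%nat ->
  Rabs (lsum (fun j => if Nat.leb (i * i + j * j) (n * n) then angA (INR i) (INR j) else 0) (seq 0 (S n))
        - circF (INR n) (INR i)) <= 18 * (INR n + 1) * / (INR i + 1) + 1.
Proof.
  intros Hi. destruct (Nat.eq_dec i 0) as [->|Hi0].
  (* In column 0 the factor x^2 makes every term vanish, including the quotient 0 / 0 at the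
     origin. *)
  - assert (0 <= 18 * (INR n + 1) * / (INR 0 + 1)).
    { pose proof (pos_INR n).
      apply Rmult_le_pos; [lra|apply Rlt_le, Rinv_0_lt_compat; simpl; lra]. }
    rewrite (lsum_ext _ (fun _ => 0)).
    + rewrite lsum_const. unfold circF. simpl (INR 0) in *. unfold Rdiv.
      match goal with |- Rabs ?z <= _ => replace z with 0 by ring end. rewrite Rabs_R0. lra.
    + intros j _. unfold angA. simpl (INR 0). unfold Rdiv.
      destruct (Nat.leb _ _); ring.
  - assert (Hx : 1 <= INR i) by (apply (le_INR 1); lia).
    assert (Hxn : INR i <= INR n) by now apply le_INR.
    (* The column holds Y + 1 points, so telescoping ends at height Y + 1, above the circle by at
       most 1. Since |angA| <= 1, returning to the circle costs the final summand 1. *)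
    set (Y := Nat.sqrt (n * n - i * i)).
    pose proof (Nat.sqrt_spec (n * n - i * i) (Nat.le_0_l _)) as [HY1 HY2]. fold Y in HY1, HY2.
    assert (Hii : (i * i <= n * n)%nat) by nia.
    rewrite (lsum_prefix (fun j => angA (INR i) (INR j)) _ (S Y)).
    2: nia.
    2:{ intros j _. rewrite Nat.leb_le. split; intros; nia. }
    set (x := INR i) in *.
    set (y := sqrt (INR n ^ 2 - x ^ 2)).
    assert (Hy2 : y * y = INR n ^ 2 - x ^ 2) by (apply sqrt_sqrt; nra).
    assert (Hy0 : 0 <= y) by apply sqrt_pos.
    assert (HYn : (S Y <= S n)%nat) by nia.
    apply le_INR in HYn. rewrite S_INR, (S_INR n) in HYn.
    assert (HYy : INR Y <= y <= INR Y + 1).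
    { rewrite <- S_INR. apply le_INR in HY1.
      assert (HY3 : INR (S (n * n - i * i)) <= INR (S Y * S Y)) by (apply le_INR; lia).
      rewrite S_INR, minus_INR, !mult_INR in HY3 by lia.
      rewrite minus_INR, !mult_INR in HY1 by lia. fold x in HY1, HY3.
      pose proof (pos_INR Y). pose proof (pos_INR (S Y)). split; nra. }
    rewrite <- angF_circle by lra. fold y.
    replace (_ - _) with ((lsum (fun j => angA x (INR j)) (seq 0 (S Y)) - angF x (INR (S Y)))
      + (angF x (INR (S Y)) - angF x y)) by ring.
    apply Rle_trans with (1 := Rabs_triang _ _).
    apply Rplus_le_compat.
    + apply Rle_trans with (1 := column_telescope x (S Y) ltac:(lra)).
      apply Rle_trans with ((INR n + 1) * (18 * / (x + 1))); [|lra].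
      pose proof (pos_INR Y).
      apply Rmult_le_compat; [rewrite S_INR; lra| |rewrite S_INR; lra|].
      * apply Rlt_le, Rdiv_lt_0_compat; lra.
      * apply Rmult_le_reg_r with (x * (x + 1)); [nra|].
        replace (9 / x * (x * (x + 1))) with (9 * (x + 1)) by (field; lra).
        replace (18 * / (x + 1) * (x * (x + 1))) with (18 * x) by (field; lra). lra.
    + apply Rle_trans with (1 * (INR (S Y) - y)).
      * apply Lipschitz_of_derive with (angA x); [rewrite S_INR; lra| |];
          intros; [apply angF_derive|apply angA_bound]; lra.
      * rewrite S_INR; lra.
Qed.

(** With y = sqrt(n^2 - x^2) this is x^3 y^3 / n^4. It vanishes at both ends of [0, n], which is why
    the boundary values of the columns cancel. *)
Definition circG (n x : R) : R := x ^ 3 * (n ^ 2 - x ^ 2) * sqrt (n ^ 2 - x ^ 2) / n ^ 4.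

Lemma circG_derive n x : 0 < x < n -> is_derive (circG n) x (- 3 * circF n x).
Proof.
  intros Hx. assert (Hw : 0 < n ^ 2 - x ^ 2) by nra.
  pose proof (sqrt_lt_R0 _ Hw) as Hs. pose proof (sqrt_sqrt _ (Rlt_le _ _ Hw)) as Hss.
  unfold circG, circF. auto_derive.
  - nra.
  - replace (n * (n * 1) + - (x * (x * 1))) with (n ^ 2 - x ^ 2) by ring.
    replace (n ^ 2 + - x ^ 2) with (n ^ 2 - x ^ 2) by ring.
    set (w := sqrt (n ^ 2 - x ^ 2)) in *.
    field_simplify_eq; [|split; lra].
    replace (w ^ 2) with (n ^ 2 - x ^ 2) by (rewrite <- Hss; ring). ring.
Qed.

Lemma circG_cont n x : 0 <= x <= n -> 0 < n -> continuity_pt (circG n) x.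
Proof.
  intros Hx Hn. unfold circG.
  apply continuity_pt_mult; [|apply continuity_pt_const; intros ? ?; reflexivity].
  apply continuity_pt_mult; [reg|].
  apply (continuity_pt_comp (fun x => n ^ 2 - x ^ 2) sqrt); [reg|].
  apply continuity_pt_sqrt; nra.
Qed.

(** The circle is vertical at x = n, so a unit step may cost sqrt(n). The polynomial factor p has
    slope at most 10 / n and multiplies w <= n; conversely |p| <= 1, and the change of w is at most
    the square root of the change of w^2. *)
Lemma circF_modulus n x c : 1 <= n -> 0 <= x -> x <= c <= x + 1 -> c <= n ->
  Rabs (circF n c - circF n x) <= 12 * sqrt n.
Proof.
  intros Hn Hx Hc Hcn.
  set (p := fun t => t ^ 2 * (2 * t ^ 2 - n ^ 2) / n ^ 4).
  set (w := fun t => sqrt (n ^ 2 - t ^ 2)).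
  assert (H4 : 0 < n ^ 4) by (apply pow_lt; lra).
  replace (circF n c - circF n x) with ((p c - p x) * w c + p x * (w c - w x))
    by (unfold circF, p, w; field; lra).
  assert (Hp : Rabs (p c - p x) <= 10 / n).
  { apply Rle_trans with (10 / n * (c - x)).
    - apply Lipschitz_of_derive with (fun t => (8 * t ^ 3 - 2 * t * n ^ 2) / n ^ 4); [lra| |].
      + intros t _; unfold p. auto_derive; [exact I|]. field. lra.
      + intros t Ht. assert (0 <= t <= n) by lra.
        assert (0 <= t ^ 3 <= n ^ 3) by (split; [apply pow_le; lra|apply pow_incr; lra]).
        assert (0 <= t * n ^ 2 <= n ^ 3).
        { simpl (n ^ 3). assert (0 <= n ^ 2) by apply pow2_ge_0. nra. }
        replace (10 / n) with (10 * n ^ 3 / n ^ 4) by (field; lra).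
        unfold Rdiv. rewrite Rabs_mult, (Rabs_pos_eq (/ _)) by (apply Rlt_le, Rinv_0_lt_compat, H4).
        apply Rmult_le_compat_r; [apply Rlt_le, Rinv_0_lt_compat, H4|].
        apply Rabs_le; lra.
    - assert (0 < 10 / n) by (apply Rdiv_lt_0_compat; lra). nra. }
  assert (Hpx : Rabs (p x) <= 1).
  { assert (0 <= x ^ 2 <= n ^ 2) by (split; [apply pow2_ge_0|apply pow_incr; lra]).
    unfold p. apply Rabs_le; split; [apply Rle_div_r|apply Rle_div_l]; try assumption;
    replace (n ^ 4) with (n ^ 2 * n ^ 2) by ring; nra. }
  assert (Hwc : 0 <= w c <= n).
  { split; [apply sqrt_pos|]. unfold w. rewrite <- (sqrt_pow2 n) at 2 by lra.
    apply sqrt_le_1_alt. nra. }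
  assert (Hs : sqrt n * sqrt n = n) by (apply sqrt_sqrt; lra).
  assert (Hs1 : 1 <= sqrt n) by (apply sqrt_ge_1; lra).
  assert (Hw : Rabs (w c - w x) <= 2 * sqrt n).
  { assert (E1 : w c * w c = n ^ 2 - c ^ 2) by (apply sqrt_sqrt; nra).
    assert (E2 : w x * w x = n ^ 2 - x ^ 2) by (apply sqrt_sqrt; nra).
    assert (0 <= w x) by apply sqrt_pos.
    assert (Hm : w c <= w x) by (apply sqrt_le_1_alt; nra).
    rewrite Rabs_left1 by lra.
    assert ((w x - w c) ^ 2 <= (2 * sqrt n) ^ 2).
    { apply Rle_trans with (w x * w x - w c * w c); [nra|]. rewrite E1, E2. nra. }
    nra. }
  apply Rle_trans with (1 := Rabs_triang _ _). rewrite !Rabs_mult, (Rabs_pos_eq (w c)) by lra.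
  apply Rle_trans with (10 / n * n + 1 * (2 * sqrt n)).
  - apply Rplus_le_compat; apply Rmult_le_compat; try apply Rabs_pos; lra.
  - replace (10 / n * n) with 10 by (field; lra). lra.
Qed.

(** A left Riemann sum for the derivative of -circG / 3: each unit step costs [circF_modulus], and
    [circG] is zero at both ends. The last column lies at a zero of [circF], so n steps suffice. *)
Lemma circF_sum (n : nat) : Rabs (lsum (fun i => circF (INR n) (INR i)) (seq 0 (S n))) <= 12 * err n.
Proof.
  destruct (Nat.eq_dec n 0) as [->|Hn0].
  { match goal with |- Rabs ?a <= _ =>
      replace a with 0 by (unfold lsum, circF, Rdiv; simpl; ring) end.
    pose proof (err_ge 0). rewrite Rabs_R0; simpl in *; lra. }
  assert (Hn : 1 <= INR n) by (apply (le_INR 1); lia).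
  set (N := INR n) in *.
  assert (Step : forall m, (m <= n)%nat ->
    Rabs (lsum (fun i => circF N (INR i)) (seq 0 m) + / 3 * circG N (INR m)) <= INR m * (12 * sqrt N)).
  { induction m as [|m IH]; intros Hm.
    - match goal with |- Rabs ?a <= _ =>
        replace a with 0 by (unfold lsum, circG, Rdiv; simpl; ring) end.
      rewrite Rabs_R0; simpl; lra.
    - specialize (IH ltac:(lia)). rewrite lsum_seq_S, S_INR. 
      apply le_INR in Hm. rewrite S_INR in Hm. fold N in Hm. pose proof (pos_INR m) as Hm0.
      (* [circG_derive] covers only the open interval (0, N); at its ends continuity is enough for
         the mean value theorem. *)
      destruct (MVT_gen (circG N) (INR m) (INR m + 1) (fun t => - 3 * circF N t)) as (c & Hc & E).
      + intros t Ht. rewrite Rmin_left, Rmax_right in Ht by lra. apply circG_derive; lra.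
      + intros t Ht. rewrite Rmin_left, Rmax_right in Ht by lra. apply circG_cont; lra.
      + rewrite Rmin_left, Rmax_right in Hc by lra.
        set (s := lsum _ _) in *.
        replace (s + circF N (INR m) + / 3 * circG N (INR m + 1)) with
          ((s + / 3 * circG N (INR m)) + - (circF N c - circF N (INR m))).
        2:{ replace (circG N (INR m + 1)) with (circG N (INR m) + -3 * circF N c * (INR m + 1 - INR m))
              by (rewrite <- E; ring). field. }
        apply Rle_trans with (1 := Rabs_triang _ _). rewrite Rabs_Ropp.
        pose proof (circF_modulus N (INR m) c Hn Hm0 Hc ltac:(lra)). lra. }
  specialize (Step n (le_n n)). rewrite lsum_seq_S. fold N in Step |- *.
  assert (E1 : circG N N = 0) by (unfold circG; rewrite Rminus_diag, sqrt_0; unfold Rdiv; ring).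
  assert (E2 : circF N N = 0) by (unfold circF; rewrite Rminus_diag, sqrt_0; unfold Rdiv; ring).
  rewrite E1 in Step. rewrite E2. rewrite Rmult_0_r in Step.
  apply Rle_trans with (1 := Step). unfold err. fold N.
  assert (sqrt N <= sqrt (N + 1)) by (apply sqrt_le_1_alt; lra).
  pose proof (sqrt_pos N). nra.
Qed.

Lemma dsum_angA n : Rabs (dsum n (fun i j => angA (INR i) (INR j))) <= 49 * err n.
Proof.
  unfold dsum.
  rewrite (lsum_ext _ (fun i => 1 * (lsum (fun j => if Nat.leb (i * i + j * j) (n * n)
     then angA (INR i) (INR j) else 0) (seq 0 (S n)) - circF (INR n) (INR i))
     + 1 * circF (INR n) (INR i))) by (intros; ring).
  rewrite (lsum_lin _ (fun i => circF (INR n) (INR i))).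
  apply Rle_trans with (1 := Rabs_triang _ _). rewrite !Rmult_1_l.
  pose proof (circF_sum n).
  assert (X : Rabs (lsum (fun i => lsum (fun j => if Nat.leb (i * i + j * j) (n * n)
     then angA (INR i) (INR j) else 0) (seq 0 (S n)) - circF (INR n) (INR i)) (seq 0 (S n))) <= 37 * err n).
  { apply Rle_trans with (1 := lsum_abs _ _).
    apply Rle_trans with (lsum (fun i => 18 * (INR n + 1) * / (INR i + 1) + 1 * 1) (seq 0 (S n))).
    - apply lsum_le; intros i Hi; apply in_seq in Hi. rewrite Rmult_1_r.
      apply column_estimate; lia.
    - rewrite (lsum_lin (fun i => / (INR i + 1)) (fun _ => 1)), lsum_const, length_seq, S_INR.
      pose proof (lsum_inv_le n). pose proof (err_ge n). pose proof (pos_INR n).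
      assert (18 * (INR n + 1) * lsum (fun i => / (INR i + 1)) (seq 0 (S n))
        <= 18 * (INR n + 1) * (2 * sqrt (INR n + 1))) by (apply Rmult_le_compat_l; lra).
      unfold err in *. lra. }
  lra.
Qed.

(** As a function of the polar angle, [csec] has only the even frequencies 0, 2 and 4. The sum
    [angA x y + angA y x] is cos(4 theta), since the weights cos^2 and sin^2 add up to 1, and the
    last quotient is cos(2 theta). *)
Lemma csec_decompose k1 k2 x y : 0 < k1 ^ 2 + k2 ^ 2 -> 0 < x ^ 2 + y ^ 2 ->
  let K := k1 ^ 2 + k2 ^ 2 in
  csec k1 k2 x y - 3 * K / (32 * PI ^ 2) =
  ((k1 ^ 4 + k2 ^ 4) / 4 - 3 / 2 * k1 ^ 2 * k2 ^ 2) / (8 * PI ^ 2 * K) * (angA x y + angA y x)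
  + (k2 ^ 4 - k1 ^ 4) / (8 * PI ^ 2 * K) * ((x ^ 2 - y ^ 2) / (x ^ 2 + y ^ 2)).
Proof.
  intros HK HL K. unfold csec, angA, K. pose proof PI_RGT_0.
  field. repeat split; lra.
Qed.

Lemma csec_average k1 k2 : 0 < k1 ^ 2 + k2 ^ 2 -> exists C, 0 <= C /\ forall n,
  Rabs (dsum n (fun i j => csec k1 k2 (INR i) (INR j) - 3 * (k1 ^ 2 + k2 ^ 2) / (32 * PI ^ 2)))
  <= C * err n.
Proof.
  intros HK. set (K := k1 ^ 2 + k2 ^ 2) in *.
  set (c := 3 * K / (32 * PI ^ 2)).
  set (P := ((k1 ^ 4 + k2 ^ 4) / 4 - 3 / 2 * k1 ^ 2 * k2 ^ 2) / (8 * PI ^ 2 * K)).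
  set (Q := (k2 ^ 4 - k1 ^ 4) / (8 * PI ^ 2 * K)).
  set (A := fun i j => angA (INR i) (INR j)).
  set (D := fun i j : nat => (INR i ^ 2 - INR j ^ 2) / (INR i ^ 2 + INR j ^ 2)).
  assert (Hc : 0 <= c).
  { unfold c. pose proof PI_sq_gt_1. apply Rdiv_le_0_compat; lra. }
  exists (Rabs P * 98 + 2 * c).
  split; [pose proof (Rabs_pos P); lra|]. intros n.
  set (g' := fun i j => P * (1 * A i j + 1 * A j i) + Q * D i j).
  rewrite (dsum_ext n _ (fun i j => 1 * g' i j +
     1 * (csec k1 k2 (INR i) (INR j) - c - g' i j))) by (intros; ring).
  rewrite (dsum_lin n g'). apply Rle_trans with (1 := Rabs_triang _ _). rewrite !Rmult_1_l.
  assert (ED : dsum n D = 0).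
  { assert (dsum n D = -1 * dsum n D + 0 * dsum n D); [|lra].
    rewrite <- (dsum_swap n D) at 1. rewrite <- dsum_lin. apply dsum_ext; intros i j.
    unfold D, Rdiv. rewrite (Rplus_comm (INR j ^ 2)). ring. }
  assert (Eg : dsum n g' = P * (2 * dsum n A)).
  { unfold g'. rewrite (dsum_lin n (fun i j => 1 * A i j + 1 * A j i)), ED.
    rewrite (dsum_lin n A (fun i j => A j i)), dsum_swap. ring. }
  rewrite Eg, !Rabs_mult, (Rabs_pos_eq 2) by lra.
  pose proof (dsum_angA n) as HA. fold A in HA.
  assert (Hz : Rabs (dsum n (fun i j => csec k1 k2 (INR i) (INR j) - c - g' i j)) <= 2 * c * err n).
  { apply Rle_trans with (dsum n (fun i j => c * / (INR i + 1) + 0 * 0)).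
    - apply dsum_abs_le. intros i j.
      (* The decomposition fails only at the origin, where all quotients are 0 and the difference is
         -c; the bound c / (i + 1) equals c there. *)
      destruct (Rlt_dec 0 (INR i ^ 2 + INR j ^ 2)) as [Hp|Hp].
      + pose proof (csec_decompose k1 k2 (INR i) (INR j) HK Hp) as E. cbv zeta in E.
        fold K P Q in E. fold c in E. rewrite E. unfold g', A, D.
        match goal with |- Rabs ?z <= _ => replace z with 0 by ring end.
        rewrite Rabs_R0. assert (0 < / (INR i + 1)).
        { apply Rinv_0_lt_compat; pose proof (pos_INR i); lra. }
        nra.
      + assert (INR i = 0 /\ INR j = 0) as [Ei Ej].
        { pose proof (pos_INR i). pose proof (pos_INR j). split; nra. }
        unfold g', A, D, csec, angA. rewrite Ei, Ej. unfold Rdiv.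
        match goal with |- Rabs ?z <= _ => replace z with (- c) by ring end.
        rewrite Rabs_Ropp, Rabs_pos_eq, Rplus_0_l, Rinv_1 by assumption. lra.
    - rewrite (dsum_lin n (fun i _ => / (INR i + 1)) (fun _ _ => 0)). pose proof (dsum_inv_l n). nra. }
  pose proof (Rabs_pos P). nra.
Qed.

(** * The Ricci curvature *)

Definition xtrig (n : nat) (t : R) : R := if Nat.odd n then cos t else sin t.

Lemma cos_xphase n : exists sg, sg * sg = 1 /\ forall t, cos (t - xphase n) = sg * xtrig n t.
Proof.
  unfold xtrig. destruct (Nat.odd n) eqn:E.
  - destruct (xphase_odd n E) as [j ->]. exists (cos (IZR (- j) * PI)).
    split; [apply cos_ZPI_sq|]. intros t. rewrite <- cos_add_ZPI, opp_IZR. f_equal; ring.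
  - assert (He : Nat.even n = true) by (rewrite <- Nat.negb_odd, E; reflexivity).
    apply Nat.even_spec in He as [j ->]. exists (cos (IZR (- Z.of_nat j) * PI)).
    split; [apply cos_ZPI_sq|]. intros t. rewrite sin_as_cos, <- cos_add_ZPI, opp_IZR, <- INR_IZR_INZ.
    unfold xphase. rewrite mult_INR. f_equal. simpl. field.
Qed.

(** The sign between a shifted cosine and the plain sine or cosine of the basis is absorbed by the
    amplitude. *)
Lemma nwave_of_product r k1 k2 q : exists sg, sg * sg = 1 /\
  forall x y, nwave (sg * r) k1 k2 q x y = r * xtrig k2 (INR k1 * x) * cos (INR k2 * y - q).
Proof.
  destruct (cos_xphase k2) as (sg & Hs & H). exists sg; split; [exact Hs|]. intros x y.
  unfold nwave, kwave, wave. rewrite <- !INR_IZR_INZ. fold (xphase k2). rewrite H.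
  replace (sg * r * (sg * xtrig k2 (INR k1 * x)) * cos (INR k2 * y - q))
    with ((sg * sg) * (r * xtrig k2 (INR k1 * x) * cos (INR k2 * y - q))) by ring.
  rewrite Hs; ring.
Qed.

Definition inJ (i j : nat) (t : btype) : bool :=
  match t with ReT => inJRe i j | ImT => inJIm i j end.

Lemma basis_fun_nwave i j t : inJ i j t = true ->
  exists s q, s <> 0 /\ nondegenerate i j q /\ basis_fun i j t = nwave s i j q.
Proof.
  intros HJ.
  set (q := match t, Nat.odd j with ReT, true | ImT, false => 0 | _, _ => PI / 2 end).
  destruct (nwave_of_product 4 i j q) as (sg & Hs & H).
  exists (sg * 4), q. split; [nra|]. split.
  - assert (Hi : i = 0%nat -> Nat.odd j = true).
    { intros ->. rewrite <- Nat.negb_even. unfold inJ, inJRe, inJIm in HJ.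
      destruct t; simpl in HJ; destruct (Nat.even j); auto; now rewrite andb_false_r in HJ. }
    split; [exact Hi|]. intros ->. destruct t; [discriminate|reflexivity].
  - apply fn2_ext; intros x y. rewrite H. unfold basis_fun, xtrig, q.
    destruct t, (Nat.odd j); rewrite ?sin_as_cos, ?Rminus_0_r; reflexivity.
Qed.

Lemma polar A B : A <> 0 \/ B <> 0 -> exists r q, r <> 0 /\ A = r * cos q /\ B = r * sin q.
Proof.
  intros H. set (r := sqrt (A ^ 2 + B ^ 2)).
  assert (Hp : 0 < A ^ 2 + B ^ 2) by (destruct H; nra).
  assert (Hr : 0 < r) by now apply sqrt_lt_R0.
  assert (Hrr : r * r = A ^ 2 + B ^ 2) by (apply sqrt_sqrt; lra).
  set (c := A / r). set (s := B / r).
  assert (Hcs : c ^ 2 + s ^ 2 = 1).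
  { unfold c, s. replace ((A / r) ^ 2 + (B / r) ^ 2) with ((A ^ 2 + B ^ 2) / (r * r)) by (field; lra).
    rewrite Hrr; field; lra. }
  assert (Hc : -1 <= c <= 1) by nra.
  assert (Hsin : sin (acos c) = Rabs s).
  { rewrite sin_acos by assumption. rewrite <- sqrt_Rsqr_abs. f_equal. unfold Rsqr. lra. }
  exists r. destruct (Rle_dec 0 s) as [P|P].
  - exists (acos c). rewrite cos_acos, Hsin, Rabs_pos_eq by assumption.
    unfold c, s. repeat split; [lra|field; lra..].
  - exists (- acos c). rewrite cos_neg, sin_neg, cos_acos, Hsin, Rabs_left1 by lra.
    unfold c, s. repeat split; [lra|field; lra..].
Qed.

(** The sign (-1)^(k2 + 1) combines the terms at k and kbar so that only the cosine in [x] (k2 odd)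
    or only the sine (k2 even) survives. *)
Lemma xi_k_product k1 k2 a : exists A B, forall x y,
  xi_k k1 k2 a x y = xtrig k2 (INR k1 * x) * (A * cos (INR k2 * y) + B * sin (INR k2 * y)).
Proof.
  assert (E : forall x y, xi_k k1 k2 a x y =
    let X := INR k1 * x in let Y := INR k2 * y in let s := (-1) ^ (k2 + 1) in
    2 * (fst a * (cos X * cos Y - sin X * sin Y) - snd a * (sin X * cos Y + cos X * sin Y))
    + 2 * s * (fst a * (cos X * cos Y + sin X * sin Y) + snd a * (sin X * cos Y - cos X * sin Y))).
  { intros x y. unfold xi_k, ek. destruct a as [al be]. simpl fst; simpl snd.
    unfold Re, Cplus, Cmult, Cconj, RtoC. cbn [fst snd].
    replace (- INR k1 * x + - INR k2 * y) with (- (INR k1 * x + INR k2 * y)) by ring.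
    replace (- INR k1 * x + INR k2 * y) with (- (INR k1 * x - INR k2 * y)) by ring.
    replace (INR k1 * x + - INR k2 * y) with (INR k1 * x - INR k2 * y) by ring.
    rewrite !cos_neg, !sin_neg, cos_plus, sin_plus, cos_minus, sin_minus. ring. }
  unfold xtrig. destruct (Nat.odd k2) eqn:Ho.
  - exists (4 * fst a), (- 4 * snd a). intros x y. rewrite E; cbv zeta.
    apply Nat.odd_spec in Ho as [j Hj].
    replace ((-1) ^ (k2 + 1)) with 1; [ring|].
    rewrite Hj. replace (2 * j + 1 + 1)%nat with (2 * (j + 1))%nat by lia. now rewrite pow_1_even.
  - exists (- 4 * snd a), (- 4 * fst a). intros x y. rewrite E; cbv zeta.
    assert (He : Nat.even k2 = true) by (rewrite <- Nat.negb_odd, Ho; reflexivity).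
    apply Nat.even_spec in He as [j Hj].
    replace ((-1) ^ (k2 + 1)) with (-1); [ring|].
    rewrite Hj, Nat.add_1_r. now rewrite pow_1_odd.
Qed.

Lemma xi_k_nwave k1 k2 a : (exists x y, xi_k k1 k2 a x y <> 0) ->
  exists r q, r <> 0 /\ nondegenerate k1 k2 q /\ xi_k k1 k2 a = nwave r k1 k2 q.
Proof.
  intros (x0 & y0 & Hne). destruct (xi_k_product k1 k2 a) as (A & B & E).
  rewrite E in Hne.
  assert (H1 : k1 = 0%nat -> Nat.odd k2 = true).
  { intros Z. destruct (Nat.odd k2) eqn:Ho; [reflexivity|exfalso].
    apply Hne. unfold xtrig. rewrite Ho, Z. simpl (INR 0). rewrite Rmult_0_l, sin_0; ring. }
  assert (H2 : exists r q, r <> 0 /\ (k2 = 0%nat -> q = 0) /\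
    forall y, A * cos (INR k2 * y) + B * sin (INR k2 * y) = r * cos (INR k2 * y - q)).
  { destruct (Nat.eq_dec k2 0) as [Z|Z].
    (* The factor in [y] is now the constant [A], and phase 0 is the normalization that
       [nondegenerate] asks for. *)
    - exists A, 0. rewrite Z in *. simpl (INR 0) in *. split; [|split; [reflexivity|]].
      + intros HA. apply Hne. rewrite Rmult_0_l, sin_0, HA; ring.
      + intros y. rewrite Rmult_0_l, sin_0, Rminus_0_r; ring.
    - destruct (polar A B) as (r & q & Hr & EA & EB).
      + destruct (Req_dec A 0) as [HA|HA]; [right|now left]. intros HB.
        apply Hne. rewrite HA, HB; ring.
      + exists r, q. split; [exact Hr|]. split; [contradiction|].
        intros y. rewrite EA, EB, cos_minus; ring. }
  destruct H2 as (r & q & Hr & Hq & Hy).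
  destruct (nwave_of_product r k1 k2 q) as (sg & Hs & H).
  exists (sg * r), q. split; [|split].
  - apply Rmult_integral_contrapositive_currified; [|exact Hr]. intros Z; rewrite Z in Hs; lra.
  - now split.
  - apply fn2_ext; intros x y. rewrite E, H, Hy; ring.
Qed.

Lemma lsum_basis_index n (h : nat * nat * btype -> R) : lsum h (basis_index n) =
  dsum n (fun i j => (if inJRe i j then h (i, j, ReT) else 0) + (if inJIm i j then h (i, j, ImT) else 0)).
Proof.
  unfold basis_index, dsum. rewrite lsum_flat_map. apply lsum_ext; intros i _.
  rewrite lsum_flat_map. apply lsum_ext; intros j _.
  destruct (Nat.leb _ _); [|reflexivity].
  rewrite lsum_app. unfold lsum. destruct (inJRe i j), (inJIm i j); simpl; ring.
Qed.

Lemma le_lsum {T} (f : T -> R) s x : (forall y, 0 <= f y) -> In x s -> f x <= lsum f s.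
Proof.
  intros Hf. assert (P : forall s, 0 <= lsum f s).
  { induction s0; unfold lsum in *; simpl; [lra|]. specialize (Hf a). lra. }
  induction s as [|a s IH]; [contradiction|]. intros [->|H];
    change (f x <= f a + lsum f s) || change (f x <= f x + lsum f s).
  - specialize (P s). lra.
  - specialize (IH H). specialize (Hf a). lra.
Qed.

Lemma weight_pos i j : 0 < weight i j.
Proof.
  unfold weight. pose proof (pos_INR i). pose proof (pos_INR j).
  apply Rplus_lt_0_compat; apply Rinv_0_lt_compat; lra.
Qed.

(** Indices absent from the basis lie on the axes. Because the weight is at least 1 there, such
    modes may be counted as present at the cost of an admissible error. *)
Lemma weight_axis i j : (i = 0 \/ j = 0)%nat -> 1 <= weight i j.
Proof.
  unfold weight. pose proof (pos_INR i). pose proof (pos_INR j).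
  assert (0 < / (INR i + 1)) by (apply Rinv_0_lt_compat; lra).
  assert (0 < / (INR j + 1)) by (apply Rinv_0_lt_compat; lra).
  intros [-> | ->]; simpl (INR 0) in *; rewrite Rplus_0_l, Rinv_1 in *; lra.
Qed.

Definition ricterm (xi E : fn2) : R :=
  if excluded_middle_informative (inLine xi E) then 0 else sec xi E.

(** For L >= 8 K the mode is off the line of xi and [sec_estimate] applies. The other indices lie in
    a finite square; [M], the sum of all errors in it, bounds each of them, and the weight is at
    least 1 / (m + 1) on that square. *)
Lemma ricterm_bound r k1 k2 q : r <> 0 -> nondegenerate k1 k2 q ->
  0 < INR k1 ^ 2 + INR k2 ^ 2 -> exists C, 0 <= C /\ forall i j t, inJ i j t = true ->
  Rabs (ricterm (nwave r k1 k2 q) (basis_fun i j t) + csec (INR k1) (INR k2) (INR i) (INR j))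
    <= C * weight i j.
Proof.
  intros Hr Hd HK. set (K := INR k1 ^ 2 + INR k2 ^ 2) in *.
  set (h := fun i j t => Rabs (ricterm (nwave r k1 k2 q) (basis_fun i j t)
     + csec (INR k1) (INR k2) (INR i) (INR j))).
  destruct (INR_unbounded (8 * K)) as [m Hm].
  set (M := lsum (fun i => lsum (fun j => h i j ReT + h i j ImT) (seq 0 (S m))) (seq 0 (S m))).
  assert (Hh : forall i j t, 0 <= h i j t) by (intros; apply Rabs_pos).
  assert (Hin : forall i j t, (i <= m)%nat -> (j <= m)%nat -> h i j t <= M).
  { intros i j t Hi Hj. apply Rle_trans with (h i j ReT + h i j ImT).
    - pose proof (Hh i j ReT). pose proof (Hh i j ImT). destruct t; lra.
    - apply Rle_trans with (lsum (fun j => h i j ReT + h i j ImT) (seq 0 (S m))).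
      + apply (le_lsum (fun j => h i j ReT + h i j ImT)); [|apply in_seq; lia].
        intros y; pose proof (Hh i y ReT). pose proof (Hh i y ImT). lra.
      + apply (le_lsum (fun i => lsum (fun j => h i j ReT + h i j ImT) (seq 0 (S m))));
          [|apply in_seq; lia].
        intros y. apply Rle_trans with (lsum (fun _ => 0) (seq 0 (S m))); [rewrite lsum_const; lra|].
        apply lsum_le; intros z _; pose proof (Hh y z ReT). pose proof (Hh y z ImT). lra. }
  assert (HM : 0 <= M) by (apply Rle_trans with (2 := Hin 0%nat 0%nat ReT ltac:(lia) ltac:(lia)); apply Hh).
  set (C0 := 76 * K * (INR k1 + 1) + 76 * K * (INR k2 + 1) + 16 * K ^ 2).
  pose proof (pos_INR k1). pose proof (pos_INR k2). pose proof (pos_INR m) as Hm0.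
  assert (HC0 : 0 <= C0).
  { unfold C0. assert (0 <= 76 * K * (INR k1 + 1)) by (apply Rmult_le_pos; lra).
    assert (0 <= 76 * K * (INR k2 + 1)) by (apply Rmult_le_pos; lra).
    pose proof (pow2_ge_0 K). lra. }
  exists (C0 + M * (INR m + 1)). split; [nra|]. intros i j t HJ.
  pose proof (weight_pos i j) as Hw.
  destruct (Rle_dec (8 * K) (INR i ^ 2 + INR j ^ 2)) as [HL|HL].
  - apply Rle_trans with (C0 * weight i j).
    + destruct (basis_fun_nwave i j t HJ) as (s & q' & Hs & Hd' & Eb). rewrite Eb.
      unfold ricterm. destruct (excluded_middle_informative _) as [Hl|Hl].
      * exfalso. exact (nwave_not_inLine r s k1 k2 i j q q' Hs Hd' HK HL Hl).
      * apply sec_estimate; assumption.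
    + apply Rmult_le_compat_r; [lra|]. nra.
  - assert (Hbound : forall a b : nat, INR a ^ 2 + INR b ^ 2 < 8 * K -> (a <= m)%nat).
    { intros a b Hab. destruct (Nat.eq_dec a 0) as [->|]; [lia|].
      assert (1 <= INR a) by (apply (le_INR 1); lia).
      apply INR_le. pose proof (pow2_ge_0 (INR b)). nra. }
    assert (Hi : (i <= m)%nat) by (apply (Hbound i j); lra).
    assert (Hj : (j <= m)%nat) by (apply (Hbound j i); lra).
    apply Rle_trans with M; [apply (Hin i j t Hi Hj)|].
    apply Rle_trans with (M * (INR m + 1) * weight i j).
    + assert (1 <= (INR m + 1) * weight i j); [|nra].
      apply le_INR in Hi. pose proof (pos_INR i). pose proof (pos_INR j).
      assert (/ (INR m + 1) <= / (INR i + 1)) by (apply Rinv_le_contravar; lra).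
      assert (0 < / (INR j + 1)) by (apply Rinv_0_lt_compat; lra).
      unfold weight. apply Rle_trans with ((INR m + 1) * / (INR m + 1)); [right; field; lra|].
      apply Rmult_le_compat_l; lra.
    + apply Rmult_le_compat_r; lra.
Qed.

Lemma inJ_false_axis i j t : inJ i j t = false -> (i = 0 \/ j = 0)%nat.
Proof.
  unfold inJ, inJRe, inJIm. intros H.
  destruct i; [now left|]. destruct j; [now right|]. destruct t; discriminate.
Qed.

(** In terms of s = sqrt(n + 1) the error is C1 s^3 and the count at least s^4 / 2 - C2 s^3, so the
    quotient deviates from its limit by O(1 / s). The 1 subtracted from the count only adds c to the
    numerator. *)
Lemma ratio_limit (S N : nat -> R) c C1 C2 : 0 <= C1 -> 0 <= C2 ->
  (forall n, Rabs (S n + c * N n) <= C1 * err n) ->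
  (forall n, (INR n + 1) ^ 2 / 2 - C2 * err n <= N n) ->
  is_lim_seq (fun n => / (N n - 1) * S n) (- c).
Proof.
  intros H1 H2 HS HN. apply is_lim_seq_spec. intros eps. simpl.
  pose proof (cond_pos eps) as He. pose proof (Rabs_pos c) as Hc.
  (* The part 4 C2 + 4 of the threshold makes N - 1 >= s^4 / 4, and D / eps then brings the quotient
     below eps. *)
  set (D := 4 * (C1 + Rabs c)). set (T := 4 * C2 + 4 + D / eps).
  assert (HD : 0 <= D / eps) by (apply Rdiv_le_0_compat; unfold D; lra).
  destruct (INR_unbounded (T ^ 2)) as [m Hm]. exists m. intros n Hn.
  apply le_INR in Hn.
  set (s := sqrt (INR n + 1)). pose proof (pos_INR n).
  assert (Es : s * s = INR n + 1) by (apply sqrt_sqrt; lra).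
  assert (HT : T < s).
  { apply Rsqr_incrst_0; [|unfold T; lra|apply sqrt_pos]. unfold Rsqr. rewrite Es. nra. }
  assert (Hs : 4 * C2 + 4 < s) by (unfold T in HT; lra).
  specialize (HS n). specialize (HN n). unfold err in *. fold s in HS, HN. rewrite <- Es in *.
  assert (Hs3 : 1 <= s * s * s) by nra.
  assert (HN1 : s * s * s * s / 4 <= N n - 1).
  { assert (s * s * s * (4 * C2 + 4) <= s * s * s * s) by (apply Rmult_le_compat_l; lra).
    replace ((s * s) ^ 2 / 2) with (s * s * s * s / 2) in HN by field. lra. }
  assert (Hs4 : 0 < s * s * s * s) by (repeat apply Rmult_lt_0_compat; lra).
  replace (/ (N n - 1) * S n - - c) with ((S n + c * N n - c) / (N n - 1)) by (field; lra).
  unfold Rdiv. rewrite Rabs_mult, (Rabs_pos_eq (/ _)) by (apply Rlt_le, Rinv_0_lt_compat; lra).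
  apply Rlt_div_l; [lra|].
  apply Rle_lt_trans with ((C1 + Rabs c) * (s * s * s)).
  - apply Rle_trans with (1 := Rabs_triang _ _). rewrite Rabs_Ropp. nra.
  - apply Rlt_le_trans with (eps * (s * s * s * s / 4)); [|apply Rmult_le_compat_l; lra].
    assert (D < eps * s).
    { apply Rle_lt_trans with (eps * (D / eps)); [right; field; lra|].
      apply Rmult_lt_compat_l; [lra|]. unfold T in HT. lra. }
    unfold D in *. nra.
Qed.

Lemma sum_weight_abs n (g : nat -> nat -> R) C : 0 <= C ->
  (forall i j, Rabs (g i j) <= C * weight i j) -> Rabs (dsum n g) <= 4 * C * err n.
Proof.
  intros HC Hg.
  apply Rle_trans with (dsum n (fun i j => C * weight i j + 0 * 0)).
  - apply dsum_abs_le; intros; specialize (Hg i j); lra.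
  - rewrite (dsum_lin n weight (fun _ _ => 0)). pose proof (dsum_weight n). nra.
Qed.

(** The partial sums are compared with a model having two modes at every lattice point: each point
    then contributes -2 csec to the sum and 2 to the count, and the factor 2 drops out of the
    quotient. *)
Lemma Ric_nwave r k1 k2 q : r <> 0 -> nondegenerate k1 k2 q ->
  0 < INR k1 ^ 2 + INR k2 ^ 2 ->
  Ric_is (nwave r k1 k2 q) (- (3 * (INR k1 ^ 2 + INR k2 ^ 2) / (32 * PI ^ 2))).
Proof.
  intros Hr Hd HK.
  set (xi := nwave r k1 k2 q). set (c := 3 * (INR k1 ^ 2 + INR k2 ^ 2) / (32 * PI ^ 2)).
  set (cs := fun i j : nat => csec (INR k1) (INR k2) (INR i) (INR j)).
  destruct (ricterm_bound r k1 k2 q Hr Hd HK) as (C & HC & Hterm). fold xi in Hterm.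
  destruct (csec_average (INR k1) (INR k2) HK) as (C' & HC' & Hav). fold c in Hav.
  set (X := fun i j => (if inJRe i j then ricterm xi (basis_fun i j ReT) else 0)
                     + (if inJIm i j then ricterm xi (basis_fun i j ImT) else 0)).
  set (Y := fun i j => (if inJRe i j then 1 else 0) + (if inJIm i j then 1 else 0)).
  set (K := INR k1 ^ 2 + INR k2 ^ 2) in *.
  assert (Hcs : forall i j, 0 <= cs i j <= K).
  { intros i j. destruct (Rlt_dec 0 (INR i ^ 2 + INR j ^ 2)) as [HL|HL].
    - now apply csec_bound.
    - assert (INR i = 0 /\ INR j = 0) as [Ei Ej].
      { pose proof (pos_INR i). pose proof (pos_INR j). split; nra. }
      unfold cs, csec. rewrite Ei, Ej. unfold Rdiv.
      match goal with |- 0 <= ?z <= _ => replace z with 0 by ring end. lra. }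
  assert (HX : forall i j, Rabs (X i j + 2 * cs i j) <= 2 * (C + K) * weight i j).
  { assert (Hone : forall i j t, Rabs ((if inJ i j t then ricterm xi (basis_fun i j t) else 0) + cs i j)
       <= (C + K) * weight i j).
    { intros i j t. pose proof (weight_pos i j). destruct (inJ i j t) eqn:E.
      - apply Rle_trans with (1 := Hterm i j t E). nra.
      - pose proof (weight_axis i j (inJ_false_axis i j t E)).
        rewrite Rplus_0_l, Rabs_pos_eq by apply Hcs. specialize (Hcs i j). nra. }
    intros i j. unfold X.
    pose proof (Hone i j ReT) as B1. pose proof (Hone i j ImT) as B2. simpl inJ in B1, B2.
    match type of B1 with Rabs ?a <= _ => match type of B2 with Rabs ?b <= _ =>
      match goal with |- Rabs ?z <= _ => replace z with (a + b) by ring end end end.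
    apply Rle_trans with (1 := Rabs_triang _ _). lra. }
  assert (HY : forall i j, Rabs (Y i j - 2) <= 2 * weight i j).
  { intros i j. pose proof (weight_pos i j).
    pose proof (inJ_false_axis i j ReT) as A1. pose proof (inJ_false_axis i j ImT) as A2.
    simpl inJ in A1, A2. unfold Y.
    destruct (inJRe i j); [|pose proof (weight_axis i j (A1 eq_refl))];
    (destruct (inJIm i j); [|pose proof (weight_axis i j (A2 eq_refl))]); apply Rabs_le; lra. }
  assert (EN : forall n, INR (length (B_R n)) = dsum n Y).
  { intros n. unfold B_R. rewrite length_map.
    transitivity (lsum (fun _ => 1) (basis_index n)); [rewrite lsum_const; ring|].
    apply lsum_basis_index. }
  assert (ES : forall n, fold_right Rplus 0 (map (ricterm xi) (B_R n)) = dsum n X).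
  { intros n. unfold B_R. rewrite map_map.
    change (lsum (fun p => ricterm xi (let '(l1, l2, t) := p in basis_fun l1 l2 t)) (basis_index n)
      = dsum n X).
    apply lsum_basis_index. }
  unfold Ric_is.
  apply (is_lim_seq_incr_1 (fun n => ric_partial xi n)).
  apply is_lim_seq_ext with (fun n => / (dsum n Y - 1) * dsum n X).
  { intros n. rewrite <- EN, <- ES. reflexivity. }
  assert (HC1 : 0 <= c).
  { unfold c. pose proof PI_sq_gt_1. apply Rdiv_le_0_compat; lra. }
  (* The summands come from replacing [X] by -2 csec (4 * 2 (C + K)), from averaging csec (2 C'),
     and from replacing the count by 2 per point (4 * 2 c); the last replacement also gives the
     8. *)
  apply ratio_limit with (8 * (C + K) + 2 * C' + 8 * c) 8.
  - lra.
  - lra.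
  - intros n.
    replace (dsum n X + c * dsum n Y) with
      (dsum n (fun i j => X i j + 2 * cs i j) - 2 * dsum n (fun i j => cs i j - c)
       + c * dsum n (fun i j => Y i j - 2)).
    2:{ rewrite (dsum_ext n (fun i j => X i j + 2 * cs i j) (fun i j => 1 * X i j + 2 * cs i j)) by (intros; ring).
        rewrite (dsum_ext n (fun i j => cs i j - c) (fun i j => 1 * cs i j + (- c) * 1)) by (intros; ring).
        rewrite (dsum_ext n (fun i j => Y i j - 2) (fun i j => 1 * Y i j + (-2) * 1)) by (intros; ring).
        rewrite (dsum_lin n X cs), (dsum_lin n cs (fun _ _ => 1)), (dsum_lin n Y (fun _ _ => 1)). ring. }
    assert (0 <= C + K) by lra.
    pose proof (sum_weight_abs n (fun i j => X i j + 2 * cs i j) (2 * (C + K)) ltac:(lra) HX) as B1.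
    pose proof (sum_weight_abs n (fun i j => Y i j - 2) 2 ltac:(lra) HY) as B2.
    pose proof (Hav n) as B3.
    apply Rle_trans with (1 := Rabs_triang _ _). rewrite Rabs_mult, (Rabs_pos_eq c) by assumption.
    assert (B4 : Rabs (dsum n (fun i j => X i j + 2 * cs i j) - 2 * dsum n (fun i j => cs i j - c))
      <= Rabs (dsum n (fun i j => X i j + 2 * cs i j)) + 2 * Rabs (dsum n (fun i j => cs i j - c))).
    { apply Rle_trans with (1 := Rabs_triang _ _).
      rewrite Rabs_Ropp, Rabs_mult, (Rabs_pos_eq 2) by lra. lra. }
    change (Rabs (dsum n (fun i j => cs i j - c)) <= C' * err n) in B3.
    assert (c * Rabs (dsum n (fun i j => Y i j - 2)) <= c * (4 * 2 * err n))
      by now apply Rmult_le_compat_l.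
    lra.
  - intros n. pose proof (dsum_1_ge n).
    pose proof (sum_weight_abs n (fun i j => Y i j - 2) 2 ltac:(lra) HY) as B2.
    rewrite (dsum_ext n (fun i j => Y i j - 2) (fun i j => 1 * Y i j + (-2) * 1)) in B2 by (intros; ring).
    rewrite (dsum_lin n Y (fun _ _ => 1)) in B2.
    apply Rabs_le_between in B2. lra.
Qed.

Theorem theorem4 (k1 k2 : nat) (a : C) :
  (k1, k2) <> (0%nat, 0%nat) ->
  (exists x y, xi_k k1 k2 a x y <> 0) ->
  Ric_is (xi_k k1 k2 a) (- 3 * (INR k1 ^ 2 + INR k2 ^ 2) / (8 * S_T)) /\
  - 3 * (INR k1 ^ 2 + INR k2 ^ 2) / (8 * S_T)
    = - 3 * (INR k1 ^ 2 + INR k2 ^ 2) / (16 * S_K).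
Proof.
  intros Hk Hne. pose proof PI_RGT_0 as Hpi. split.
  - destruct (xi_k_nwave k1 k2 a Hne) as (r & q & Hr & Hd & ->).
    replace (- 3 * (INR k1 ^ 2 + INR k2 ^ 2) / (8 * S_T))
      with (- (3 * (INR k1 ^ 2 + INR k2 ^ 2) / (32 * PI ^ 2))) by (unfold S_T; field; lra).
    apply Ric_nwave; [assumption..|].
    pose proof (pos_INR k1). pose proof (pos_INR k2).
    destruct k1 as [|k1].
    + destruct k2 as [|k2]; [congruence|]. pose proof (lt_0_INR (S k2) ltac:(lia)). nra.
    + pose proof (lt_0_INR (S k1) ltac:(lia)). nra.
  - unfold S_K, S_T. field. lra.
Qed.
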